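(* Let $0<\alpha<n$, $1<p_1\le p_0<\infty$, $0<p_2\le\infty$, $1<q_1\le q_0<\infty$, $1<r_1\le r_0<\infty$ and $1<r_2\le\infty$. Assume that $$r_1<q_1,\quad\frac1{q_0}\le\frac{\alpha}{n}<\frac1{p_0},\quad\frac1{r_0}=\frac1{q_0}+\frac1{p_0}-\frac{\alpha}{n}.$$ Suppose that either (1) or (2) holds: (1) $0<r_2,p_2<\infty$ and $\frac{r_0}{p_0}=\frac{r_1}{p_1}=\frac{r_2}{p_2}$; (2) $r_2=p_2=\infty$ and $\frac{r_0}{p_0}=\frac{r_1}{p_1}$. Then there is a constant $C>0$, independent of $f$ and $g$, such that $$\|g\cdot I_\alpha f\|_{\mathcal{M}^{r_0}_{r_1,r_2}}\le C\|g\|_{\mathrm{W}\mathcal{M}^{q_0}_{q_1}}\|f\|_{\mathcal{M}^{p_0}_{p_1,p_2}}$$ for all measurable functions $f\in\mathcal{M}^{p_0}_{p_1,p_2}(\mathbb{R}^n)$ and $g\in\mathrm{W}\mathcal{M}^{q_0}_{q_1}(\mathbb{R}^n)$.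
   Context: For $0<\alpha<n$ the fractional integral operator is $I_\alpha f(x)=\int_{\mathbb{R}^n}\frac{f(y)}{|x-y|^{n-\alpha}}\,dy$ for measurable $f$ on $\mathbb{R}^n$. $L^0(\mathbb{R}^n)$ is the set of all measurable functions on $\mathbb{R}^n$, $\mathcal{Q}(\mathbb{R}^n)$ is the family of all cubes in $\mathbb{R}^n$ with sides parallel to the coordinate axes, $|E|$ is Lebesgue measure, and $\chi_E$ is the indicator function of $E$. For measurable $f$ put $\lambda_f(\alpha)=|\{x:|f(x)|>\alpha\}|$ ($\alpha>0$) and $f^\ast(t)=\inf\{\alpha>0:\lambda_f(\alpha)\le t\}$ ($t>0$). The Lorentz quasi-norm is $\|f\|_{L^{q,r}}=\left(\int_0^\infty(t^{1/q}f^\ast(t))^r\frac{dt}{t}\right)^{1/r}$ for $0<q,r<\infty$ and $\|f\|_{L^{q,\infty}}=\sup_{t>0}t^{1/q}f^\ast(t)$. For $0<q\le p<\infty$, $0<r\le\infty$, the Morrey-Lorentz space $\mathcal{M}^p_{q,r}(\mathbb{R}^n)$ is the set of $f\in L^0(\mathbb{R}^n)$ with $\|f\|_{\mathcal{M}^p_{q,r}}=\sup_{Q\in\mathcal{Q}(\mathbb{R}^n)}|Q|^{\frac1p-\frac1q}\|f\chi_Q\|_{L^{q,r}}<\infty$. The Morrey space is $\mathcal{M}^p_q(\mathbb{R}^n)=\mathcal{M}^p_{q,q}(\mathbb{R}^n)$ (same quasi-norm), and the weak Morrey space $\mathrm{W}\mathcal{M}^p_q(\mathbb{R}^n)$ is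 the set of $f\in L^0(\mathbb{R}^n)$ with $\|f\|_{\mathrm{W}\mathcal{M}^p_q}=\sup_{\lambda>0}\lambda\|\chi_{\{x:|f(x)|>\lambda\}}\|_{\mathcal{M}^p_q}<\infty$. *)

(* Defs.v *)
From HB Require Import structures.
From mathcomp Require Import all_boot all_order all_algebra.
From mathcomp Require Import all_classical all_reals all_analysis.
From mathcomp Require Import measurable_realfun.
Import Order.TTheory GRing.Theory Num.Theory numFieldNormedType.Exports.

Set Implicit Arguments.
Unset Strict Implicit.
Unset Printing Implicit Defensive.

Local Open Scope classical_set_scope.
Local Open Scope ring_scope.

Section cons_measure.
Local Open Scope ereal_scope.
Context d (T : measurableType d) (R : realType) (n : nat).
Variables (m : {sigma_finite_measure set T -> \bar R})
  (mn : {sigma_finite_measure set (n.-tuple T) -> \bar R}).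

Definition tcons (z : T * n.-tuple T) : n.+1.-tuple T := [tuple of z.1 :: z.2].

Lemma measurable_tcons : measurable_fun setT tcons.
Proof. exact: measurable_cons. Qed.

(* The product of [m] and [mn], transported to (n+1)-tuples *)
Definition cons_measure : set (n.+1.-tuple T) -> \bar R :=
  pushforward (m \x mn) tcons.

Let cons_measure0 : cons_measure set0 = 0.
Proof. by rewrite /cons_measure /pushforward preimage_set0 measure0. Qed.

Let cons_measure_ge0 A : 0 <= cons_measure A.
Proof. exact: (measure_ge0 (m \x mn)). Qed.

Let cons_measure_sigma_additive : semi_sigma_additive cons_measure.
Proof.
move=> F mF tF mUF.
have mpre A : measurable A -> measurable (tcons @^-1` A).
  by move=> mA; rewrite -[X in measurable X]setTI; exact: measurable_tcons.
rewrite /cons_measure /pushforward preimage_bigcup.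
apply: measure_semi_sigma_additive.
- by move=> k; exact: mpre.
- apply/trivIsetP => /= i j _ _ ij; rewrite -preimage_setI.
  by move/trivIsetP : tF => /(_ _ _ _ _ ij) ->//; rewrite preimage_set0.
- by rewrite -preimage_bigcup; exact: mpre.
Qed.

HB.instance Definition _ := isMeasure.Build _ _ _ cons_measure
  cons_measure0 cons_measure_ge0 cons_measure_sigma_additive.

Let cons_measure_sigma_finite : sigma_finite setT cons_measure.
Proof.
have [F TF mF] : sigma_finite setT (m \x mn).
  have /sigma_finiteP[F [TF ndF Foo]] := sigma_finiteT m.
  have /sigma_finiteP[G [TG ndG Goo]] := sigma_finiteT mn.
  exists (fun k => F k `*` G k).
    rewrite -setXTT TF TG predeqE => -[x y]; split.
      move=> [/= [i _ Fix] [k _ Gky]]; exists (maxn i k) => //; split.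
      - by move: x Fix; exact/subsetPset/ndF/leq_maxl.
      - by move: y Gky; exact/subsetPset/ndG/leq_maxr.
    by move=> [i _ []/= ? ?]; split; exists i.
  move=> k; have [? ?] := Foo k; have [? ?] := Goo k.
  split; first exact: measurableX.
  by rewrite product_measure1E// lte_mul_pinfty// ge0_fin_numE.
pose u (x : n.+1.-tuple T) := (thead x, [tuple of behead x] : n.-tuple T).
have tconsK : cancel tcons u.
  by move=> [x t]; rewrite /u /tcons/= theadE; congr pair; exact: val_inj.
have mu' : measurable_fun setT u.
  apply/measurable_fun_pair; last exact: measurable_behead.
  exact: measurable_tnth.
exists (fun k => u @^-1` F k).
  by rewrite -preimage_bigcup -TF preimage_setT.
move=> k; have [mFk Fk] := mF k; split.
  by rewrite -[X in measurable X]setTI; exact: mu'.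
rewrite /cons_measure /pushforward -comp_preimage.
by rewrite (_ : u \o tcons = id)//; apply/funext => z /=; exact: tconsK.
Qed.

HB.instance Definition _ := Measure_isSigmaFinite.Build _ _ _ cons_measure
  cons_measure_sigma_finite.

End cons_measure.

(* Lebesgue measure on R^n, points being n-tuples of reals. [borel_lebesgue n]
   is the n-fold product of the Lebesgue measure of the line, on Borel sets;
   [lebesgue_Rn n] is its completion, defined on all Lebesgue measurable sets,
   and measurability of functions on [Rn n] is Lebesgue measurability. *)
Section lebesgue_measure_Rn.
Context (R : realType).

Fixpoint borel_lebesgue n :
    {sigma_finite_measure set (n.-tuple (measurableTypeR R)) -> \bar R} :=
  if n is k.+1 then cons_measure lebesgue_measure (borel_lebesgue k)
  else \d_([tuple] : 0.-tuple (measurableTypeR R)).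

Definition Rn n : Type := caratheodory_type (mu_ext (borel_lebesgue n)).

HB.instance Definition _ n := Measurable.on (Rn n).

Definition lebesgue_Rn n : set (Rn n) -> \bar R :=
  @completed_measure_extension _ _ _ (borel_lebesgue n).

HB.instance Definition _ n := Measure.on (@lebesgue_Rn n).

Let lebesgue_Rn_sigma_finite n : sigma_finite setT (@lebesgue_Rn n).
Proof. exact/completed_measure_extension_sigma_finite/sigma_finiteT. Qed.

HB.instance Definition _ n := Measure_isSigmaFinite.Build _ _ _
  (@lebesgue_Rn n) (@lebesgue_Rn_sigma_finite n).

End lebesgue_measure_Rn.
Arguments lebesgue_Rn {R n}.

(* Functions take extended real values, so that [fractional_integral alpha f]
   is a function of the same kind as [f]. An integral whose positive and
   negative parts are both infinite is -oo by the library's convention. *)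
Section morrey_lorentz.
Context {R : realType} {n : nat}.
Local Notation mu := (@lebesgue_Rn R n).
Implicit Types (f g : Rn R n -> \bar R) (Q A : set (Rn R n)).

Definition edist (x y : Rn R n) : R :=
  Num.sqrt (\sum_(i < n) (tnth x i - tnth y i) ^+ 2).

Definition fractional_integral (alpha : R) f (x : Rn R n) : \bar R :=
  (\int[mu]_y (f y * ((edist x y `^ (n%:R - alpha))^-1)%:E))%E.

Definition cube (a : Rn R n) (l : R) : set (Rn R n) :=
  [set x | forall i : 'I_n, tnth a i <= tnth x i <= tnth a i + l].

Definition cubes : set (set (Rn R n)) :=
  [set Q | exists a l, 0 < l /\ Q = cube a l].

Definition charfun A (x : Rn R n) : \bar R := (\1_A x)%:E.

Definition distribution_function f (s : R) : \bar R :=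
  mu [set x | (s%:E < `|f x|)%E].

Definition rearrangement f (t : R) : \bar R :=
  ereal_inf [set s%:E | s in [set s : R |
    0 < s /\ (distribution_function f s <= t%:E)%E]].

(* Here [0 < q < oo] and [0 < r <= oo] *)
Definition lorentz_norm (q : R) (r : \bar R) f : \bar R :=
  if r is r'%:E then
    ((\int[lebesgue_measure]_(t in `]0%R, +oo[)
       (((t `^ q^-1)%:E * rearrangement f t) `^ r' * t^-1%:E)) `^ r'^-1)%E
  else ereal_sup [set ((t `^ q^-1)%:E * rearrangement f t)%E
                 | t in [set t : R | 0 < t]].

Definition morrey_lorentz_norm (p q : R) (r : \bar R) f : \bar R :=
  ereal_sup [set (mu Q `^ (p^-1 - q^-1) *
                  lorentz_norm q r (fun x => f x * charfun Q x))%E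
            | Q in cubes].

Definition morrey_lorentz (p q : R) (r : \bar R) : set (Rn R n -> \bar R) :=
  [set f | measurable_fun setT f /\ (morrey_lorentz_norm p q r f < +oo)%E].

Definition morrey_norm (p q : R) f : \bar R := morrey_lorentz_norm p q q%:E f.

Definition weak_morrey_norm (p q : R) f : \bar R :=
  ereal_sup [set (s%:E * morrey_norm p q
                    (charfun [set x | (s%:E < `|f x|)%E]))%E
            | s in [set s : R | 0 < s]].

Definition weak_morrey (p q : R) : set (Rn R n -> \bar R) :=
  [set f | measurable_fun setT f /\ (weak_morrey_norm p q f < +oo)%E].

End morrey_lorentz.

(* Main.v *)
(* Let N_k x be the union of the dyadic cubes of side 2^k touching the one that
   contains x, let M be the maximal operator over these neighbourhoods, and let
   J_b F x = sum_k 2^(k (b - n)) int_(N_k x) F, so that |I_alpha f| is at most a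
   constant times J_alpha |f|. Put theta = p_0 / r_0 and b = n / q_0. The Morrey
   size of f bounds its average over N_k x by 2^(- k n / p_0), and interpolating
   this with the bound by M f gives, scale by scale as in Hedberg's inequality,
   J_alpha f <= C J_b ((M f)^theta). As r_i theta = p_i, it remains to bound M on
   the Morrey-Lorentz space of f and F |-> g J_b F on that of exponents r_0, r_1.
   Each of these bounds splits F into its part near a cube, handled by
   Marcinkiewicz interpolation, and its far part, where the image of F is
   essentially constant (or a constant multiple of g) on the cube. The weak type
   (p, p) of g J_b for 1 < p < q_1 comes from a Schur test with powers of the
   A_1 weight max (g, M(g^gamma)^(1/gamma)).
   Lorentz quasi-norms enter only through the sequence of dyadic values of the
   distribution function, which treats all second exponents alike. *)
Require Import Defs.
From HB Require Import structures.
From mathcomp Require Import all_boot all_order all_algebra.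
From mathcomp Require Import all_classical all_reals all_analysis.
From mathcomp Require Import measurable_realfun.
From mathcomp Require Import ring lra zify.
Import Order.TTheory GRing.Theory Num.Theory numFieldNormedType.Exports.

Set Implicit Arguments.
Unset Strict Implicit.
Unset Printing Implicit Defensive.

Local Open Scope classical_set_scope.
Local Open Scope ring_scope.

(** * Two-sided sums and dyadic scales *)

(** The hypothesis 1/q_0 <= alpha/n includes equality, and then theta = 1: the source and target
    scales coincide and Hedberg's interpolation gains nothing. This is why the potential is reduced
    to the order b = n / q_0, for which multiplication by a function of Morrey scale q_0 restores
    homogeneity zero. The strict inequality alpha/n < 1/p_0 keeps b below n / r_0, so that the far
    scales sum geometrically. As g is only in a weak space, the room left by r_1 < q_1 is spent on
    the exponent gamma < q_1 of its weight. The ratio p_2 / p_1 may be below 1, where sequence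
    quasi-norms are not norms; sums therefore run against kernels that decay geometrically in both
    directions, and part of this decay replaces the triangle inequality. Belonging to the same cube
    and to a common neighbourhood are symmetric relations, so Fubini's theorem provides both the
    covering argument for the maximal operator and the self-adjointness of the potential. The dyadic
    bounds hold for data of a fixed size, with constants depending on it; homogeneity returns at the
    end by scaling f and g. *)

Section zsum.
Local Open Scope ereal_scope.
Context {R : realType}.
Implicit Types a b : int -> \bar R.

Definition zsum a : \bar R := \esum_(j in [set: int]) a j.

(** Even indices enumerate the nonnegative integers and odd ones the negative, so the entry at index
    i has absolute value at least (i - 1) / 2; [zsum_hat] relies on this rate. *)
Definition int_of_index (i : nat) : int := if odd i then Negz i./2 else Posz i./2.

Lemma int_of_index_bij : set_bij [set: nat] [set: int] int_of_index.
Proof.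
split=> //.
- move=> i j _ _; rewrite /int_of_index.
  case: ifP => oi; case: ifP => oj // -[] h.
  + by rewrite -(odd_double_half i) -(odd_double_half j) oi oj h.
  + by rewrite -(odd_double_half i) -(odd_double_half j) oi oj h.
- move=> [m|m] _.
  + by exists (m.*2) => //; rewrite /int_of_index odd_double doubleK.
  + by exists (m.*2.+1) => //; rewrite /int_of_index /= odd_double /= uphalf_double.
Qed.

Lemma zsumE a : (forall j, 0 <= a j) -> zsum a = \sum_(i <oo) a (int_of_index i).
Proof.
move=> a0; rewrite /zsum (reindex_esum [set: nat] _ int_of_index) //; last first.
  exact: int_of_index_bij.
by rewrite nneseries_esumT.
Qed.

Lemma zsum_ge0 a : (forall j, 0 <= a j) -> 0 <= zsum a.
Proof. by move=> a0; apply: esum_ge0. Qed.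

Lemma le_zsum a b : (forall j, a j <= b j) -> zsum a <= zsum b.
Proof. by move=> ab; apply: le_esum. Qed.

Lemma zsum_ge a j : (forall j, 0 <= a j) -> a j <= zsum a.
Proof.
move=> a0; apply: esum_ge; exists [set j]; first by split.
by rewrite fsbig_set1.
Qed.

Lemma zsumZl a (x : R) : (forall j, 0 <= a j) -> (0 <= x)%R ->
  zsum (fun j => x%:E * a j) = x%:E * zsum a.
Proof.
move=> a0 x0; rewrite !zsumE//; last by move=> j; rewrite mule_ge0.
by rewrite nneseriesZl.
Qed.

Lemma zsumD a b : (forall j, 0 <= a j) -> (forall j, 0 <= b j) ->
  zsum (fun j => a j + b j) = zsum a + zsum b.
Proof. by move=> a0 b0; rewrite /zsum esumD. Qed.

Lemma zsum_shift a (l : int) : zsum (fun j => a (j + l)%R) = zsum a.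
Proof.
rewrite /zsum [RHS](reindex_esum [set: int] _ (fun j => j + l)%R)//.
split=> //.
  by move=> i j _ _ /addIr.
by move=> i _; exists (i - l)%R => //; rewrite subrK.
Qed.

Lemma zsum_exchange (a : int -> int -> \bar R) : (forall i j, 0 <= a i j) ->
  zsum (fun i => zsum (fun j => a i j)) = zsum (fun j => zsum (fun i => a i j)).
Proof.
move=> a0; rewrite /zsum !esum_esum//.
rewrite (reindex_esum ([set: int] `*`` (fun=> [set: int])) _ (fun x => (x.2, x.1)))//; split=> //=.
  by move=> [i1 i2] [j1 j2] /= _ _ [] -> ->.
by move=> [i1 i2] _; exists (i2, i1).
Qed.

Lemma integral_zsum d (T : measurableType d) (mu : {measure set T -> \bar R})
    (D : set T) (f : int -> T -> \bar R) :
  measurable D -> (forall j, measurable_fun D (f j)) ->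
  (forall j x, 0 <= f j x) ->
  \int[mu]_(x in D) zsum (f ^~ x) = zsum (fun j => \int[mu]_(x in D) f j x).
Proof.
move=> mD mf f0; rewrite zsumE; last by move=> j; apply: integral_ge0.
rewrite -integral_nneseries//; apply: eq_integral => x _.
by rewrite zsumE.
Qed.

Lemma measurable_zsum d (T : measurableType d) (f : int -> T -> \bar R) :
  (forall j, measurable_fun setT (f j)) -> (forall j x, 0 <= f j x) ->
  measurable_fun setT (fun x => zsum (f ^~ x)).
Proof.
move=> mf f0.
rewrite (_ : (fun x => _) = (fun x => \sum_(i <oo) f (int_of_index i) x)).
  by apply: ge0_emeasurable_sum => // *; exact: mf.
by apply/funext => x; rewrite zsumE.
Qed.

End zsum.

Section dyad.
Context {R : realType}.
Implicit Types (c A u v tau : R) (i j : int).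

Definition dyad c j : R := 2 `^ (c * j%:~R).

(** The profile of a quantity with one power bound at small scales and another at large scales,
    centred at u = 1. *)
Definition hat A u : R := Num.min (u `^ A) (u `^ (- A)).

Lemma dyad_gt0 c j : 0 < dyad c j.
Proof. exact: powR_gt0. Qed.

Lemma dyad_ge0 c j : 0 <= dyad c j.
Proof. exact: powR_ge0. Qed.

Lemma dyadD c i j : dyad c (i + j) = dyad c i * dyad c j.
Proof. by rewrite /dyad intrD mulrDr powRD// pnatr_eq0 implybT. Qed.

Lemma dyadN c j : dyad c (- j) = (dyad c j)^-1.
Proof. by rewrite /dyad intrN mulrN powRN. Qed.

Lemma dyad_powR c j A : dyad c j `^ A = dyad (c * A) j.
Proof. by rewrite /dyad -powRrM mulrAC. Qed.

Lemma dyad_split a b j : dyad (a + b) j = dyad a j * dyad b j.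
Proof. by rewrite /dyad mulrDl powRD// pnatr_eq0 implybT. Qed.

Lemma dyad_opp a j : dyad (- a) j = (dyad a j)^-1.
Proof. by rewrite /dyad mulNr powRN. Qed.

Lemma dyad0 c : dyad c 0 = 1.
Proof. by rewrite /dyad mulr0 powRr0. Qed.

Lemma dyad_le c i j : 0 <= c -> (i <= j)%R -> dyad c i <= dyad c j.
Proof.
by move=> c0 ij; apply: ler_powR; rewrite ?ler1n// ler_wpM2l// ler_int.
Qed.

Lemma dyad_bracket c u : 0 < c -> 0 < u ->
  exists j : int, dyad c j <= u < dyad c (j + 1).
Proof.
move=> c0 u0; have l2 : 0 < ln (2 : R) by rewrite ln_gt0// ltr1n.
exists (Num.floor (ln u / (c * ln 2))).
have E j : dyad c j = expR (c * j%:~R * ln 2).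
  by rewrite /dyad /powR pnatr_eq0.
rewrite !E -{2 3}(lnK (_ : u \is Num.pos))// ler_expR ltr_expR.
have cl : 0 < c * ln 2 by rewrite mulr_gt0.
have M (x : R) : c * x * ln 2 = x * (c * ln 2) by rewrite mulrCA mulrA.
rewrite !M -ler_pdivlMr// -ltr_pdivrMr//.
by rewrite Num.Theory.floor_le Num.Theory.floorD1_gt.
Qed.

Lemma hat_ge0 A u : 0 <= hat A u.
Proof. by rewrite /hat le_min !powR_ge0. Qed.

Lemma hat_dyad c A j : 0 < c -> 0 < A ->
  hat A (dyad c j) = dyad (- (c * A)) `|j|%R.
Proof.
move=> c0 A0; rewrite /hat !dyad_powR mulrN.
have cA := mulr_gt0 c0 A0.
have [j0|j0] := lerP 0 j.
  rewrite ger0_norm//; apply/min_idPr; rewrite /dyad ler_powR// ?ler1n// mulNr.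
  by rewrite -subr_ge0 opprK addr_ge0// mulr_ge0 ?(ltW cA)// ler0z.
rewrite ltr0_norm// [RHS]dyadN [in RHS]dyad_opp invrK.
apply/min_idPl; rewrite /dyad ler_powR// ?ler1n// mulNr -subr_ge0.
by rewrite -opprD oppr_ge0 -mulr2n pmulrn_lle0// pmulr_rle0// lerz0 ltW.
Qed.

(** Moving the centre by a bounded factor costs only a constant, which lets an arbitrary centre be
    rounded to a dyadic one. *)
Lemma hat_slow A u v : 0 < A -> 0 < u -> 1 <= v ->
  hat A (u / v) <= v `^ A * hat A u.
Proof.
move=> A0 u0 v1; have v0 : 0 < v by rewrite (lt_le_trans ltr01).
have vi0 : 0 <= v^-1 by rewrite invr_ge0 ltW.
have vN B : v^-1 `^ B = v `^ (- B).
  by rewrite -powR_inv1 ?(ltW v0)// -powRrM mulN1r.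
have vA : v `^ (- A) <= v `^ A.
  by rewrite ler_powR// -subr_ge0 opprK addr_ge0// ltW.
rewrite /hat minr_pMr ?powR_ge0// !powRM ?(ltW u0)// !vN opprK.
rewrite ![u `^ _ * _]mulrC le_min; apply/andP; split.
  by rewrite ge_min ler_wpM2r ?powR_ge0.
by rewrite ge_min lexx orbT.
Qed.

Lemma nneseries_geometric_le (a r : R) : 0 <= a -> 0 < r < 1 ->
  (\sum_(i <oo) (a * r ^+ i)%:E <= (a / (1 - r))%:E)%E.
Proof.
move=> a0 /andP[r0 r1].
apply: lime_le.
  by apply: is_cvg_nneseries => n _ _; rewrite lee_fin mulr_ge0// exprn_ge0// ltW.
apply: nearW => n; rewrite sumEFin lee_fin.
have := @geometric_le_lim R n a r a0 r0.
by rewrite ger0_norm ?(ltW r0)// /series /=; exact.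
Qed.

(** Uniformity in [tau] is the point: [tau] is rounded down to a dyadic value, and a sum over all
    integers absorbs that value by translation. *)
Lemma zsum_hat c A : 0 < c -> 0 < A -> exists2 C : R, 0 < C &
  forall tau : R, 0 < tau ->
  (zsum (fun j => (hat A (dyad c j / tau))%:E) <= C%:E)%E.
Proof.
move=> c0 A0; have cA := mulr_gt0 c0 A0.
(* The square root of the decay 2^(- c A), because the enumeration of the integers gains one unit of
   absolute value every two indices; the shift in i - 1 produces the factor [r^-1] of [K]. *)
pose r : R := 2 `^ (- (c * A) / 2).
have r01 : 0 < r < 1.
  rewrite powR_gt0//= /r -[ltRHS](powRr0 2) /powR pnatr_eq0/= ltr_expR.
  by rewrite mul0r pmulr_llt0 ?ln_gt0 ?ltr1n// pmulr_llt0// oppr_lt0.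
pose K := r^-1 / (1 - r).
have K0 : 0 < K by rewrite mulr_gt0// invr_gt0 ?subr_gt0; case/andP: r01.
have base : (zsum (fun j => (hat A (dyad c j))%:E) <= K%:E)%E.
  rewrite zsumE; last by move=> j; rewrite lee_fin hat_ge0.
  apply: le_trans; last first.
    by apply: (nneseries_geometric_le _ r01); rewrite invr_ge0 powR_ge0.
  apply: lee_nneseries => // i _; first by rewrite lee_fin hat_ge0.
  rewrite lee_fin hat_dyad// -powR_mulrn ?powR_ge0// /r -powRN -!powRrM -powRD.
    rewrite /dyad ler_powR ?ler1n//.
    have -> : - (- (c * A) / 2) + - (c * A) / 2 * i%:R = - (c * A) * ((i%:R - 1) / 2).
      by ring.
    rewrite ler_wnM2l// ?oppr_le0 ?(ltW cA)//.
    have h : (i%:Z - 1 <= 2 * `|int_of_index i|)%R.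
      by rewrite /int_of_index; case: ifP; lia.
    rewrite ler_pdivrMr// mulrC.
    by move: h; rewrite -(ler_int R) intrD intrM /=; lra.
  by rewrite pnatr_eq0 implybT.
exists (2 `^ c `^ A * K); first by rewrite mulr_gt0// !powR_gt0.
move=> tau tau0; have [l /andP[l1 l2]] := dyad_bracket c0 tau0.
rewrite -(zsum_shift _ l).
apply: (@le_trans _ _ (zsum (fun j => (2 `^ c `^ A)%:E * (hat A (dyad c j))%:E)))%E.
  apply: le_zsum => j; rewrite -EFinM lee_fin.
  pose v := tau / dyad c l.
  have v1 : 1 <= v by rewrite ler_pdivlMr ?dyad_gt0// mul1r.
  have v2 : v <= 2 `^ c.
    by rewrite ler_pdivrMr ?dyad_gt0// (le_trans (ltW l2))// dyadD mulrC /dyad mulr1.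
  have -> : dyad c (j + l) / tau = dyad c j / v.
    by rewrite dyadD /v invf_div mulrA.
  apply: (le_trans (hat_slow A0 (dyad_gt0 _ _) v1)).
  rewrite ler_wpM2r ?hat_ge0// ge0_ler_powR ?nnegrE ?powR_ge0 ?(ltW A0)//.
  by rewrite (le_trans ler01).
rewrite zsumZl ?powR_ge0//; last by move=> j; rewrite lee_fin hat_ge0.
by rewrite EFinM lee_pmul2l// lte_fin !powR_gt0.
Qed.

End dyad.

(** * Sequence quasi-norms l^sigma for 0 < sigma <= oo *)

Section lbound.
Context {R : realType}.
Implicit Types (s A B c X tau eta : R) (sigma : \bar R) (a b : int -> \bar R).

(* [lbound sigma a B]: the l^sigma quasi-norm of [a] is at most [B]. *)
Definition lbound sigma a B : Prop :=
  if sigma is s%:E then (zsum (fun j => a j `^ s) <= (B `^ s)%:E)%E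
  else forall j, (a j <= B%:E)%E.

Lemma hat_powR A s (u : R) : 0 <= s -> 0 < u -> hat A u `^ s = hat (A * s) u.
Proof.
move=> s0 u0; rewrite /hat -mulNr !powRrM.
case: (leP (u `^ A)) => h; apply/esym; [apply/min_idPl|apply/min_idPr].
  by rewrite ge0_ler_powR ?nnegrE ?powR_ge0.
by rewrite ge0_ler_powR ?nnegrE ?powR_ge0// ltW.
Qed.

Lemma hat_le1 A (u : R) : 0 < A -> 0 < u -> hat A u <= 1.
Proof.
move=> A0 u0; have mono := ge0_ler_powR (ltW A0).
rewrite /hat ge_min powRN; case: (leP u 1) => h; apply/orP; [left|right].
  by have := mono u 1; rewrite powR1 !nnegrE ler01 (ltW u0) h => ->.
rewrite invf_le1 ?powR_gt0//.
by have := mono 1 u; rewrite powR1 !nnegrE ler01 (ltW u0) (ltW h) => ->.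
Qed.

Lemma le_poweR (x y : \bar R) s : 0 <= s -> (0 <= x)%E -> (x <= y)%E ->
  (x `^ s <= y `^ s)%E.
Proof.
move=> s0 x0 xy; have y0 := le_trans x0 xy.
by apply: gt0_ler_poweR => //; rewrite in_itv/= leey andbT.
Qed.

Lemma lbound_le sigma a b A B : (0 < sigma)%E -> 0 <= A <= B ->
  (forall j, 0 <= a j)%E -> (forall j, a j <= b j)%E ->
  lbound sigma b A -> lbound sigma a B.
Proof.
move=> s0 /andP[A0 AB] a0 ab; case: sigma s0 => [s||]//=.
  rewrite lte_fin => s0 h; apply: (@le_trans _ _ (A `^ s)%:E).
    by apply: le_trans h; apply: le_zsum => j; rewrite le_poweR ?(ltW s0).
  rewrite lee_fin ge0_ler_powR ?nnegrE ?(ltW s0)//.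
  exact: le_trans AB.
by move=> _ h j; rewrite (le_trans (ab j))// (le_trans (h j)).
Qed.

Lemma lboundZ sigma a B X : (0 < sigma)%E -> 0 <= X -> 0 <= B ->
  (forall j, 0 <= a j)%E ->
  lbound sigma a B -> lbound sigma (fun j => X%:E * a j)%E (X * B).
Proof.
move=> s0 X0 B0 a0; case: sigma s0 => [s||]//=.
  rewrite lte_fin => s0 h; under eq_fun do rewrite poweRM// poweR_EFin.
  rewrite zsumZl ?powR_ge0//; last by move=> j; exact: poweR_ge0.
  by rewrite powRM// EFinM lee_wpmul2l// lee_fin powR_ge0.
by move=> _ h j; rewrite EFinM lee_wpmul2l.
Qed.

Lemma lbound_term sigma a B j : (0 < sigma)%E -> 0 <= B ->
  (forall j, 0 <= a j)%E -> lbound sigma a B -> (a j <= B%:E)%E.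
Proof.
move=> s0 B0 a0; case: sigma s0 => [s||]//=.
rewrite lte_fin => s0 h.
have : (a j `^ s <= (B `^ s)%:E)%E.
  apply: le_trans h; apply: (@zsum_ge _ (fun j => a j `^ s)%E) => i.
  exact: poweR_ge0.
rewrite -poweR_EFin => /(le_poweR (_ : 0 <= s^-1) (poweR_ge0 _ _)).
by rewrite invr_ge0 (ltW s0) -!poweRrM mulfV ?gt_eqF// !poweRe1//; exact.
Qed.

(** (a + b)^s <= 2^s (a^s + b^s) holds for every s > 0, which avoids separating s < 1 from s >=
    1. *)
Lemma lboundD sigma : (0 < sigma)%E -> exists2 C : R, 0 < C &
  forall a b A B, 0 <= A -> 0 <= B ->
  (forall j, 0 <= a j)%E -> (forall j, 0 <= b j)%E ->
  lbound sigma a A -> lbound sigma b B ->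
  lbound sigma (fun j => a j + b j)%E (C * (A + B)).
Proof.
case: sigma => [s||]// => [|_]; last first.
  exists 1 => // a b A B A0 B0 a0 b0 ha hb j.
  by rewrite mul1r EFinD leeD.
rewrite lte_fin => s0; exists (2 `^ s^-1 * 2); first by rewrite mulr_gt0// powR_gt0.
move=> a b A B A0 B0 a0 b0 /= ha hb.
have sN0 : s != 0 by rewrite gt_eqF.
rewrite -mulrA powRM ?powR_ge0//; last by rewrite mulr_ge0// addr_ge0.
rewrite -powRrM mulVf// powRr1//.
apply: (@le_trans _ _ (zsum (fun j => (2 `^ s)%:E * (a j `^ s + b j `^ s)))%E).
  apply: le_zsum => j.
  have [ab|ab] := leP (a j) (b j).
    apply: (@le_trans _ _ ((2%:E * b j) `^ s)%E).
      by rewrite le_poweR ?adde_ge0 ?(ltW s0)// mule_natl mule2n leeD2r.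
    rewrite poweRM// poweR_EFin lee_wpmul2l ?lee_fin ?powR_ge0//.
    by rewrite leeDr// poweR_ge0.
  apply: (@le_trans _ _ ((2%:E * a j) `^ s)%E).
    by rewrite le_poweR ?adde_ge0 ?(ltW s0)// mule_natl mule2n leeD2l// ltW.
  rewrite poweRM// poweR_EFin lee_wpmul2l ?lee_fin ?powR_ge0//.
  by rewrite leeDl// poweR_ge0.
rewrite zsumZl ?powR_ge0//; last by move=> j; rewrite adde_ge0 ?poweR_ge0.
rewrite zsumD; [|by move=> j; rewrite poweR_ge0..].
apply: (@le_trans _ _ ((2 `^ s)%:E * (A `^ s + B `^ s)%:E)%E).
  by rewrite lee_wpmul2l ?lee_fin ?powR_ge0// EFinD leeD.
rewrite -EFinM lee_fin powRM ?addr_ge0// mulrCA ler_wpM2l ?powR_ge0//.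
rewrite mulr_natl mulr2n lerD// ge0_ler_powR ?nnegrE ?addr_ge0 ?(ltW s0)//.
  by rewrite lerDl.
by rewrite lerDr.
Qed.

Lemma lbound_hat sigma c A : (0 < sigma)%E -> 0 < c -> 0 < A ->
  exists2 C : R, 0 < C & forall a tau X, 0 < tau -> 0 <= X ->
  (forall j, 0 <= a j)%E ->
  (forall j, a j <= (X * hat A (dyad c j / tau))%:E)%E ->
  lbound sigma a (C * X).
Proof.
move=> + c0 A0; case: sigma => [s||]// => [|_]; last first.
  exists 1 => // a tau X tau0 X0 a0 ha j; apply: (le_trans (ha j)).
  rewrite lee_fin mul1r ler_piMr//.
  by rewrite hat_le1// divr_gt0// dyad_gt0.
rewrite lte_fin => s0.
have [C C0 hC] := zsum_hat c0 (mulr_gt0 A0 s0).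
exists (C `^ s^-1); first exact: powR_gt0.
move=> a tau X tau0 X0 a0 ha /=.
have sN0 : s != 0 by rewrite gt_eqF.
rewrite powRM ?powR_ge0// -powRrM mulVf// powRr1 ?(ltW C0)//.
apply: (@le_trans _ _ (zsum (fun j => (X `^ s)%:E * (hat (A * s) (dyad c j / tau))%:E))%E).
  apply: le_zsum => j; apply: (le_trans (le_poweR (ltW s0) (a0 j) (ha j))).
  by rewrite poweR_EFin powRM ?hat_ge0// hat_powR ?(ltW s0)// divr_gt0// dyad_gt0.
rewrite zsumZl ?powR_ge0//; last by move=> j; rewrite lee_fin hat_ge0.
by rewrite [(C * _)%R]mulrC EFinM lee_wpmul2l ?hC// lee_fin powR_ge0.
Qed.

Lemma zsum_hat1 c A : 0 < c -> 0 < A -> exists2 C : R, 0 < C &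
  (zsum (fun j => (hat A (dyad c j))%:E) <= C%:E)%E.
Proof.
move=> c0 A0; have [C C0 /(_ 1 ltr01) hC] := zsum_hat c0 A0; exists C => //.
by apply: le_trans hC; apply: le_zsum => j; rewrite divr1.
Qed.

(** A discrete Young inequality that covers s < 1, where Minkowski's inequality fails. The kernel is
    the square of [hat (eta / 2)]: one factor stays with b in an l^s sum [V] that bounds every
    single term, the other makes the sum over l converge. *)
Lemma lbound_conv sigma c eta : (0 < sigma)%E -> 0 < c -> 0 < eta ->
  exists2 C : R, 0 < C & forall a b B, 0 <= B ->
  (forall j, 0 <= a j)%E -> (forall j, 0 <= b j)%E ->
  (forall j, a j <= zsum (fun l => (hat eta (dyad c l))%:E * b (j + l)%R))%E ->
  lbound sigma b B -> lbound sigma a (C * B).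
Proof.
move=> + c0 eta0; case: sigma => [s||]// => [|_]; last first.
  have [C C0 hC] := zsum_hat1 c0 eta0.
  exists C => // a b B B0 a0 b0 ha hb j; apply: (le_trans (ha j)).
  apply: (@le_trans _ _ (zsum (fun l => B%:E * (hat eta (dyad c l))%:E)))%E.
    by apply: le_zsum => l; rewrite muleC lee_wpmul2r// lee_fin hat_ge0.
  rewrite zsumZl//; last by move=> i; rewrite lee_fin hat_ge0.
  by rewrite [(C * _)%R]mulrC EFinM lee_wpmul2l.
rewrite lte_fin => s0.
have e20 : 0 < eta / 2 by rewrite divr_gt0.
have sN0 : s != 0 by rewrite gt_eqF.
have [C C0 hC] := zsum_hat1 c0 e20.
have [K K0 hK] := zsum_hat1 c0 (mulr_gt0 e20 s0).
exists (C * K `^ s^-1); first by rewrite mulr_gt0// powR_gt0.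
move=> a b B B0 a0 b0 ha /= hb.
rewrite !powRM ?mulr_ge0 ?powR_ge0 ?(ltW C0)// -powRrM mulVf// powRr1 ?(ltW K0)//.
pose h l := hat (eta / 2) (dyad c l : R).
pose V j := zsum (fun l => ((h l)%:E * b (j + l)%R) `^ s)%E.
have V0 j : (0 <= V j)%E by apply: zsum_ge0 => l; exact: poweR_ge0.
have aV j : (a j `^ s <= (C `^ s)%:E * V j)%E.
  have [VE|Voo] := eqVneq (V j) +oo%E.
    by rewrite VE gt0_muley ?leey// lte_fin powR_gt0.
  have Vfin : V j \is a fin_num by rewrite ge0_fin_numE// ltey.
  have hV l : ((h l)%:E * b (j + l)%R <= (fine (V j) `^ s^-1)%:E)%E.
    have : (((h l)%:E * b (j + l)%R) `^ s <= V j)%E.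
      apply: (@zsum_ge _ (fun l => ((h l)%:E * b (j + l)%R) `^ s)%E) => i.
      exact: poweR_ge0.
    move=> /(le_poweR (_ : 0 <= s^-1) (poweR_ge0 _ _)).
    rewrite invr_ge0 (ltW s0) -poweRrM mulfV// poweRe1; last first.
      by rewrite mule_ge0// lee_fin hat_ge0.
    by rewrite -poweR_EFin fineK//; exact.
  have : (a j <= C%:E * (fine (V j) `^ s^-1)%:E)%E.
    apply: (le_trans (ha j)).
    apply: (@le_trans _ _ (zsum (fun l => (fine (V j) `^ s^-1)%:E * (h l)%:E)))%E.
      apply: le_zsum => l.
      have -> : hat eta (dyad c l) = h l * h l.
        rewrite /h -expr2 -powR_mulrn ?hat_ge0// hat_powR ?dyad_gt0//.
        by rewrite divfK.
      by rewrite EFinM muleC muleA [leRHS]muleC muleC lee_wpmul2l ?lee_fin ?hat_ge0// muleC.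
    rewrite zsumZl ?powR_ge0//; last by move=> i; rewrite lee_fin hat_ge0.
    by rewrite muleC lee_wpmul2r// lee_fin powR_ge0.
  move=> /(le_poweR (ltW s0) (a0 _)); rewrite -EFinM poweR_EFin.
  rewrite powRM ?powR_ge0 ?(ltW C0)// -powRrM mulVf// powRr1 ?fine_ge0//.
  by rewrite EFinM fineK.
apply: (le_trans (le_zsum aV)).
rewrite zsumZl ?powR_ge0// -mulrA EFinM lee_wpmul2l ?lee_fin ?powR_ge0//.
rewrite zsum_exchange; last by move=> *; exact: poweR_ge0.
apply: (@le_trans _ _ (zsum (fun l => (B `^ s)%:E * (hat (eta / 2 * s) (dyad c l))%:E))%E).
  apply: le_zsum => l.
  under eq_fun.
    move=> j; rewrite poweRM ?lee_fin ?hat_ge0// poweR_EFin hat_powR ?(ltW s0) ?dyad_gt0//.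
    over.
  rewrite zsumZl ?hat_ge0//; last by move=> j; exact: poweR_ge0.
  rewrite muleC lee_wpmul2r ?lee_fin ?hat_ge0//.
  by rewrite (zsum_shift (fun j => b j `^ s)%E).
rewrite zsumZl ?powR_ge0//; last by move=> i; rewrite lee_fin hat_ge0.
by rewrite [(K * _)%R]mulrC EFinM lee_wpmul2l// lee_fin powR_ge0.
Qed.

End lbound.

(** * Distribution functions and interpolation *)

Section measure_tools.
Local Open Scope ereal_scope.
Context d (T : measurableType d) (R : realType).
Implicit Types (mu : {measure set T -> \bar R}) (f h : T -> \bar R) (A B : set T).

Definition cutoff A f : T -> \bar R := fun x => f x * (\1_A x)%:E.

Definition superlevel f (l : R) : set T := [set x | l%:E < f x].

Lemma cutoff_ge0 A f x : (forall x, 0 <= f x) -> 0 <= cutoff A f x.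
Proof. by move=> f0; rewrite /cutoff mule_ge0// lee_fin. Qed.

Lemma cutoffT A f x : A x -> cutoff A f x = f x.
Proof. by move=> Ax; rewrite /cutoff indicE mem_set// mule1. Qed.

Lemma cutoffF A f x : ~ A x -> cutoff A f x = 0.
Proof. by move=> Ax; rewrite /cutoff indicE memNset// mule0. Qed.

Lemma cutoff_le A f x : (forall x, 0 <= f x) -> cutoff A f x <= f x.
Proof.
by move=> f0; have [Ax|Ax] := pselect (A x); [rewrite cutoffT|rewrite cutoffF].
Qed.

Lemma cutoff_split A f x : cutoff A f x + cutoff (~` A) f x = f x.
Proof.
have [Ax|nAx] := pselect (A x).
  by rewrite cutoffT// cutoffF ?adde0//; exact.
by rewrite cutoffF// cutoffT// add0e.
Qed.

Lemma measurable_cutoff A f : measurable A -> measurable_fun setT f ->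
  measurable_fun setT (cutoff A f).
Proof.
move=> mA mf; apply: emeasurable_funM => //.
by apply/measurable_EFinP; exact: measurable_indic.
Qed.

Lemma integral_cutoff mu A f : \int[mu]_(x in A) f x = \int[mu]_x cutoff A f x.
Proof.
rewrite integral_mkcond; apply: eq_integral => x _.
rewrite patchE; case: ifPn => [|/negP]; rewrite inE => Ax.
  by rewrite cutoffT.
by rewrite cutoffF.
Qed.

Lemma measurable_superlevel f l : measurable_fun setT f ->
  measurable (superlevel f l).
Proof. by move=> mf; rewrite -[X in measurable X]setTI; exact: emeasurable_fun_o_infty. Qed.

Lemma chebyshev mu f (l : R) : (forall x, 0 <= f x) -> measurable_fun setT f ->
  (0 <= l)%R -> l%:E * mu (superlevel f l) <= \int[mu]_x f x.
Proof.
move=> f0 mf l0; have mS := measurable_superlevel l mf.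
have := integral_indic mu measurableT mS; rewrite setIT => <-.
have mI : measurable_fun setT (fun x => (\1_(superlevel f l) x : R)%:E).
  by apply/measurable_EFinP; exact: measurable_indic.
rewrite -ge0_integralZl//.
apply: ge0_le_integral => //.
- by move=> x _; rewrite mule_ge0// lee_fin.
- exact: measurable_funeM.
- move=> x _; rewrite indicE; case: (boolP (x \in _)) => [|_].
    by rewrite inE /superlevel/= mule1 => /ltW.
  by rewrite mule0.
Qed.

Lemma ge0_integral_le mu A B f h : measurable A -> measurable B -> A `<=` B ->
  measurable_fun setT f -> measurable_fun setT h ->
  (forall x, 0 <= f x) -> (forall x, 0 <= h x) ->
  (forall x, A x -> f x <= h x) ->
  \int[mu]_(x in A) f x <= \int[mu]_(x in B) h x.
Proof.
move=> mA mB AB mf mh f0 h0 fh.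
apply: (@le_trans _ _ (\int[mu]_(x in A) h x)).
  by apply: ge0_le_integral => //; exact: measurable_funTS.
by apply: ge0_subset_integral => //; exact: measurable_funTS.
Qed.

End measure_tools.

(** * Fubini's theorem for a symmetric relation *)

Section symmetric_relation.
Local Open Scope ereal_scope.
Context d (T : measurableType d) (R : realType).
Variable mu : {sigma_finite_measure set T -> \bar R}.
Variable S : T -> set T.
Hypothesis mS : measurable [set z : T * T | S z.1 z.2].
Hypothesis symS : forall x y, S x y -> S y x.
Implicit Types u h : T -> \bar R.

Lemma measurable_rel x : measurable (S x).
Proof.
have := @measurable_xsection _ _ T T _ x mS.
by rewrite (_ : xsection _ x = S x)//; apply/seteqP; split => y; rewrite /xsection/= inE.
Qed.

Let K h (z : T * T) := h z.2 * (\1_[set z : T * T | S z.1 z.2] z)%:E.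

Let mK h : measurable_fun setT h -> measurable_fun setT (K h).
Proof.
move=> mh; apply: emeasurable_funM; first exact: measurableT_comp.
by apply/measurable_EFinP; exact: measurable_indic.
Qed.

Let intK h x : \int[mu]_(y in S x) h y = \int[mu]_y K h (x, y).
Proof.
rewrite integral_cutoff; apply: eq_integral => y _.
by rewrite /cutoff /K/= !indicE; congr (_ * (_ : bool)%:R%:E); apply/idP/idP; rewrite !inE.
Qed.

Lemma measurable_integral_rel h : measurable_fun setT h -> (forall x, 0 <= h x) ->
  measurable_fun setT (fun x => \int[mu]_(y in S x) h y).
Proof.
move=> mh h0; have -> : (fun x => \int[mu]_(y in S x) h y) = fubini_F mu (K h).
  by apply/funext => x; rewrite intK.
apply: (@measurable_fun_fubini_tonelli_F _ _ _ _ _ mu (K h) (mK mh)) => z.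
by rewrite /K mule_ge0// lee_fin.
Qed.

(** Both sides integrate u x * h y over the related pairs; symmetry turns the sections of one order
    of integration into those of the other. *)
Lemma integral_rel_sym u h : measurable_fun setT u -> measurable_fun setT h ->
  (forall x, 0 <= u x) -> (forall x, 0 <= h x) ->
  \int[mu]_x (u x * \int[mu]_(y in S x) h y) =
  \int[mu]_y (h y * \int[mu]_(x in S y) u x).
Proof.
move=> mu_ mh u0 h0.
have K0 f z : (forall x, 0 <= f x) -> 0 <= K f z.
  by move=> f0; rewrite /K mule_ge0// lee_fin.
transitivity (\int[mu]_x \int[mu]_y (u x * K h (x, y))).
  apply: eq_integral => x _; rewrite ge0_integralZl//; first by rewrite intK.
  - by apply: measurableT_comp; [exact: mK|exact: pair1_measurable].
  - by move=> y _; exact: K0.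
transitivity (\int[mu]_y \int[mu]_x (u x * K h (x, y))).
  apply: (@fubini_tonelli _ _ _ _ _ mu mu (fun z => u z.1 * K h z)).
  - by apply: emeasurable_funM; [exact: measurableT_comp|exact: mK].
  - by move=> z; rewrite mule_ge0// K0.
apply: eq_integral => y _.
rewrite intK -ge0_integralZl//; last 2 first.
- by apply: measurableT_comp; [exact: mK|exact: pair1_measurable].
- by move=> x _; exact: K0.
apply: eq_integral => x _; rewrite /K/= muleCA; congr (_ * (_ * _)).
by rewrite !indicE; congr ((_ : bool)%:R%:E); apply/idP/idP; rewrite !inE => /symS.
Qed.

End symmetric_relation.

(** The bracket is strict below because superlevel sets are strict. *)
Lemma dyad_bracket_oc (R : realType) (c u : R) : 0 < c -> 0 < u ->
  exists j : int, dyad c j < u <= dyad c (j + 1).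
Proof.
move=> c0 u0; have ui0 : 0 < u^-1 by rewrite invr_gt0.
have [i /andP[i1 i2]] := dyad_bracket c0 ui0.
exists (- i - 1); rewrite subrK; apply/andP; split.
  by rewrite -opprD dyadN -ltf_pV2 ?posrE ?invr_gt0 ?dyad_gt0// invrK.
by rewrite dyadN -lef_pV2 ?posrE ?invr_gt0 ?dyad_gt0// invrK.
Qed.

Lemma dyad_lt_inv (R : realType) (c : R) (i j : int) : 0 < c ->
  dyad c i < dyad c j -> i < j.
Proof.
by move=> c0; apply: contraTT; rewrite -!leNgt => ji; apply: dyad_le (ltW c0) ji.
Qed.

(** For v <= 1 the power delta decays, for v >= 1 the power delta - p does; the smaller of the two
    rates serves on both sides. *)
Lemma weak_hat (R : realType) (delta p v : R) : 0 < delta < p -> 0 < v ->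
  v `^ delta * Num.min 1 (v `^ (- p)) <= hat (Num.min delta (p - delta)) v.
Proof.
move=> /andP[d0 dp] v0; have vN0 : v != 0 by rewrite gt_eqF.
set A := Num.min delta (p - delta).
have A1 : A <= delta by rewrite ge_min lexx.
have A2 : A <= p - delta by rewrite ge_min lexx orbT.
have A0 : 0 < A by rewrite lt_min d0 subr_gt0.
rewrite minr_pMr ?powR_ge0// mulr1 -powRD; last by rewrite vN0 implybT.
have lo (x y : R) : v <= 1 -> x <= y -> v `^ y <= v `^ x.
  by move=> v1 xy; apply: ger_powR => //; rewrite v0.
have hi (x y : R) : 1 <= v -> x <= y -> v `^ x <= v `^ y.
  by move=> v1 xy; apply: ler_powR.
rewrite /hat; have [v1|/ltW v1] := leP v 1.
  have -> : Num.min (v `^ A) (v `^ (- A)) = v `^ A.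
    by apply/min_idPl; apply: lo => //; lra.
  by rewrite ge_min lo.
have -> : Num.min (v `^ A) (v `^ (- A)) = v `^ (- A).
  by apply/min_idPr; apply: hi => //; lra.
by rewrite ge_min [X in _ || X]hi ?orbT//; lra.
Qed.

(** * Dyadic layers and weak bounds on a set *)

Section layers.
Local Open Scope ereal_scope.
Context d (T : measurableType d) (R : realType).
Implicit Types (mu : {measure set T -> \bar R}) (f u : T -> \bar R) (A E : set T).

Lemma superlevel_cutoff A f (l : R) : (0 <= l)%R ->
  superlevel (cutoff A f) l = A `&` superlevel f l.
Proof.
move=> l0; apply/seteqP; split => x; rewrite /superlevel/=.
  have [Ax|Ax] := pselect (A x); first by rewrite cutoffT.
  by rewrite cutoffF// lte_fin ltNge l0.
by move=> [Ax fx]; rewrite cutoffT.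
Qed.

Lemma layer_le f (c delta : R) (P : pred int) x : (0 < c)%R -> (0 < delta)%R ->
  0 <= f x ->
  (forall j, (dyad c j)%:E < f x -> f x <= (dyad c (j + 1)%R)%:E -> P j) ->
  (f x = +oo -> exists m : int, forall j, (m <= j)%R -> P j) ->
  f x `^ delta <= zsum (fun j => (dyad (c * delta) (j + 1) * (P j)%:R)%:E *
     (\1_(superlevel f (dyad c j)) x)%:E).
Proof.
move=> c0 d0 fx0 Pf Poo.
have t0 j : 0 <= (dyad (c * delta) (j + 1) * (P j)%:R)%:E *
     (\1_(superlevel f (dyad c j)) x)%:E :> \bar R.
  by rewrite mule_ge0 ?lee_fin// mulr_ge0// dyad_ge0.
move: fx0 Pf Poo; case fxE : (f x) => [r||]// r0 Pf Poo; last first.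
  have [m Pm] := Poo erefl.
  suff h (M : R) : (0 < M)%R -> M%:E <= zsum (fun j =>
      (dyad (c * delta) (j + 1) * (P j)%:R)%:E *
      (\1_(superlevel f (dyad c j)) x)%:E).
    apply: le_trans (leey _) _; rewrite leye_eq; apply/eqP/eqyP => M M0.
    exact: h.
  move=> M0; have cd := mulr_gt0 c0 d0.
  have [j /andP[_ j2]] := dyad_bracket_oc cd M0.
  pose k := Num.max m j.
  apply: le_trans (zsum_ge k t0) => /=.
  rewrite Pm ?le_max ?lexx// mulr1 indicE mem_set ?mule1; last first.
    by rewrite /superlevel/= fxE ltry.
  rewrite lee_fin (le_trans j2)// dyad_le ?(ltW cd)// lerD2r.
  by rewrite le_max lexx orbT.
have [->|rN0] := eqVneq r 0%R.
  by rewrite poweR0r ?gt_eqF//; exact: zsum_ge0.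
have rp : (0 < r)%R by rewrite lt_neqAle eq_sym rN0.
have [j /andP[j1 j2]] := dyad_bracket_oc c0 rp.
apply: le_trans (zsum_ge j t0) => /=.
rewrite Pf ?lte_fin ?lee_fin// mulr1 indicE mem_set ?mule1; last first.
  by rewrite /superlevel/= fxE lte_fin.
by rewrite /= mulr1 -dyad_powR ge0_ler_powR ?nnegrE ?dyad_ge0 ?(ltW d0) ?(ltW rp).
Qed.

Lemma integral_layers mu f (c : R) (w : int -> R) :
  measurable_fun setT f -> (forall j, 0 <= w j)%R ->
  \int[mu]_x zsum (fun j => (w j)%:E * (\1_(superlevel f (dyad c j)) x)%:E) =
  zsum (fun j => (w j)%:E * mu (superlevel f (dyad c j))).
Proof.
move=> mf w0; have mI j : measurable_fun setT (fun x => (\1_(superlevel f (dyad c j)) x : R)%:E).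
  by apply/measurable_EFinP; apply: measurable_indic; exact: measurable_superlevel.
rewrite integral_zsum//; last 2 first.
- by move=> j; exact: measurable_funeM.
- by move=> j x; rewrite mule_ge0 ?lee_fin.
congr zsum; apply/funext => j; rewrite ge0_integralZl ?lee_fin//.
by rewrite integral_indic ?setIT//; exact: measurable_superlevel.
Qed.

(** [X] stands for the measure of [E], and [tau] for the weak L^p size of u normalised by that
    measure; an upper bound for the measure is enough in this form. *)
Definition weak_bound mu E u (p X tau : R) : Prop :=
  mu E <= X%:E /\
  forall l : R, (0 < l)%R -> mu (E `&` superlevel u l) <= (X * (tau / l) `^ p)%:E.

(** The bound on the measure of [E] controls the low levels and the weak estimate the high ones,
    hence decay on both sides of [tau]. *)
Lemma weak_bound_hat mu E u (c p delta X tau : R) j :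
  (0 < c)%R -> (0 < delta < p)%R -> (0 <= X)%R -> (0 < tau)%R ->
  measurable E -> measurable_fun setT u ->
  weak_bound mu E u p X tau ->
  (dyad (c * delta) j)%:E * mu (superlevel (cutoff E u) (dyad c j)) <=
  (X * tau `^ delta * hat (Num.min delta (p - delta)) (dyad c j / tau))%:E.
Proof.
move=> c0 dp X0 tau0 mE mU [h1 h2]; have tN0 : tau != 0%R by rewrite gt_eqF.
have v0 : (0 < dyad c j / tau)%R by rewrite divr_gt0// dyad_gt0.
rewrite superlevel_cutoff ?dyad_ge0//.
apply: (@le_trans _ _ ((dyad (c * delta) j) *
    (X * Num.min 1 ((dyad c j / tau) `^ (- p))))%:E).
  rewrite EFinM lee_wpmul2l ?lee_fin ?dyad_ge0//.
  rewrite minr_pMr// mulr1 EFin_min le_min; apply/andP; split.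
    apply: le_trans h1; apply: le_measure; rewrite ?inE//.
    by apply: measurableI => //; exact: measurable_superlevel.
  rewrite (le_trans (h2 _ (dyad_gt0 _ _)))// lee_fin ler_wpM2l//.
  by rewrite -[(tau / _)%R]invf_div -[in leLHS]powR_inv1 ?(ltW v0)// -powRrM mulN1r.
rewrite lee_fin [leLHS]mulrCA -mulrA ler_wpM2l//.
apply: le_trans (ler_wpM2l (powR_ge0 tau delta) (weak_hat dp v0)).
rewrite mulrA -powRM ?(ltW tau0) ?(ltW v0)// mulrCA divff// mulr1.
by rewrite dyad_powR.
Qed.

(** Kolmogorov's inequality: a weak L^p bound on a set of finite measure controls the integral of
    any smaller power, since the layers decay geometrically away from the level [tau]. *)
Lemma kolmogorov (p delta : R) : (0 < delta < p)%R ->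
  exists2 C : R, (0 < C)%R & forall mu E u (X tau : R),
  (0 <= X)%R -> (0 < tau)%R -> measurable E -> measurable_fun setT u ->
  (forall x, 0 <= u x) -> weak_bound mu E u p X tau ->
  \int[mu]_(x in E) (u x `^ delta) <= (C * (X * tau `^ delta))%:E.
Proof.
move=> dp; have /andP[d0 dp'] := dp.
have A0 : (0 < Num.min delta (p - delta))%R by rewrite lt_min d0 subr_gt0.
have [C C0 hC] := zsum_hat (@ltr01 R) A0.
exists (2 `^ delta * C)%R; first by rewrite mulr_gt0// powR_gt0.
move=> mu E u X tau X0 tau0 mE mU u0 wb.
have muc : measurable_fun setT (cutoff E u) by exact: measurable_cutoff.
have cu0 x : 0 <= cutoff E u x by exact: cutoff_ge0.
have mpw f : measurable_fun setT f -> measurable_fun setT (fun x => f x `^ delta).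
  by move=> mf; exact: (measurableT_comp (measurable_poweR delta) mf).
pose w (j : int) : R := (dyad (1 * delta) (j + 1) * (predT j)%:R)%R.
have w0 j : (0 <= w j)%R by rewrite mulr_ge0// dyad_ge0.
apply: (@le_trans _ _ (\int[mu]_x zsum (fun j => (w j)%:E *
    (\1_(superlevel (cutoff E u) (dyad 1 j)) x)%:E))).
  rewrite integral_cutoff; apply: ge0_le_integral => //.
  - by move=> x _; apply: cutoff_ge0 => ?; exact: poweR_ge0.
  - by apply: measurable_cutoff => //; exact: mpw.
  - apply: measurable_zsum => j => [|x].
      apply: measurable_funeM; apply/measurable_EFinP; apply: measurable_indic.
      exact: measurable_superlevel.
    by rewrite mule_ge0 ?lee_fin.
  - move=> x _; apply: (@le_trans _ _ (cutoff E u x `^ delta)).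
      have [Ex|Ex] := pselect (E x); first by rewrite !cutoffT.
      by rewrite !cutoffF// poweR_ge0.
    by apply: layer_le => // _; exists 0%R.
rewrite integral_layers//.
apply: (@le_trans _ _ (zsum (fun j => (2 `^ delta * (X * tau `^ delta))%:E *
   (hat (Num.min delta (p - delta)) (dyad 1 j / tau))%:E))).
  apply: le_zsum => j; rewrite /w mulr1 addrC dyadD {1}/dyad mul1r mulr1 !EFinM -!muleA.
  rewrite lee_wpmul2l ?lee_fin ?powR_ge0// -[dyad delta j](congr1 (dyad ^~ j) (mul1r delta)).
  by have := @weak_bound_hat mu E u 1 p delta X tau j ltr01 dp X0 tau0 mE mU wb; rewrite !EFinM -!muleA.
rewrite zsumZl; [|by move=> j; rewrite lee_fin hat_ge0|by rewrite !mulr_ge0 ?powR_ge0].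
rewrite [leRHS](_ : _ = (2 `^ delta * (X * tau `^ delta))%:E * C%:E).
  by rewrite lee_wpmul2l ?hC// lee_fin !mulr_ge0 ?powR_ge0.
by rewrite -EFinM; congr EFin; ring.
Qed.

(* For every [c > 0] the l^(r/q) quasi-norm of [dseq mu c q `|f|] is comparable
   with the [q]-th power of the Lorentz quasi-norm of [f] in L^(q,r). *)
Definition dseq mu (c p : R) f (j : int) : \bar R :=
  (dyad (c * p) j)%:E * mu (superlevel f (dyad c j)).

Lemma dseq_ge0 mu (c p : R) f j : 0 <= dseq mu c p f j.
Proof. by rewrite mule_ge0// lee_fin dyad_ge0. Qed.

(** On a set of finite measure weak L^q lies in L^(p,r) for p < q whatever r is: a sequence with a
    [hat] profile lies in every l^sigma. *)
Lemma weak_lbound sigma (c p q : R) : 0 < sigma -> (0 < c)%R -> (0 < p < q)%R ->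
  exists2 C : R, (0 < C)%R & forall mu E u (X tau : R),
  (0 <= X)%R -> (0 < tau)%R -> measurable E -> measurable_fun setT u ->
  weak_bound mu E u q X tau ->
  lbound sigma (dseq mu c p (cutoff E u)) (C * (X * tau `^ p)).
Proof.
move=> s0 c0 pq; have /andP[p0 pq'] := pq.
have A0 : (0 < Num.min p (q - p))%R by rewrite lt_min p0 subr_gt0.
have [C C0 hC] := lbound_hat s0 c0 A0; exists C => // mu E u X tau X0 tau0 mE mU wb.
apply: (hC _ tau) => //.
- by rewrite mulr_ge0// powR_ge0.
- by move=> j; exact: dseq_ge0.
- by move=> j; exact: weak_bound_hat.
Qed.

End layers.

(** * Marcinkiewicz interpolation for dyadic level sequences *)

Section marcinkiewicz.
Local Open Scope ereal_scope.
Context d (T : measurableType d) (R : realType).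
Implicit Types (mu : {measure set T -> \bar R}) (f u : T -> \bar R).

Record sublinear (S : (T -> \bar R) -> T -> \bar R) : Prop := Sublinear {
  sublinear_measurable : forall f, measurable_fun setT f ->
    (forall x, 0 <= f x) -> measurable_fun setT (S f);
  sublinear_ge0 : forall f x, (forall x, 0 <= f x) -> 0 <= S f x;
  sublinearD : forall f1 f2 x, measurable_fun setT f1 -> measurable_fun setT f2 ->
    (forall x, 0 <= f1 x) -> (forall x, 0 <= f2 x) ->
    S (fun y => f1 y + f2 y) x <= S f1 x + S f2 x }.

Definition weak_type mu (S : (T -> \bar R) -> T -> \bar R) (p K : R) : Prop :=
  forall f (l : R), measurable_fun setT f -> (forall x, 0 <= f x) -> (0 < l)%R ->
  mu (superlevel (S f) l) <= (K * l `^ (- p))%:E * \int[mu]_x (f x `^ p).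

Lemma measurable_poweR_fun f (p : R) : measurable_fun setT f ->
  measurable_fun setT (fun x => f x `^ p).
Proof. by move=> mf; exact: (measurableT_comp (measurable_poweR p) mf). Qed.

Lemma superlevel_sum mu f f1 f2 (l : R) : measurable_fun setT f ->
  measurable_fun setT f1 -> measurable_fun setT f2 ->
  (forall x, f x <= f1 x + f2 x) ->
  mu (superlevel f l) <= mu (superlevel f1 (l / 2)) + mu (superlevel f2 (l / 2)).
Proof.
move=> mf m1 m2 h.
have mS g k : measurable_fun setT g -> measurable (superlevel g k).
  by move=> mg; exact: measurable_superlevel.
apply: le_trans (measureU2 _ _ _); [|exact: mS..].
apply: le_measure; rewrite ?inE//; first exact: mS.
  by apply: measurableU; exact: mS.
move=> x; rewrite /superlevel/= => lx; apply: contrapT => /not_orP[/negP + /negP].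
rewrite -!leNgt => h1 h2.
have := lt_le_trans lx (le_trans (h x) (leeD h1 h2)).
by rewrite -EFinD -splitr ltxx.
Qed.

(** One half of the interpolation: [g] is the part of f above or below the height 2^(c j), and [P]
    is the half-line of level differences k - j on which 2^(c (q - p) l) decays. The constant 2^((1
    + c) q) collects 2^q from the halved level and 2^(c q) from rounding a value up to the next
    dyadic one. *)
Lemma superlevel_dist_bound mu f (c q p eta : R) (P : pred int) (g : T -> \bar R) (j : int) :
  (0 < c)%R -> (0 < q)%R -> measurable_fun setT f -> (forall x, 0 <= f x) ->
  measurable_fun setT g -> (forall x, 0 <= g x) ->
  (forall x, g x <= f x) ->
  (forall x k, (dyad c k)%:E < g x -> g x <= (dyad c (k + 1)%R)%:E -> P (k - j)%R) ->
  (forall x, g x = +oo -> exists m : int, forall k, (m <= k)%R -> P (k - j)%R) ->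
  (forall l, P l -> dyad (c * (q - p)) l <= hat eta (dyad c l))%R ->
  (dyad (c * p) j * (dyad c j / 2) `^ (- q))%:E * \int[mu]_x (g x `^ q) <=
  zsum (fun l => (hat eta (dyad c l))%:E *
    ((2 `^ ((1 + c) * q))%:E * dseq mu c p f (j + l)%R)).
Proof.
move=> c0 q0 mf f0 mg g0 gf Pg Pgoo Ph.
pose w k : R := (dyad (c * q) (k + 1) * (P (k - j))%:R)%R.
have w0 k : (0 <= w k)%R by rewrite mulr_ge0// dyad_ge0.
apply: (@le_trans _ _ ((dyad (c * p) j * (dyad c j / 2) `^ (- q))%:E *
    zsum (fun k => (w k)%:E * mu (superlevel f (dyad c k))))).
  rewrite lee_wpmul2l ?lee_fin ?mulr_ge0 ?dyad_ge0 ?powR_ge0//.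
  rewrite -integral_layers//; apply: ge0_le_integral => //.
  - by move=> x _; exact: poweR_ge0.
  - exact: measurable_poweR_fun.
  - apply: measurable_zsum => k => [|x].
      apply: measurable_funeM; apply/measurable_EFinP; apply: measurable_indic.
      exact: measurable_superlevel.
    by rewrite mule_ge0 ?lee_fin.
  - move=> x _; apply: (le_trans (@layer_le _ _ _ g c q (fun k => P (k - j)%R) x c0 q0 (g0 x) (Pg x) (Pgoo x))).
    apply: le_zsum => k; rewrite lee_wpmul2l ?lee_fin ?w0//.
    rewrite !indicE ler_nat; case: (boolP (x \in superlevel g _)) => //.
    rewrite inE => xg; rewrite mem_set//.
    by move: xg; rewrite /superlevel/= => /lt_le_trans; apply.
rewrite -zsumZl ?mulr_ge0 ?dyad_ge0 ?powR_ge0//; last first.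
  by move=> k; rewrite mule_ge0// lee_fin.
rewrite -(zsum_shift _ j); apply: le_zsum => l.
rewrite /w /= [(l + j)%R]addrC /dseq.
have -> : (j + l - j = l)%R by rewrite addrC addKr.
rewrite !muleA; apply: lee_wpmul2r => //.
rewrite -!EFinM lee_fin.
have [Pl|Pl] := boolP (P l); last first.
  by rewrite /= !mulr0 !mulr_ge0 ?hat_ge0 ?powR_ge0// dyad_ge0.
rewrite /= mulr1.
rewrite [leLHS](_ : _ = dyad (c * (q - p)) l * (2 `^ ((1 + c) * q) * dyad (c * p) (j + l)))%R.
  by rewrite -mulrA ler_wpM2r ?Ph// mulr_ge0 ?powR_ge0 ?dyad_ge0.
rewrite -addrA !dyadD [in dyad (c * q) 1]/dyad.
have -> : ((dyad c j / 2) `^ (- q) = 2 `^ q / dyad (c * q) j :> R)%R.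
  rewrite powRM ?dyad_ge0// dyad_powR mulrN dyad_opp mulrC; congr (_ * _)%R.
  by rewrite -powR_inv1// -powRrM mulrNN mul1r.
have -> : (2 `^ ((1 + c) * q) = 2 `^ q * 2 `^ (c * q * 1%:~R) :> R)%R.
  by rewrite mulrDl mul1r powRD ?mulr1// pnatr_eq0 implybT.
have -> : (dyad (c * q) l = dyad (c * (q - p)) l * dyad (c * p) l :> R)%R.
  by rewrite -dyad_split -mulrDr subrK.
have : (dyad (c * q) j != 0 :> R)%R by rewrite gt_eqF// dyad_gt0.
by move: (dyad (c * q) j) (2 `^ (c * q * 1%:~R)) (2 `^ q) => a b b' a0; field.
Qed.

(** Cutting f at the output level itself bounds the sequence of S f by a convolution of that of f
    with a [hat] kernel, so [lbound_conv] gives all second exponents at once. *)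
Lemma marcinkiewicz sigma (c pa p pb K : R) : 0 < sigma -> (0 < c)%R ->
  (0 < pa)%R -> (pa < p)%R -> (p < pb)%R -> (0 < K)%R ->
  exists2 C : R, (0 < C)%R & forall mu S f (B : R),
  sublinear S -> weak_type mu S pa K -> weak_type mu S pb K ->
  measurable_fun setT f -> (forall x, 0 <= f x) -> (0 <= B)%R ->
  lbound sigma (dseq mu c p f) B -> lbound sigma (dseq mu c p (S f)) (C * B).
Proof.
move=> s0 c0 pa0 pap ppb K0.
pose eta : R := Num.min (p - pa)%R (pb - p)%R.
have eta0 : (0 < eta)%R by rewrite lt_min !subr_gt0 pap.
have pb0 : (0 < pb)%R by lra.
have [C C0 hC] := lbound_conv s0 c0 eta0.
pose K' : R := (K * (2 `^ ((1 + c) * pa) + 2 `^ ((1 + c) * pb)))%R.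
have K'0 : (0 < K')%R by rewrite mulr_gt0// addr_gt0// powR_gt0.
exists (C * K')%R; first exact: mulr_gt0.
move=> mu S f B sS wa wb mf f0 B0 hB.
rewrite -mulrA.
apply: (hC _ (fun j => K'%:E * dseq mu c p f j)).
- by rewrite mulr_ge0// ltW.
- by move=> j; exact: dseq_ge0.
- by move=> j; rewrite mule_ge0 ?dseq_ge0// lee_fin ltW.
- move=> j; pose H := superlevel f (dyad c j).
  have mH : measurable H by exact: measurable_superlevel.
  pose f1 := cutoff H f; pose f2 := cutoff (~` H) f.
  have mf1 : measurable_fun setT f1 by exact: measurable_cutoff.
  have mf2 : measurable_fun setT f2 by apply: measurable_cutoff => //; exact: measurableC.
  have f10 x : 0 <= f1 x by exact: cutoff_ge0.
  have f20 x : 0 <= f2 x by exact: cutoff_ge0.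
  have eA : (eta <= p - pa)%R by rewrite ge_min lexx.
  have eB : (eta <= pb - p)%R by rewrite ge_min lexx orbT.
  have dle (a b : R) : (a <= b)%R -> (2 `^ a <= 2 `^ b :> R)%R.
    by move=> ab; rewrite ler_powR// ler1n.
  have l2 : (0 < dyad c j / 2 :> R)%R by rewrite divr_gt0// dyad_gt0.
  have half : mu (superlevel (S f) (dyad c j)) <=
      mu (superlevel (S f1) (dyad c j / 2)) + mu (superlevel (S f2) (dyad c j / 2)).
    apply: superlevel_sum; [exact: (sublinear_measurable sS)..|].
    move=> x; apply: le_trans (sublinearD sS _ mf1 mf2 f10 f20).
    by rewrite (_ : (fun y => _) = f)//; apply/funext => y; rewrite cutoff_split.
  have I1 := @superlevel_dist_bound mu f c pa p eta (fun l => 0 <= l)%R f1 j c0 pa0 mf f0 mf1 f10.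
  have I2 := @superlevel_dist_bound mu f c pb p eta (fun l => l < 0)%R f2 j c0 pb0 mf f0 mf2 f20.
  rewrite /dseq; apply: (@le_trans _ _ ((dyad (c * p) j)%:E *
      ((K * (dyad c j / 2) `^ (- pa))%:E * \int[mu]_x (f1 x `^ pa) +
       (K * (dyad c j / 2) `^ (- pb))%:E * \int[mu]_x (f2 x `^ pb)))).
    rewrite lee_wpmul2l ?lee_fin ?dyad_ge0//; apply: (le_trans half).
    by apply: leeD; [exact: wa|exact: wb].
  rewrite muleDr ?ge0_adde_def ?inE ?mule_ge0 ?lee_fin ?mulr_ge0 ?powR_ge0 ?(ltW K0)//; last 2 first.
  - by apply: integral_ge0 => x _; exact: poweR_ge0.
  - by apply: integral_ge0 => x _; exact: poweR_ge0.
  rewrite !muleA -!EFinM ![(dyad (c * p) j * (K * _))%R]mulrCA !EFinM -!muleA.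
  apply: (@le_trans _ _ (K%:E * zsum (fun l => (hat eta (dyad c l))%:E *
    ((2 `^ ((1 + c) * pa))%:E * dseq mu c p f (j + l)%R)) +
    K%:E * zsum (fun l => (hat eta (dyad c l))%:E *
    ((2 `^ ((1 + c) * pb))%:E * dseq mu c p f (j + l)%R)))).
    apply: leeD; apply: lee_wpmul2l; rewrite ?lee_fin ?(ltW K0)//; rewrite !muleA -?EFinM.
    - apply: I1.
      + by move=> x; exact: cutoff_le.
      + move=> x k h1 h2; have [Hx|Hx] := pselect (H x); last first.
          by move: h1; rewrite /f1 cutoffF// lte_fin ltNge dyad_ge0.
        move: h2; rewrite /f1 cutoffT// => h2.
        have := lt_le_trans Hx h2; rewrite lte_fin => /(dyad_lt_inv c0).
        by rewrite subr_ge0 ltzD1.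
      + by move=> x _; exists j => k; rewrite subr_ge0.
      + move=> l l0; rewrite /hat le_min !dyad_powR /dyad; apply/andP; split.
          apply: dle; rewrite ler_wpM2r ?ler0z// ler_wpM2l ?(ltW c0)//; lra.
        by apply: dle; rewrite ler_wpM2r ?ler0z// ler_wpM2l ?(ltW c0)//; lra.
    - apply: I2.
      + by move=> x; exact: cutoff_le.
      + move=> x k h1 h2; have [Hx|Hx] := pselect ((~` H) x); last first.
          by move: h1; rewrite /f2 cutoffF// lte_fin ltNge dyad_ge0.
        move: h1; rewrite /f2 cutoffT// => h1; move: Hx => /negP; rewrite -leNgt => Hx.
        have := lt_le_trans h1 Hx; rewrite lte_fin => /(dyad_lt_inv c0).
        by rewrite subr_lt0.
      + move=> x; have [Hx|Hx] := pselect ((~` H) x); last by rewrite /f2 cutoffF.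
        rewrite /f2 cutoffT//; move: Hx => /negP; rewrite -leNgt => Hx fx.
        by move: Hx; rewrite fx leye_eq.
      + move=> l l0; rewrite /hat le_min !dyad_powR /dyad.
        have l0' : (l%:~R <= 0 :> R)%R by rewrite lerz0 ltW.
        apply/andP; split.
          by apply: dle; rewrite ler_wnM2r// ler_wpM2l ?(ltW c0)//; lra.
        by apply: dle; rewrite ler_wnM2r// ler_wpM2l ?(ltW c0)//; lra.
  have t0 q l : 0 <= (hat eta (dyad c l))%:E *
    ((2 `^ ((1 + c) * q))%:E * dseq mu c p f (j + l)%R) :> \bar R.
    by rewrite !mule_ge0 ?lee_fin ?hat_ge0 ?powR_ge0 ?dseq_ge0.
  rewrite -!zsumZl ?(ltW K0)// -zsumD; [|by move=> l; rewrite mule_ge0 ?t0// lee_fin ltW..].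
  apply: le_zsum => l; rewrite /K' /dseq !muleA -!EFinM -ge0_muleDl; last 2 first.
  - by rewrite lee_fin !mulr_ge0 ?hat_ge0 ?powR_ge0 ?dyad_ge0// ltW.
  - by rewrite lee_fin !mulr_ge0 ?hat_ge0 ?powR_ge0 ?dyad_ge0// ltW.
  rewrite -EFinD; apply: lee_wpmul2r => //; rewrite lee_fin.
  move: (hat _ _) (2 `^ ((1 + c) * pa))%R (2 `^ ((1 + c) * pb))%R (dyad (c * p) (j + l)) => x y z t.
  rewrite (_ : (x * K * (y + z) * t = K * x * y * t + K * x * z * t)%R)//.
  by ring.
- exact: (lboundZ s0 (ltW K'0) B0 (dseq_ge0 mu c p f) hB).
Qed.

End marcinkiewicz.

(** * The dyadic maximal operator *)

Section dyadic_system.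
Local Open Scope ereal_scope.
Context d (T : measurableType d) (R : realType).
Variable mu : {sigma_finite_measure set T -> \bar R}.

(* [Q k x] is the dyadic cube of side 2^k containing [x] and [N k x] the union
   of the dyadic cubes of side 2^k touching it. *)
Record dyadic_system (nu K : R) (Q N : int -> T -> set T) : Prop := DyadicSystem {
  cube_sym : forall k x y, Q k x y -> Q k y x;
  cube_trans : forall k x y z, Q k x y -> Q k y z -> Q k x z;
  cubeS : forall k x, Q k x `<=` Q (k + 1)%R x;
  nbhd_sym : forall k x y, N k x y -> N k y x;
  sub_cube_nbhd : forall k x y, N k x y -> Q k y `<=` N k x;
  nbhdxx : forall k x, N k x x;
  nbhdS : forall k x, N k x `<=` N (k + 1)%R x;
  sub_nbhd_nbhdS : forall k x y, N k x y -> N k y `<=` N (k + 1)%R x;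
  nbhd_cover : forall x y, exists k, N k x y;
  measurable_cube_rel : forall k, measurable [set z : T * T | Q k z.1 z.2];
  measurable_nbhd_rel : forall k, measurable [set z : T * T | N k z.1 z.2];
  measure_cube : forall k x, mu (Q k x) = (dyad nu k)%:E;
  measure_nbhd : forall k x, mu (N k x) <= (K * dyad nu k)%:E }.

Variables (nu K : R) (Q N : int -> T -> set T).
Hypothesis ds : dyadic_system nu K Q N.
Implicit Types (f h : T -> \bar R).

Lemma measurable_cube k x : measurable (Q k x).
Proof. exact: (@measurable_rel _ T (Q k) (measurable_cube_rel ds k) x). Qed.

Lemma measurable_nbhd k x : measurable (N k x).
Proof. exact: (@measurable_rel _ T (N k) (measurable_nbhd_rel ds k) x). Qed.

Lemma int_mono (F : int -> set T) : (forall k, F k `<=` F (k + 1)%R) ->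
  forall j k, (j <= k)%R -> F j `<=` F k.
Proof.
move=> h j k; rewrite -subr_ge0; case E : (k - j)%R => [m|//] _.
have -> : k = (j + m%:Z)%R by rewrite -E addrC subrK.
elim: m {E} => [|m IH]; first by rewrite addr0.
apply: subset_trans IH _; apply: subset_trans (h _) _.
by rewrite -addrA intS [(1 + _)%R]addrC.
Qed.

Lemma cube_le j k x : (j <= k)%R -> Q j x `<=` Q k x.
Proof. by apply: (@int_mono (Q ^~ x)) => i; exact: cubeS ds i x. Qed.

Lemma nbhd_le j k x : (j <= k)%R -> N j x `<=` N k x.
Proof. by apply: (@int_mono (N ^~ x)) => i; exact: nbhdS ds i x. Qed.

Lemma measurable_int_nbhd k h : measurable_fun setT h -> (forall x, 0 <= h x) ->
  measurable_fun setT (fun x => \int[mu]_(y in N k x) h y).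
Proof. exact: (measurable_integral_rel mu (S := N k) (measurable_nbhd_rel ds k)). Qed.

Lemma measurable_int_cube k h : measurable_fun setT h -> (forall x, 0 <= h x) ->
  measurable_fun setT (fun x => \int[mu]_(y in Q k x) h y).
Proof. exact: (measurable_integral_rel mu (S := Q k) (measurable_cube_rel ds k)). Qed.

(** Normalised by the measure of a cube instead of that of the neighbourhood; the discrepancy is at
    most a factor [K]. *)
Definition average k h x : \bar R :=
  (dyad nu (- k))%:E * \int[mu]_(y in N k x) h y.

Lemma average_ge0 k h x : (forall x, 0 <= h x) -> 0 <= average k h x.
Proof.
by move=> h0; rewrite mule_ge0 ?lee_fin ?dyad_ge0//; exact: integral_ge0.
Qed.

Lemma measurable_average k h : measurable_fun setT h -> (forall x, 0 <= h x) ->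
  measurable_fun setT (average k h).
Proof. by move=> mh h0; apply: measurable_funeM; exact: measurable_int_nbhd. Qed.

Definition maximal h x : \bar R := ereal_sup (range (fun k => average k h x)).

Lemma average_le_maximal k h x : average k h x <= maximal h x.
Proof. by apply: ereal_sup_ubound; exists k. Qed.

Lemma maximal_ge0 h x : (forall x, 0 <= h x) -> 0 <= maximal h x.
Proof. by move=> h0; apply: le_trans (average_le_maximal 0 h x); exact: average_ge0. Qed.

Lemma superlevel_maximal h l :
  superlevel (maximal h) l = \bigcup_n superlevel (average (int_of_index n) h) l.
Proof.
apply/seteqP; split => x; rewrite /superlevel/=.
  move=> /ereal_sup_gt[_ [k _ <-]] lk.
  have [_ _ /(_ k Logic.I)[n _ nk]] := int_of_index_bij.
  by exists n => //=; rewrite nk.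
by move=> [n _ /= ln]; apply: lt_le_trans ln (average_le_maximal _ _ _).
Qed.

Lemma measurable_maximal h : measurable_fun setT h -> (forall x, 0 <= h x) ->
  measurable_fun setT (maximal h).
Proof.
move=> mh h0.
rewrite (_ : maximal h = fun x => esups (fun n => average (int_of_index n) h x) 0%N).
  by apply: measurable_fun_esups => n; exact: measurable_average.
apply/funext => x; rewrite /maximal /esups/=; congr ereal_sup.
apply/seteqP; split => [_ [k _ <-]|_ [n _ <-]]; last by exists (int_of_index n).
have [_ _ /(_ k Logic.I)[n _ nk]] := int_of_index_bij.
by exists n => //=; rewrite nk.
Qed.

Lemma integral_nbhd_le k j x y f h : measurable_fun setT f -> measurable_fun setT h ->
  (forall x, 0 <= f x) -> (forall x, 0 <= h x) ->
  N k x `<=` N j y -> (forall z, N k x z -> f z <= h z) ->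
  \int[mu]_(z in N k x) f z <= \int[mu]_(z in N j y) h z.
Proof.
by move=> mf mh f0 h0 s fh; apply: ge0_integral_le => //; exact: measurable_nbhd.
Qed.

Lemma maximal_le f h x : measurable_fun setT f -> measurable_fun setT h ->
  (forall x, 0 <= f x) -> (forall x, 0 <= h x) -> (forall x, f x <= h x) ->
  maximal f x <= maximal h x.
Proof.
move=> mf mh f0 h0 fh; apply: ge_ereal_sup => _ [k _ <-].
apply: le_trans (average_le_maximal k h x).
by rewrite lee_wpmul2l ?lee_fin ?dyad_ge0// integral_nbhd_le.
Qed.

Lemma averageD k f h x : measurable_fun setT f -> measurable_fun setT h ->
  (forall x, 0 <= f x) -> (forall x, 0 <= h x) ->
  average k (fun y => f y + h y) x = average k f x + average k h x.
Proof.
move=> mf mh f0 h0; rewrite /average ge0_integralD//; last 3 first.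
- exact: measurable_nbhd.
- exact: measurable_funTS.
- exact: measurable_funTS.
by rewrite ge0_muleDr//; exact: integral_ge0.
Qed.

Lemma sublinear_maximal : sublinear maximal.
Proof.
split=> [f mf f0|f x f0|f1 f2 x m1 m2 f10 f20].
- exact: measurable_maximal.
- exact: maximal_ge0.
- apply: ge_ereal_sup => _ [k _ <-]; rewrite averageD//.
  by apply: leeD; exact: average_le_maximal.
Qed.

Section weak11.
Variables (f : T -> \bar R) (l : R).
Hypotheses (mf : measurable_fun setT f) (f0 : forall x, 0 <= f x) (l0 : (0 < l)%R).
Hypothesis K0 : (0 < K)%R.

Let s := (l / K)%R.

Let s0 : (0 < s)%R. Proof. by rewrite divr_gt0. Qed.

Let A k : set T := superlevel (fun y => \int[mu]_(z in Q k y) f z) (s * dyad nu k).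

Let mA k : measurable (A k).
Proof.
apply: measurable_superlevel.
exact: measurable_int_cube.
Qed.

Let cubeE k x y : Q k x y -> Q k x = Q k y.
Proof.
move=> xy; apply/seteqP; split => z h.
  by apply: (cube_trans ds) h; exact: (cube_sym ds).
exact: (cube_trans ds) xy h.
Qed.

Let AQ j k x y : (j <= k)%R -> A k x -> Q j x y -> A k y.
Proof.
by move=> jk; rewrite /A /superlevel/= => h /(cube_le jk)/cubeE <-.
Qed.

(** The neighbourhood is a union of cubes with at most [K] times the measure of one, so an average
    above l forces one of its cubes to be heavy, that is, to have average above l / K. Counting
    cubes is replaced by integrating the relation [Q k] over the neighbourhood. *)
Let meetA k x : (l%:E < average k f x) -> exists2 y, N k x y & A k y.
Proof.
move=> lx; apply: contrapT => /forall2NP nA.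
have /= small y : N k x y -> \int[mu]_(z in Q k y) f z <= (s * dyad nu k)%:E.
  by move=> xy; have [//|/negP] := nA y; rewrite -leNgt.
have mN := measurable_nbhd k x.
have mc : measurable_fun setT (cutoff (N k x) f) by exact: measurable_cutoff.
have c0 y : 0 <= cutoff (N k x) f y by exact: cutoff_ge0.
have sym := @integral_rel_sym _ _ _ mu (Q k) (measurable_cube_rel ds k)
  (cube_sym ds (k := k)) (cst 1) _ (measurable_cst _) mc (fun _ => lee01) c0.
suff : (dyad nu k)%:E * \int[mu]_(y in N k x) f y <= (dyad nu k * (l * dyad nu k))%:E.
  rewrite EFinM lee_pmul2l ?lte_fin ?dyad_gt0// => h; move: lx; apply/negP.
  rewrite -leNgt /average dyadN muleC lee_pdivrMr ?dyad_gt0//.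
apply: (@le_trans _ _ (\int[mu]_y (cutoff (N k x) f y * \int[mu]_(z in Q k y) cst 1 z))).
  rewrite integral_cutoff -ge0_integralZl//; last exact: dyad_ge0.
  rewrite le_eqVlt; apply/orP; left; apply/eqP/eq_integral => y _.
  rewrite integral_cst; last exact: measurable_cube.
  by rewrite mul1e muleC -(measure_cube ds k y).
rewrite -sym.
apply: (@le_trans _ _ (\int[mu]_z (s * dyad nu k * (\1_(N k x) z))%:E)).
  apply: ge0_le_integral => //.
  - by move=> z _; rewrite mul1e; exact: integral_ge0.
  - apply: measurable_funeM.
    exact: measurable_int_cube.
  - apply/measurable_EFinP; apply: measurable_funM => //; exact: measurable_indic.
  move=> z _; rewrite mul1e indicE; have [xz|xz] := pselect (N k x z).
    rewrite mem_set// mulr1; apply: le_trans (small z xz).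
    apply: ge0_integral_le => //; try exact: measurable_cube.
    by move=> y _; exact: cutoff_le.
  rewrite memNset// mulr0 (_ : \int[mu]_(_ in _) _ = 0)//.
  apply: integral0_eq => y zy; rewrite cutoffF// => xy; apply: xz.
  by apply: (sub_cube_nbhd ds xy); exact: (cube_sym ds).
under eq_integral do rewrite EFinM.
have mIN : measurable_fun setT (fun z => (\1_(N k x) z : R)%:E).
  by apply/measurable_EFinP; exact: measurable_indic.
rewrite ge0_integralZl//; last by rewrite lee_fin mulr_ge0 ?dyad_ge0 ?(ltW s0).
rewrite integral_indic// setIT.
apply: (le_trans (lee_wpmul2l _ (measure_nbhd ds k x))).
  by rewrite lee_fin mulr_ge0 ?dyad_ge0 ?(ltW s0).
rewrite -EFinM lee_fin /s le_eqVlt; apply/orP; left; apply/eqP.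
by have : (K != 0)%R by [rewrite gt_eqF]; move: (dyad _ _) => D KN0; field.
Qed.

Variable kappa : int.

Let E (i : nat) : set T := seqDU (fun i => A (kappa - i%:Z)%R) i.

Let mE i : measurable (E i).
Proof. by apply: measurableD; [exact: mA|apply: bigsetU_measurable => *; exact: mA]. Qed.

Let EE i : E i = A (kappa - i%:Z)%R `\` \bigcup_(j in `I_i) A (kappa - j%:Z)%R.
Proof. by rewrite /E /seqDU bigcup_mkord. Qed.

Let EQ i x y : E i x -> Q (kappa - i%:Z)%R x y -> E i y.
Proof.
rewrite EE => -[Ax nA] xy; split; first exact: AQ xy.
move=> -[j /= ji Ay]; apply: nA; exists j => //=; apply: (AQ _ Ay (cube_sym ds xy)).
by rewrite lerD2l lerN2 lez_nat ltnW.
Qed.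

Let mI i : measurable_fun setT (fun x => (\1_(E i) x : R)%:E).
Proof. by apply/measurable_EFinP; exact: measurable_indic. Qed.

Let I0 i x : 0 <= (\1_(E i) x : R)%:E :> \bar R.
Proof. by rewrite lee_fin. Qed.

Let int_indic i D : measurable D -> \int[mu]_(x in D) (\1_(E i) x : R)%:E = mu (E i `&` D).
Proof. by move=> mD; rewrite integral_indic. Qed.

(* Fubini for the relation [Q k] replaces a covering lemma: [E i] is a union of
   cubes of side 2^(kappa - i) on each of which [f] has average above [s]. *)
Let stepA i : s%:E * mu (E i) <= \int[mu]_(x in E i) f x.
Proof.
set k := (kappa - i%:Z)%R.
have sym := @integral_rel_sym _ _ _ mu (Q k) (measurable_cube_rel ds k)
  (cube_sym ds (k := k)) _ _ (mI i) mf (I0 i) f0.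
have mq : measurable_fun setT (fun y => \int[mu]_(z in Q k y) f z).
  exact: measurable_int_cube.
have mqI : measurable_fun setT (fun y => \int[mu]_(x in Q k y) (\1_(E i) x : R)%:E).
  exact: measurable_int_cube.
suff : (dyad nu k)%:E * (s%:E * mu (E i)) <= (dyad nu k)%:E * \int[mu]_(x in E i) f x.
  by rewrite lee_pmul2l ?lte_fin ?dyad_gt0.
have -> : mu (E i) = \int[mu]_x (\1_(E i) x : R)%:E by rewrite int_indic// setIT.
rewrite muleA -EFinM mulrC -ge0_integralZl//; last first.
  by rewrite lee_fin mulr_ge0 ?dyad_ge0 ?(ltW s0).
apply: (@le_trans _ _ (\int[mu]_x ((\1_(E i) x : R)%:E * \int[mu]_(z in Q k x) f z))).
  apply: ge0_le_integral => //.
  - by move=> x _; rewrite mule_ge0// lee_fin mulr_ge0 ?dyad_ge0 ?(ltW s0).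
  - exact: measurable_funeM.
  - exact: emeasurable_funM.
  move=> x _; rewrite indicE; case: (boolP (x \in E i)) => [|_]; last by rewrite mule0 mul0e.
  by rewrite inE => -[Ax _]; rewrite mule1 mul1e ltW.
have mcE : measurable_fun setT (cutoff (E i) f) by exact: measurable_cutoff.
have cE0 x : 0 <= cutoff (E i) f x by exact: cutoff_ge0.
rewrite sym [\int[mu]_(x in E i) f x]integral_cutoff -ge0_integralZl ?lee_fin ?dyad_ge0//.
apply: ge0_le_integral => //.
- by move=> x _; rewrite mule_ge0// integral_ge0.
- exact: emeasurable_funM.
- exact: measurable_funeM.
move=> y _; rewrite int_indic; last exact: measurable_cube.
have [Ey|Ey] := pselect (E i y).
  rewrite cutoffT// muleC lee_wpmul2r// -(measure_cube ds k y).
  apply: le_measure; rewrite ?inE; last exact: subIsetr.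
    by apply: measurableI => //; exact: measurable_cube.
  exact: measurable_cube.
rewrite cutoffF// mule0 (_ : _ `&` _ = set0) ?measure0 ?mule0//.
by apply/seteqP; split => // z [Ez yz]; apply: Ey; apply: (EQ Ez); exact: (cube_sym ds).
Qed.

(** Plays the role of the enlarged cubes of a covering argument. The factor 1/2 makes the inclusion
    of a whole cube in [E i] a strict inequality. *)
Let Nb i : set T :=
  superlevel (fun x => \int[mu]_(z in N (kappa - i%:Z)%R x) (\1_(E i) z : R)%:E)
    (dyad nu (kappa - i%:Z) / 2).

Let mNb i : measurable (Nb i).
Proof. by apply: measurable_superlevel; exact: measurable_int_nbhd. Qed.

(** Chebyshev's inequality, after Fubini for [N k] has bounded the integral over x of the measure of
    [N k x] within [E i] by K 2^(nu k) times the measure of [E i]. *)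
Let stepB i : mu (Nb i) <= (2 * K)%:E * mu (E i).
Proof.
set k := (kappa - i%:Z)%R.
have sym := @integral_rel_sym _ _ _ mu (N k) (measurable_nbhd_rel ds k)
  (nbhd_sym ds (k := k)) (cst 1) _ (measurable_cst _) (mI i) (fun _ => lee01) (I0 i).
have k2 : (0 < dyad nu k / 2)%R by rewrite divr_gt0// dyad_gt0.
have mi := @measurable_int_nbhd k _ (mI i) (I0 i).
have i0 x : 0 <= \int[mu]_(z in N k x) (\1_(E i) z : R)%:E by exact: integral_ge0.
have := chebyshev mu i0 mi (ltW k2); rewrite -/(Nb i) => h.
suff : (dyad nu k / 2)%:E * mu (Nb i) <= (dyad nu k / 2)%:E * ((2 * K)%:E * mu (E i)).
  by rewrite lee_pmul2l ?lte_fin.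
apply: (le_trans h).
rewrite [leLHS](_ : _ = \int[mu]_x (cst 1 x * \int[mu]_(z in N k x) (\1_(E i) z : R)%:E)); last first.
  by apply: eq_integral => x _; rewrite mul1e.
rewrite sym muleA -EFinM (_ : dyad nu k / 2 * (2 * K) = K * dyad nu k)%R; last by field.
have -> : mu (E i) = \int[mu]_x (\1_(E i) x : R)%:E by rewrite int_indic// setIT.
rewrite -ge0_integralZl//; last by rewrite lee_fin mulr_ge0 ?dyad_ge0 ?(ltW K0).
apply: ge0_le_integral => //.
- by move=> x _; rewrite mule_ge0// integral_ge0.
- apply: emeasurable_funM => //; apply: measurable_int_nbhd => //.
- exact: measurable_funeM.
move=> y _; rewrite muleC lee_wpmul2r// integral_cst ?mul1e; last exact: measurable_nbhd.
exact: (measure_nbhd ds).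
Qed.

Lemma truncated_weak11 :
  mu (\bigcup_i superlevel (average (kappa - i%:Z)%R f) l) <=
  (2 * K ^+ 2 / l)%:E * \int[mu]_x f x.
Proof.
have mav k : measurable (superlevel (average k f) l).
  by apply: measurable_superlevel; exact: measurable_average.
(* An average above l at x yields a heavy cube around some y in the neighbourhood of x. Replacing it
   by the largest heavy cube of y, of index j <= i, enlarges the scale and so keeps y in the
   neighbourhood of x; that cube lies in [E j]. *)
have sub : \bigcup_i superlevel (average (kappa - i%:Z)%R f) l `<=` \bigcup_i Nb i.
  move=> x [i _ /meetA[y xy Ay]].
  have : (\bigcup_j E j) y.
    by rewrite /E -seqDU_bigcup_eq; exists i.
  have [j Ejy ji] : exists2 j, E j y & (j <= i)%N.
    have : (\bigcup_(j in [set j | j <= i]%N) A (kappa - j%:Z)%R) y by exists i => /=.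
    pose P j := `[< A (kappa - j%:Z)%R y >].
    have exP : exists j, P j by exists i; apply/asboolP.
    case: (ex_minnP exP) => m /asboolP Am mmin _; exists m; last exact/mmin/asboolP.
    rewrite EE; split => // -[j /= jm Aj].
    by have := mmin j; rewrite leqNgt jm => /(_ (introT (asboolP _) Aj)).
  move=> _; exists j => //; rewrite /Nb /superlevel/=.
  have xyj : N (kappa - j%:Z)%R x y.
    by apply: nbhd_le xy; rewrite lerD2l lerN2 lez_nat.
  rewrite int_indic; last exact: measurable_nbhd.
  apply: (@lt_le_trans _ _ (mu (Q (kappa - j%:Z)%R y))).
    rewrite (measure_cube ds) lte_fin ltr_pdivrMr// ltr_pMr ?dyad_gt0//.
    by rewrite ltr1n.
  apply: le_measure; rewrite ?inE; first exact: measurable_cube.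
    by apply: measurableI => //; exact: measurable_nbhd.
  by move=> z yz; split; [exact: EQ yz|exact: (sub_cube_nbhd ds xyj)].
have tE : trivIset setT E by exact: trivIset_seqDU.
apply: (@le_trans _ _ (\sum_(i <oo) mu (Nb i))).
  apply: measure_sigma_subadditive => //.
  by apply: bigcupT_measurable => i; exact: mav.
apply: (@le_trans _ _ (\sum_(i <oo) ((2 * K / s)%:E * \int[mu]_(x in E i) f x))).
  apply: lee_nneseries => // i _; apply: (le_trans (stepB i)).
  rewrite (EFinM (2 * K)) -muleA lee_wpmul2l ?lee_fin ?mulr_ge0 ?(ltW K0)//.
  by rewrite [leRHS]muleC lee_pdivlMr// muleC.
rewrite nneseriesZl; last by move=> i _; exact: integral_ge0.
have mfE : measurable_fun (\bigcup_i E i) f by exact: measurable_funTS.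
rewrite -ge0_integral_bigcup//.
rewrite (_ : 2 * K ^+ 2 / l = 2 * K / s)%R; last first.
  by rewrite /s; field; rewrite !gt_eqF.
rewrite lee_wpmul2l ?lee_fin ?mulr_ge0 ?invr_ge0 ?(ltW s0) ?(ltW K0)//.
apply: ge0_subset_integral => //.
exact: bigcupT_measurable.
Qed.

End weak11.

End dyadic_system.

(** * The maximal operator on Morrey-Lorentz spaces *)

Section maximal_morrey.
Local Open Scope ereal_scope.
Context d (T : measurableType d) (R : realType).
Variable mu : {sigma_finite_measure set T -> \bar R}.
Variables (nu K : R) (Q N : int -> T -> set T).
Hypothesis ds : dyadic_system mu nu K Q N.
Hypothesis K0 : (0 < K)%R.
Implicit Types (f h u w : T -> \bar R).

Local Notation average := (average mu nu N).
Local Notation maximal := (maximal mu nu N).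

(** The constant of [truncated_weak11] does not depend on the largest scale kappa, which tends to
    infinity along an increasing union. *)
Lemma maximal_weak11 f (l : R) : measurable_fun setT f -> (forall x, 0 <= f x) ->
  (0 < l)%R ->
  mu (superlevel (maximal f) l) <= (2 * K ^+ 2 / l)%:E * \int[mu]_x f x.
Proof.
move=> mf f0 l0.
pose B n := \bigcup_i superlevel (average (n%:Z - i%:Z)%R f) l.
have mB n : measurable (B n).
  apply: bigcupT_measurable => i; apply: measurable_superlevel.
  exact: (measurable_average ds).
have -> : superlevel (maximal f) l = \bigcup_n B n.
  rewrite superlevel_maximal; apply/seteqP; split => x.
    move=> [i _ /=]; case: (int_of_index i) => m lx.
      by exists m => //; exists 0%N => //; rewrite subr0.
    by exists 0%N => //; exists m.+1 => //; rewrite sub0r -NegzE.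
  move=> [n _ [i _ lx]].
  have [_ _ /(_ (n%:Z - i%:Z)%R Logic.I)[j _ ji]] := int_of_index_bij.
  by exists j => //; rewrite ji.
have ndB : nondecreasing_seq B.
  apply/nondecreasing_seqP => n; apply/subsetPset => x [i _ lx].
  have E : (n.+1%:Z - i.+1%:Z = n%:Z - i%:Z)%R by lia.
  by exists i.+1 => //; rewrite E.
have cB := @nondecreasing_cvg_mu _ T R mu B mB (bigcupT_measurable _ mB) ndB.
rewrite -(cvg_lim _ cB)//; apply: lime_le; first by apply/cvg_ex; eexists; exact: cB.
apply: nearW => n; exact: (truncated_weak11 ds mf f0 l0 K0).
Qed.

Lemma average_cst_le k (t : R) x : (0 <= t)%R -> average k (cst t%:E) x <= (K * t)%:E.
Proof.
move=> t0; rewrite /average integral_cst; last exact: (measurable_nbhd ds).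
apply: (@le_trans _ _ ((dyad nu (- k))%:E * (t%:E * (K * dyad nu k)%:E))).
  by rewrite !lee_wpmul2l ?lee_fin ?dyad_ge0// (measure_nbhd ds).
rewrite -!EFinM lee_fin dyadN le_eqVlt; apply/orP; left; apply/eqP.
have : (dyad nu k != 0)%R by rewrite gt_eqF// dyad_gt0.
by move: (dyad _ _) => D D0; field.
Qed.

(** The part of f below t = l / (2 K) contributes at most K t = l / 2 to the maximal function. On
    the part above, f <= t^(1 - p) f^p, and the weak (1,1) bound at level l / 2 gives the
    constant. *)
Lemma weak_type_maximal (p : R) : (1 <= p)%R ->
  weak_type mu maximal p (4 * K ^+ 2 * (2 * K) `^ (p - 1)).
Proof.
move=> p1 f l mf f0 l0.
pose t := (l / (2 * K))%R.
have K20 : (0 < 2 * K)%R by rewrite mulr_gt0.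
have t0 : (0 < t)%R by rewrite divr_gt0.
pose H := superlevel f t.
have mH : measurable H by exact: measurable_superlevel.
have mc : measurable_fun setT (cutoff H f) by exact: measurable_cutoff.
have c0 x : 0 <= cutoff H f x by exact: cutoff_ge0.
have l2 : (0 < l / 2)%R by rewrite divr_gt0.
have sub : superlevel (maximal f) l `<=` superlevel (maximal (cutoff H f)) (l / 2).
  move=> x; rewrite /superlevel/= => lx.
  have : maximal f x <= maximal (fun y => cutoff H f y + cst t%:E y) x.
    apply: (maximal_le ds) => // [|y|y].
    - exact: emeasurable_funD.
    - by rewrite adde_ge0// lee_fin ltW.
    - have [Hy|Hy] := pselect (H y).
        by rewrite cutoffT// leeDl// lee_fin ltW.
      by rewrite cutoffF// add0e leNgt; exact/negP.
  have tc0 (y : T) : 0 <= cst t%:E y by rewrite lee_fin ltW.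
  move=> /le_trans /(_ (sublinearD (sublinear_maximal ds) x mc (measurable_cst _) c0 tc0)).
  have Mc : maximal (cst t%:E) x <= (l / 2)%:E.
    apply: ge_ereal_sup => _ [k _ <-]; apply: (le_trans (average_cst_le k x (ltW t0))).
    by rewrite lee_fin /t le_eqVlt; apply/orP; left; apply/eqP; field; rewrite gt_eqF.
  move=> /(lt_le_trans lx) /lt_le_trans /(_ (leeD2l _ Mc)) h.
  have : l%:E - (l / 2)%:E < maximal (cutoff H f) x.
    by rewrite lteBlDr.
  by rewrite -EFinB (_ : l - l / 2 = l / 2)%R//; lra.
apply: le_trans (le_measure _ _ _ sub) _; rewrite ?inE.
- by apply: measurable_superlevel; exact: (measurable_maximal ds).
- by apply: measurable_superlevel; exact: (measurable_maximal ds).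
apply: le_trans (maximal_weak11 mc c0 l2) _.
apply: (@le_trans _ _ ((2 * K ^+ 2 / (l / 2))%:E * \int[mu]_x ((t `^ (1 - p))%:E * f x `^ p))).
  rewrite lee_wpmul2l ?lee_fin ?divr_ge0 ?mulr_ge0 ?exprn_ge0 ?(ltW K0) ?(ltW l0)//.
  apply: ge0_le_integral => //.
  - by apply: measurable_funeM; exact: measurable_poweR_fun.
  - move=> x _; have [Hx|Hx] := pselect (H x); last first.
      by rewrite cutoffF// mule_ge0 ?poweR_ge0// lee_fin powR_ge0.
    rewrite cutoffT//; move: Hx; rewrite /H /superlevel/=.
    case: (f x) (f0 x) => [r r0||]// tr; last first.
      by rewrite poweRyr ?gt_eqF ?(lt_le_trans ltr01)// gt0_muley ?leey// lte_fin powR_gt0.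
    rewrite poweR_EFin lee_fin -[leLHS](@powRr1 _ r)//.
    have rp : (0 < r)%R by apply: lt_trans t0 tr.
    rewrite -[leLHS](_ : r `^ (1 - p) * r `^ p = _)%R; last first.
      by rewrite -powRD ?subrK// gt_eqF// implybT.
    rewrite ler_wpM2r ?powR_ge0// -opprB !powRN lef_pV2 ?posrE ?powR_gt0//.
    by rewrite ge0_ler_powR ?nnegrE ?subr_ge0 ?(ltW t0) ?(ltW rp)// ltW.
rewrite ge0_integralZl//; [|exact: measurable_poweR_fun|by move=> x _; exact: poweR_ge0|by rewrite lee_fin powR_ge0].
rewrite muleA -EFinM le_eqVlt; apply/orP; left; apply/eqP; congr (_%:E * _).
have lN0 : l != 0%R by rewrite gt_eqF.
have E : ((2 * K)^-1 `^ (1 - p) = (2 * K) `^ (p - 1) :> R)%R.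
  by rewrite -(powR_inv1 (ltW K20)) -powRrM mulN1r opprB.
rewrite /t powRM ?(ltW l0) ?invr_ge0 ?(ltW K20)// E.
have -> : (l `^ (1 - p) = l * l `^ (- p))%R.
  by rewrite powRD ?lN0 ?implybT// powRr1// ltW.
by move: (l `^ _)%R ((2 * K) `^ _)%R => a b; field.
Qed.

Lemma superlevel_double f (l : R) :
  superlevel (fun x => 2%:E * f x) l = superlevel f (l / 2).
Proof.
by apply/seteqP; split => x; rewrite /superlevel/= EFinM lte_pdivrMr// muleC.
Qed.

Lemma weak_type_double (S : (T -> \bar R) -> T -> \bar R) (p C : R) :
  weak_type mu S p C -> weak_type mu (fun f x => 2%:E * S f x) p (C * 2 `^ p).
Proof.
move=> h f l mf f0 l0.
have -> : superlevel (fun x => 2%:E * S f x) l = superlevel (S f) (l / 2).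
  exact: superlevel_double.
apply: le_trans (h f _ mf f0 _) _; first by rewrite divr_gt0.
rewrite powRM ?(ltW l0)// -mulrA [(2 `^ p * _)%R]mulrC.
by rewrite -[(2^-1)%R]powR_inv1// -powRrM mulrNN mul1r.
Qed.

Lemma sublinear_double S : @sublinear _ T R S -> sublinear (fun f x => 2%:E * S f x).
Proof.
move=> sS; split=> [f mf f0|f x f0|f1 f2 x m1 m2 f10 f20].
- by apply: measurable_funeM; exact: (sublinear_measurable sS).
- by rewrite mule_ge0//; exact: (sublinear_ge0 sS).
- rewrite -ge0_muleDr; [|exact: (sublinear_ge0 sS)..].
  by rewrite lee_wpmul2l//; exact: (sublinearD sS).
Qed.

(** The common pattern of both Morrey estimates: the near part [S f] is interpolated, while the far
    part [w] is known only in weak L^q with q > p on [E], which is enough for every second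
    exponent. *)
Lemma local_lbound sigma (c pa p pb q C1 : R) : 0 < sigma -> (0 < c)%R ->
  (0 < pa)%R -> (pa < p)%R -> (p < pb)%R -> (p < q)%R -> (0 < C1)%R ->
  exists2 C : R, (0 < C)%R & forall S E f u w (B X tau : R),
  sublinear S -> weak_type mu S pa C1 -> weak_type mu S pb C1 ->
  measurable E -> measurable_fun setT f -> (forall x, 0 <= f x) ->
  measurable_fun setT u -> measurable_fun setT w -> (forall x, 0 <= w x) ->
  (0 <= B)%R -> (0 <= X)%R -> (0 < tau)%R ->
  lbound sigma (dseq mu c p f) B -> weak_bound mu E w q X tau ->
  (forall x, E x -> u x <= S f x + w x) ->
  lbound sigma (dseq mu c p (cutoff E u)) (C * (B + X * tau `^ p)).
Proof.
move=> s0 c0 pa0 pap ppb pq C10.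
pose C2 := Num.max (C1 * 2 `^ pa)%R (C1 * 2 `^ pb)%R.
have C20 : (0 < C2)%R by rewrite lt_max mulr_gt0 ?powR_gt0.
have [M M0 hM] := marcinkiewicz T s0 c0 pa0 pap ppb C20.
have pq' : (0 < p < q)%R by rewrite pq andbT (lt_trans pa0).
have [W W0 hW] := weak_lbound T s0 c0 pq'.
have [D D0 hD] := lboundD s0.
exists (D * (M + W * 2 `^ p))%R.
  by rewrite mulr_gt0// addr_gt0// mulr_gt0// powR_gt0.
move=> S E f u w B X tau sS wa wb mE mf f0 mu_ mw w0 B0 X0 tau0 hB wE uE.
(* Splitting a sum halves the level, and 2^(c j) / 2 need not be of the form 2^(c i); doubling both
   summands restores the level. *)
pose S2 g x := 2%:E * S g x.
have sS2 : sublinear S2 by exact: sublinear_double.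
have wt p' : weak_type mu S p' C1 -> (C1 * 2 `^ p' <= C2)%R -> weak_type mu S2 p' C2.
  move=> /weak_type_double h le g l mg g0 l0; apply: (le_trans (h g l mg g0 l0)).
  rewrite lee_wpmul2r ?lee_fin ?ler_wpM2r ?powR_ge0//.
  by apply: integral_ge0 => x _; exact: poweR_ge0.
have /(hM mu S2 f B sS2) : weak_type mu S2 pa C2 by apply: wt => //; rewrite le_max lexx.
have wpb : weak_type mu S2 pb C2 by apply: wt => //; rewrite le_max lexx orbT.
move=> /(_ wpb mf f0 B0 hB) near.
have w2 : weak_bound mu E (fun x => 2%:E * w x) q X (2 * tau).
  case: wE => e1 e2; split => // l l0.
  have -> : superlevel (fun x => 2%:E * w x) l = superlevel w (l / 2).
    exact: superlevel_double.
  apply: (le_trans (e2 (l / 2)%R _)); first by rewrite divr_gt0.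
  by rewrite invf_div mulrA [(tau * 2)%R]mulrC.
have mw2 : measurable_fun setT (fun x => 2%:E * w x) by exact: measurable_funeM.
have tau20 : (0 < 2 * tau)%R by rewrite mulr_gt0.
have far := hW mu E _ X _ X0 tau20 mE mw2 w2.
have XT0 : (0 <= X * tau `^ p)%R by rewrite mulr_ge0// powR_ge0.
have A0 : (0 <= M * B)%R by rewrite mulr_ge0// ltW.
have A1 : (0 <= W * (X * (2 * tau) `^ p))%R by rewrite !mulr_ge0 ?powR_ge0// ltW.
have := hD _ _ _ _ A0 A1 (dseq_ge0 _ _ _ _) (dseq_ge0 _ _ _ _) near far.
apply: lbound_le => //; last 2 first.
- by move=> j; exact: dseq_ge0.
- move=> j; rewrite /dseq -ge0_muleDr// lee_wpmul2l ?lee_fin ?dyad_ge0//.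
  have h := @superlevel_sum _ T R mu (cutoff E u) (S f) (cutoff E w) (dyad c j).
  have E1 : superlevel (S2 f) (dyad c j) = superlevel (S f) (dyad c j / 2).
    exact: superlevel_double.
  have E2 : superlevel (cutoff E (fun x => 2%:E * w x)) (dyad c j) =
      superlevel (cutoff E w) (dyad c j / 2).
    rewrite -superlevel_double; congr (superlevel _ _).
    by apply/funext => x; rewrite /cutoff muleA.
  rewrite E1 E2; apply: h.
  + exact: measurable_cutoff.
  + exact: (sublinear_measurable sS).
  + exact: measurable_cutoff.
  + move=> x; have [Ex|Ex] := pselect (E x); first by rewrite !cutoffT//; exact: uE.
    by rewrite !cutoffF// adde0; exact: (sublinear_ge0 sS).
rewrite -[X in (_ <= _ <= X)%R]mulrA; apply/andP; split.
  by rewrite mulr_ge0 ?addr_ge0// ltW.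
rewrite ler_wpM2l ?(ltW D0)// powRM ?(ltW tau0)//.
have W2 : (0 <= W * 2 `^ p)%R by rewrite mulr_ge0 ?powR_ge0// ltW.
have -> : (W * (X * (2 `^ p * tau `^ p)) = W * 2 `^ p * (X * tau `^ p))%R.
  by rewrite !mulrA [(W * _ * X)%R]mulrAC mulrAC.
move: (W * 2 `^ p)%R (X * tau `^ p)%R W2 XT0 => a y a0 y0.
rewrite [leRHS](_ : _ = M * B + a * y + (M * y + a * B))%R; last by ring.
by rewrite lerDl addr_ge0 ?mulr_ge0// ltW.
Qed.

(** At scales j <= k the neighbourhoods of y stay inside [N (k + 1) x], so the cutoff changes
    nothing there; [v] takes care of the larger scales. *)
Lemma maximal_local k x y f (v : R) : measurable_fun setT f -> (forall x, 0 <= f x) ->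
  N k x y -> (0 <= v)%R -> (forall j, (k < j)%R -> average j f y <= v%:E) ->
  maximal f y <= maximal (cutoff (N (k + 1)%R x) f) y + v%:E.
Proof.
move=> mf f0 xy v0 hv; apply: ge_ereal_sup => _ [j _ <-].
have [jk|kj] := leP j k; last first.
  apply: (le_trans (hv j kj)); rewrite leeDr//; apply: maximal_ge0 => z.
  exact: cutoff_ge0.
rewrite (_ : average j f y = average j (cutoff (N (k + 1)%R x) f) y).
  apply: le_trans (average_le_maximal _ _ _ _ _ _) _.
  by rewrite leeDl// lee_fin.
congr (_ * _); apply: eq_integral => z; rewrite inE => yz.
by rewrite cutoffT//; apply: (sub_nbhd_nbhdS ds xy); exact: (nbhd_le ds jk).
Qed.

(** The weak Morrey condition on neighbourhoods: 2^(- nu k / p0) is the power -1/p0 of the measure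
    scale 2^(nu k). *)
Definition weak_morrey_bound f (p p0 B : R) : Prop := forall k x,
  weak_bound mu (N k x) f p (K * dyad nu k) (B * dyad (- (nu / p0)) k).

Lemma weak_morrey_average (delta p p0 : R) : (0 < delta < p)%R ->
  exists2 C : R, (0 < C)%R & forall f (B : R) k x, (0 < B)%R ->
  measurable_fun setT f -> (forall x, 0 <= f x) ->
  weak_morrey_bound f p p0 B ->
  average k (fun y => f y `^ delta) x <=
    (C * B `^ delta * dyad (- (nu * delta / p0)) k)%:E.
Proof.
move=> dp; have [C C0 hC] := kolmogorov T dp.
exists (C * K)%R; first exact: mulr_gt0.
move=> f B k x B0 mf f0 wf.
have KD0 : (0 <= K * dyad nu k)%R by rewrite mulr_ge0 ?dyad_ge0// ltW.
have t0 : (0 < B * dyad (- (nu / p0)) k)%R by rewrite mulr_gt0// dyad_gt0.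
have := hC mu _ _ _ _ KD0 t0 (measurable_nbhd ds k x) mf f0 (wf k x).
move=> h; rewrite /average.
apply: (le_trans (lee_wpmul2l _ h)); first by rewrite lee_fin dyad_ge0.
rewrite -EFinM lee_fin powRM ?dyad_ge0 ?(ltW B0)// dyad_powR dyadN.
have -> : (- (nu / p0) * delta = - (nu * delta / p0))%R by rewrite mulNr mulrAC.
have : (dyad nu k != 0)%R by rewrite gt_eqF// dyad_gt0.
move: (dyad nu k) (dyad _ k) (B `^ delta)%R => a b e a0.
by rewrite le_eqVlt; apply/orP; left; apply/eqP; field.
Qed.

(** [dseq] behaves like the p-th power of a Lorentz norm, so the inverse of the Morrey normalisation
    |Q|^(1/p0 - 1/p) appears here raised to the power p. *)
Definition morrey_lbound sigma (c p p0 : R) f (B : R) : Prop := forall k x,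
  lbound sigma (dseq mu c p (cutoff (N k x) f)) (B * dyad (nu * (1 - p / p0)) k).

(** Each term of the sequence is bounded by the quasi-norm, which is the weak estimate at dyadic
    levels. In the witness, 2^(c p) pays for rounding l down to such a level and 1 / K compensates
    the [K] inside [weak_morrey_bound]. *)
Lemma morrey_lbound_weak sigma (c p p0 B : R) : 0 < sigma -> (0 < c)%R -> (0 < p)%R ->
  (0 < B)%R -> exists2 B' : R, (0 < B')%R & forall f, measurable_fun setT f ->
  morrey_lbound sigma c p p0 f B -> weak_morrey_bound f p p0 B'.
Proof.
move=> s0 c0 p_gt0 B0.
exists ((B * 2 `^ (c * p) / K) `^ p^-1)%R.
  by rewrite powR_gt0// divr_gt0// mulr_gt0// powR_gt0.
move=> f mf hf k x; split; first exact: (measure_nbhd ds).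
move=> l l0; have [j /andP[j1 j2]] := dyad_bracket c0 l0.
have BD : (0 <= B * dyad (nu * (1 - p / p0)) k)%R by rewrite mulr_ge0 ?dyad_ge0// ltW.
have := lbound_term j s0 BD (dseq_ge0 _ _ _ _) (hf k x).
rewrite /dseq superlevel_cutoff ?dyad_ge0// muleC -lee_pdivlMr ?dyad_gt0// => h.
have mN := measurable_nbhd ds k x.
apply: (@le_trans _ _ (mu (N k x `&` superlevel f (dyad c j)))).
  apply: le_measure; rewrite ?inE; [by apply: measurableI => //; exact: measurable_superlevel..|].
  by move=> y [Ny fy]; split => //; move: fy; rewrite /superlevel/=; apply: le_lt_trans; rewrite lee_fin.
apply: (le_trans h); rewrite -EFinM lee_fin.
have pN0 : p != 0%R by rewrite gt_eqF.
have B'0 : (0 <= B * 2 `^ (c * p) / K)%R by rewrite divr_ge0 ?mulr_ge0 ?powR_ge0 ?(ltW B0) ?(ltW K0).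
have PP : (((B * 2 `^ (c * p) / K) `^ p^-1) `^ p = B * 2 `^ (c * p) / K)%R.
  by rewrite -powRrM mulVf// powRr1.
have li0 : (0 <= l^-1)%R by rewrite invr_ge0 ltW.
have BD' : (0 <= (B * 2 `^ (c * p) / K) `^ p^-1 * dyad (- (nu / p0)) k)%R.
  by rewrite mulr_ge0 ?powR_ge0 ?dyad_ge0.
rewrite (powRM _ BD' li0) (powRM _ (powR_ge0 _ _) (dyad_ge0 _ _)) PP dyad_powR.
have -> : (nu * (1 - p / p0) = nu + - (nu / p0) * p)%R.
  by rewrite mulrBr mulr1 mulNr [(nu / p0 * p)%R]mulrAC mulrA.
rewrite dyad_split.
have lj : ((dyad (c * p) j)^-1 <= 2 `^ (c * p) * l^-1 `^ p)%R.
  have -> : (l^-1 `^ p = (l `^ p)^-1)%R.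
    by rewrite -powR_inv1 ?(ltW l0)// -powRrM mulN1r powRN.
  rewrite ler_pdivlMr ?powR_gt0// mulrC ler_pdivrMr ?dyad_gt0//.
  have -> : (2 `^ (c * p) * dyad (c * p) j = dyad c (j + 1) `^ p)%R.
    by rewrite dyad_powR dyadD mulrC; congr (_ * _)%R; rewrite /dyad mulr1.
  by rewrite ge0_ler_powR ?nnegrE ?dyad_ge0 ?(ltW p_gt0) ?(ltW l0)// ltW.
apply: (le_trans (ler_wpM2l _ lj)); first by rewrite !mulr_ge0 ?dyad_ge0// ltW.
rewrite le_eqVlt; apply/orP; left; apply/eqP.
move: (2 `^ _)%R (l^-1 `^ p)%R (dyad nu k) (dyad _ k) => a b e e'.
by field; rewrite gt_eqF.
Qed.

Lemma weak_bound_cst E (q X v : R) : (0 < q)%R -> (0 <= X)%R -> (0 < v)%R ->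
  measurable E -> mu E <= X%:E -> weak_bound mu E (cst v%:E) q X v.
Proof.
move=> q0 X0 v0 mE EX; split => // l l0.
have [lv|vl] := ltP l v; last first.
  rewrite (_ : _ `&` _ = set0) ?measure0 ?lee_fin ?mulr_ge0 ?powR_ge0//.
  by apply/seteqP; split => // x [_]; rewrite /superlevel/= lte_fin ltNge vl.
apply: (@le_trans _ _ X%:E).
  apply: le_trans EX; apply: le_measure; rewrite ?inE//.
  by apply: measurableI => //; exact: measurable_superlevel.
rewrite lee_fin ler_peMr//.
have h : (1 <= v / l)%R by rewrite ler_pdivlMr// mul1r ltW.
by have := ler_powR h (ltW q0); rewrite powRr0.
Qed.

(** For the estimate on [N k x], f is cut at [N (k + 1) x]. The bounds on its averages decrease with
    the scale, so the far part is at most a constant v of the size prescribed by p0. The exponent p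
    + 1 only has to exceed p. *)
Theorem maximal_morrey sigma (c p p0 B : R) : 0 < sigma -> (0 < c)%R -> (1 < p)%R ->
  (0 < p0)%R -> (0 < nu)%R -> (0 < B)%R ->
  exists2 C : R, (0 < C)%R & forall f, measurable_fun setT f -> (forall x, 0 <= f x) ->
  morrey_lbound sigma c p p0 f B -> morrey_lbound sigma c p p0 (maximal f) C.
Proof.
move=> s0 c0 p1 p00 nu0 B0.
have p_gt0 : (0 < p)%R by apply: lt_trans p1.
have [B' B'0 hB'] := morrey_lbound_weak p0 s0 c0 p_gt0 B0.
have [A A0 hA] := @weak_morrey_average 1 p p0 (introT andP (conj ltr01 p1)).
pose C1 := Num.max (4 * K ^+ 2 * (2 * K) `^ (1 - 1))%R (4 * K ^+ 2 * (2 * K) `^ (p + 1 - 1))%R.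
have C10 : (0 < C1)%R.
  by rewrite lt_max !mulr_gt0 ?exprn_gt0 ?powR_gt0// mulr_gt0.
have pp1 : (p < p + 1)%R by rewrite ltrDl.
have [L L0 hL] := local_lbound s0 c0 ltr01 p1 pp1 pp1 C10.
pose e := (nu * (1 - p / p0))%R.
pose v0 := (A * B')%R.
have v00 : (0 < v0)%R by exact: mulr_gt0.
exists (L * (B * dyad e 1 + K * v0 `^ p))%R.
  by rewrite mulr_gt0// addr_gt0// mulr_gt0 ?dyad_gt0// powR_gt0.
move=> f mf f0 hf k x.
have wf := hB' f mf hf.
pose v := (v0 * dyad (- (nu / p0)) k)%R.
have v_gt0 : (0 < v)%R by rewrite mulr_gt0// dyad_gt0.
have KD0 : (0 <= K * dyad nu k)%R by rewrite mulr_ge0 ?dyad_ge0// ltW.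
have av j y : (k <= j)%R -> average j f y <= v%:E.
  move=> kj; have := hA f B' j y B'0 mf f0 wf.
  rewrite (_ : average j _ y = average j f y); last first.
    by congr (_ * _); apply: eq_integral => z _; rewrite poweRe1.
  move=> /le_trans; apply; rewrite lee_fin powRr1 ?(ltW B'0)// mulr1.
  rewrite ler_wpM2l ?(ltW v00)// !dyad_opp lef_pV2 ?posrE ?dyad_gt0//.
  by apply: dyad_le => //; rewrite divr_ge0// ltW.
have wt p' (p'1 : (1 <= p')%R) : (4 * K ^+ 2 * (2 * K) `^ (p' - 1) <= C1)%R -> weak_type mu maximal p' C1.
  move=> le g l mg g0 l0; apply: (le_trans (weak_type_maximal p'1 mg g0 l0)).
  rewrite lee_wpmul2r ?lee_fin ?ler_wpM2r ?powR_ge0//.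
  by apply: integral_ge0 => z _; exact: poweR_ge0.
have mN := measurable_nbhd ds.
have mc : measurable_fun setT (cutoff (N (k + 1)%R x) f) by exact: measurable_cutoff.
have c0' y : 0 <= cutoff (N (k + 1)%R x) f y by exact: cutoff_ge0.
have BD : (0 <= B * dyad e (k + 1))%R by rewrite mulr_ge0 ?dyad_ge0// ltW.
have := hL maximal (N k x) _ (maximal f) (cst v%:E) _ _ _ (sublinear_maximal ds)
  (wt 1%R (lexx _) _) (wt (p + 1)%R _ _) (mN k x) mc c0' (measurable_maximal ds mf f0)
  (measurable_cst _) _ BD KD0 v_gt0 (hf (k + 1)%R x)
  (weak_bound_cst _ KD0 v_gt0 (mN k x) (measure_nbhd ds k x)).
rewrite {1}/C1 {1}/C1 !le_max !lexx orbT; move=> /(_ isT).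
have h1 : (1 <= p + 1)%R by rewrite lerDr ltW.
move=> /(_ h1 isT) h; have {h} := h _ _ _.
rewrite /v powRM ?(ltW v00) ?dyad_ge0// dyad_powR.
have -> : (L * (B * dyad e (k + 1) + K * dyad nu k * (v0 `^ p * dyad (- (nu / p0) * p) k)) =
   L * (B * dyad e 1 + K * v0 `^ p) * dyad e k)%R.
  have -> : dyad e k = (dyad nu k * dyad (- (nu / p0) * p) k)%R.
    by rewrite -dyad_split /e mulrBr mulr1 mulNr mulrA [(nu / p0 * p)%R]mulrAC.
  rewrite dyadD.
  have -> : dyad e k = (dyad nu k * dyad (- (nu / p0) * p) k)%R.
    by rewrite -dyad_split /e mulrBr mulr1 mulNr mulrA [(nu / p0 * p)%R]mulrAC.
  by move: (dyad e 1) (dyad nu k) (dyad _ k) (v0 `^ p)%R => a b b' z; ring.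
apply.
- by move=> y; rewrite lee_fin ltW.
- by rewrite addr_gt0.
- move=> y xy; apply: maximal_local => //; first exact: ltW.
  by move=> j /ltW; exact: av.
Qed.

End maximal_morrey.

(** * Dyadic potentials *)

Section potential.
Local Open Scope ereal_scope.
Context d (T : measurableType d) (R : realType).
Variable mu : {sigma_finite_measure set T -> \bar R}.
Variables (nu K : R) (Q N : int -> T -> set T).
Hypothesis ds : dyadic_system mu nu K Q N.
Hypothesis K0 : (0 < K)%R.
Implicit Types (f g h u : T -> \bar R).

Local Notation average := (average mu nu N).
Local Notation maximal := (maximal mu nu N).

Definition potential (b : R) f x : \bar R :=
  zsum (fun k => (dyad b k)%:E * average k f x).

Let term_ge0 (b : R) f x k : (forall x, 0 <= f x) -> 0 <= (dyad b k)%:E * average k f x.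
Proof. by move=> f0; rewrite mule_ge0 ?lee_fin ?dyad_ge0// average_ge0. Qed.

Lemma potential_ge0 b f x : (forall x, 0 <= f x) -> 0 <= potential b f x.
Proof. by move=> f0; apply: zsum_ge0 => k; exact: term_ge0. Qed.

Lemma measurable_potential b f : measurable_fun setT f -> (forall x, 0 <= f x) ->
  measurable_fun setT (potential b f).
Proof.
move=> mf f0; apply: measurable_zsum => k => [|x]; last exact: term_ge0.
by apply: measurable_funeM; exact: (measurable_average ds).
Qed.

Lemma average_le k f h x : measurable_fun setT f -> measurable_fun setT h ->
  (forall x, 0 <= f x) -> (forall x, 0 <= h x) -> (forall x, f x <= h x) ->
  average k f x <= average k h x.
Proof.
move=> mf mh f0 h0 fh; rewrite lee_wpmul2l ?lee_fin ?dyad_ge0//.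
exact: (integral_nbhd_le ds).
Qed.

Lemma potential_le b f h x : measurable_fun setT f -> measurable_fun setT h ->
  (forall x, 0 <= f x) -> (forall x, 0 <= h x) -> (forall x, f x <= h x) ->
  potential b f x <= potential b h x.
Proof.
move=> mf mh f0 h0 fh; apply: le_zsum => k; rewrite lee_wpmul2l ?lee_fin ?dyad_ge0//.
exact: average_le.
Qed.

Lemma potentialD b f h x : measurable_fun setT f -> measurable_fun setT h ->
  (forall x, 0 <= f x) -> (forall x, 0 <= h x) ->
  potential b (fun y => f y + h y) x = potential b f x + potential b h x.
Proof.
move=> mf mh f0 h0; rewrite /potential -zsumD; [|by move=> k; exact: term_ge0..].
congr zsum; apply/funext => k; rewrite (averageD ds)// ge0_muleDr//; exact: average_ge0.
Qed.

Lemma averageZl k (t : R) f x : measurable_fun setT f -> (forall x, 0 <= f x) ->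
  (0 <= t)%R -> average k (fun y => t%:E * f y) x = t%:E * average k f x.
Proof.
move=> mf f0 t0; rewrite /average ge0_integralZl//; first by rewrite muleCA.
- exact: (measurable_nbhd ds).
- exact: measurable_funTS.
Qed.

Lemma potentialZl b (t : R) f x : measurable_fun setT f -> (forall x, 0 <= f x) ->
  (0 <= t)%R -> potential b (fun y => t%:E * f y) x = t%:E * potential b f x.
Proof.
move=> mf f0 t0; rewrite /potential -zsumZl//; last by move=> k; exact: term_ge0.
by congr zsum; apply/funext => k; rewrite averageZl// muleCA.
Qed.

Lemma sublinear_potential b g : measurable_fun setT g -> (forall x, 0 <= g x) ->
  sublinear (fun f x => g x * potential b f x).
Proof.
move=> mg g0; split=> [f mf f0|f x f0|f1 f2 x m1 m2 f10 f20].
- by apply: emeasurable_funM => //; exact: measurable_potential.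
- by rewrite mule_ge0// potential_ge0.
- by rewrite potentialD// ge0_muleDr// potential_ge0.
Qed.

Lemma zsum_mule (a : int -> \bar R) (x : \bar R) : (forall j, 0 <= a j) -> 0 <= x ->
  zsum (fun j => x * a j) = x * zsum a.
Proof.
move=> a0; case: x => [r r0||]//; first exact: zsumZl.
move=> _; have [a_eq0|] := pselect (forall j, a j = 0).
  by rewrite /zsum !esum1 ?mule0// => j _; rewrite a_eq0 ?mule0.
move=> /existsNP[j /eqP aj]; have aj0 : 0 < a j by rewrite lt0e aj a0.
rewrite [RHS]gt0_mulye; last by apply: (lt_le_trans aj0); exact: zsum_ge.
apply/eqP; rewrite eq_le leey/=; apply: (@le_trans _ _ (+oo * a j)).
  by rewrite gt0_mulye.
by apply: (@zsum_ge _ (fun j => +oo * a j)) => i; rewrite mule_ge0.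
Qed.

(** The potential is a weighted sum of the symmetric relations [N k]; its self-adjointness is what
    moves it onto the weight in the Schur test. *)
Lemma integral_potential_sym b u f : measurable_fun setT u -> measurable_fun setT f ->
  (forall x, 0 <= u x) -> (forall x, 0 <= f x) ->
  \int[mu]_x (u x * potential b f x) = \int[mu]_x (f x * potential b u x).
Proof.
have E v h : measurable_fun setT v -> measurable_fun setT h ->
    (forall x, 0 <= v x) -> (forall x, 0 <= h x) ->
    \int[mu]_x (v x * potential b h x) = zsum (fun k =>
      (dyad b k * dyad nu (- k))%:E * \int[mu]_x (v x * \int[mu]_(y in N k x) h y)).
  move=> mv mh v0 h0.
  have i0 k x : 0 <= \int[mu]_(y in N k x) h y by exact: integral_ge0.
  have mi k := measurable_int_nbhd ds k mh h0.
  rewrite (_ : (fun x => _) = (fun x => zsum (fun k =>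
      (dyad b k * dyad nu (- k))%:E * (v x * \int[mu]_(y in N k x) h y)))); last first.
    apply/funext => x; rewrite /potential -zsum_mule//; last by move=> k; exact: term_ge0.
    congr zsum; apply/funext => k; rewrite /average.
    by rewrite EFinM -muleA [LHS]muleCA [v x * (_ * _)]muleCA.
  rewrite integral_zsum//.
  - congr zsum; apply/funext => k; rewrite ge0_integralZl//.
    + exact: emeasurable_funM.
    + by move=> x _; rewrite mule_ge0.
    + by rewrite lee_fin mulr_ge0 ?dyad_ge0.
  - by move=> k; apply: measurable_funeM; exact: emeasurable_funM.
  - by move=> k x; rewrite mule_ge0 ?lee_fin ?mulr_ge0 ?dyad_ge0// mule_ge0.
move=> mu_ mf u0 f0.
apply: eq_trans (E u f mu_ mf u0 f0) _; apply: eq_trans (esym (E f u mf mu_ f0 u0)).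
congr zsum; apply/funext => k; congr (_ * _).
exact: (@integral_rel_sym _ _ _ mu (N k) (measurable_nbhd_rel ds k)
  (nbhd_sym ds (k := k)) u f mu_ mf u0 f0).
Qed.

(* Coifman-Rochberg: a power [delta < 1] of a maximal function is an A_1 weight. *)
Lemma maximal_pow_average (delta : R) : (0 < delta < 1)%R ->
  exists2 C : R, (0 < C)%R & forall h k x (Y : R), (0 < Y)%R ->
  measurable_fun setT h -> (forall x, 0 <= h x) ->
  (forall j, (k < j)%R -> average j h x <= Y%:E) ->
  average k (fun y => maximal h y `^ delta) x <= (C * Y `^ delta)%:E.
Proof.
move=> d01; have [C C0 hC] := kolmogorov T d01.
(* At levels l <= 2 v the measure of [N k x] suffices, which takes the first summand. Above them the
   far part uses at most half of the level, and the weak (1,1) bound for the near part takes the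
   second. *)
pose D := (2 * dyad nu 1 + 4 * K * dyad nu 1)%R.
have D0 : (0 < D)%R by rewrite addr_gt0// !mulr_gt0// dyad_gt0.
exists (C * K * D `^ delta)%R; first by rewrite !mulr_gt0// powR_gt0.
move=> h k x Y Y0 mh h0 hY.
have KD0 : (0 <= K * dyad nu k)%R by rewrite mulr_ge0 ?dyad_ge0// ltW.
have DY : (0 < D * Y)%R by rewrite mulr_gt0.
have mN := measurable_nbhd ds.
have mM := measurable_maximal ds mh h0.
suff wb : weak_bound mu (N k x) (maximal h) 1 (K * dyad nu k) (D * Y).
  have M0 y : 0 <= maximal h y by exact: maximal_ge0.
  have i := hC mu _ _ _ _ KD0 DY (mN k x) mM M0 wb.
  rewrite /average; apply: (le_trans (lee_wpmul2l _ i)); first by rewrite lee_fin dyad_ge0.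
  rewrite -EFinM lee_fin dyadN powRM ?(ltW D0) ?(ltW Y0)//.
  have : (dyad nu k != 0)%R by rewrite gt_eqF// dyad_gt0.
  move: (dyad nu k) (D `^ delta)%R (Y `^ delta)%R => a e e' a0.
  by rewrite le_eqVlt; apply/orP; left; apply/eqP; field.
split; first exact: (measure_nbhd ds).
move=> l l0; rewrite powRr1 ?divr_ge0 ?(ltW l0) ?(ltW DY)//.
pose v := (dyad nu 1 * Y)%R.
have v0 : (0 < v)%R by rewrite mulr_gt0// dyad_gt0.
(* A neighbourhood at scale j > k of a point of [N k x] lies in the one of x at scale j + 1; the
   change of normalisation costs 2^nu. *)
have av y j : N k x y -> (k < j)%R -> average j h y <= v%:E.
  move=> xy kj; have xyj : N j x y by apply: (nbhd_le ds (ltW kj)) xy.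
  apply: (@le_trans _ _ ((dyad nu 1)%:E * average (j + 1)%R h x)).
    rewrite /average muleA -EFinM -dyadD opprD addrCA subrr addr0.
    rewrite lee_wpmul2l ?lee_fin ?dyad_ge0//.
    by apply: (integral_nbhd_le ds) => //; exact: (sub_nbhd_nbhdS ds).
  rewrite /v EFinM lee_wpmul2l ?lee_fin ?dyad_ge0// hY//.
  by rewrite (lt_trans kj)// ltrDl.
have [lv|vl] := leP l (2 * v)%R.
  apply: (@le_trans _ _ (K * dyad nu k)%:E).
    apply: le_trans (measure_nbhd ds k x); apply: le_measure; rewrite ?inE//.
    by apply: measurableI => //; exact: measurable_superlevel.
  rewrite lee_fin ler_peMr// ler_pdivlMr// mul1r (le_trans lv)//.
  rewrite /v /D mulrA ler_wpM2r ?(ltW Y0)// lerDl.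
  by rewrite !mulr_ge0 ?dyad_ge0// ltW.
pose h' := cutoff (N (k + 1)%R x) h.
have mh' : measurable_fun setT h' by exact: measurable_cutoff.
have h'0 y : 0 <= h' y by exact: cutoff_ge0.
have l2 : (0 < l / 2)%R by rewrite divr_gt0.
apply: (@le_trans _ _ (mu (superlevel (maximal h') (l / 2)))).
  apply: le_measure; rewrite ?inE.
  - by apply: measurableI => //; exact: measurable_superlevel.
  - by apply: measurable_superlevel; exact: (measurable_maximal ds).
  move=> y [xy]; rewrite /superlevel/= => ly.
  have := maximal_local ds mh h0 xy (ltW v0) (fun j kj => av y j xy kj).
  move=> /(lt_le_trans ly); rewrite -/h' -lteBlDr// -EFinB; apply: le_lt_trans.
  by rewrite lee_fin; lra.
apply: (le_trans (maximal_weak11 ds K0 mh' h'0 l2)).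
have -> : \int[mu]_y h' y = (dyad nu (k + 1))%:E * average (k + 1)%R h x.
  rewrite /average muleA -EFinM -dyadD subrr dyad0 mul1e /h'.
  by rewrite [RHS]integral_cutoff.
apply: (@le_trans _ _ ((2 * K ^+ 2 / (l / 2))%:E * ((dyad nu (k + 1))%:E * Y%:E))).
  rewrite lee_wpmul2l ?lee_fin ?divr_ge0 ?mulr_ge0 ?exprn_ge0 ?(ltW K0) ?(ltW l0)//.
  by rewrite lee_wpmul2l ?lee_fin ?dyad_ge0// hY// ltrDl.
rewrite -!EFinM lee_fin dyadD /D.
have := dyad_ge0 nu k; have := dyad_ge0 nu 1.
move: (dyad nu k) (dyad nu 1) => a e e0 a0.
rewrite [leRHS](_ : _ = 2 * K ^+ 2 / (l / 2) * (a * e * Y) + K * a * (2 * e * Y / l))%R.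
  by rewrite lerDl !mulr_ge0 ?invr_ge0// ltW.
by field; rewrite gt_eqF.
Qed.

End potential.

(** * A Schur test with weights *)

Section weighted_potential.
Local Open Scope ereal_scope.
Context d (T : measurableType d) (R : realType).
Variable mu : {sigma_finite_measure set T -> \bar R}.
Variables (nu K : R) (Q N : int -> T -> set T).
Hypothesis ds : dyadic_system mu nu K Q N.
Hypothesis K0 : (0 < K)%R.
Implicit Types (f g h u : T -> \bar R).

Local Notation average := (average mu nu N).
Local Notation maximal := (maximal mu nu N).
Local Notation potential := (potential mu nu N).
Local Notation weak_morrey_bound := (weak_morrey_bound mu nu K N).

(* If [w] majorizes [g] and [w^a], [w^e] are suitable test functions, a Schur
   type argument with a pointwise splitting of [F] bounds [g * potential b F]. *)
Lemma schur_weak_type b g (w : T -> R) (C p a e : R) :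
  (1 < p)%R -> (0 < C)%R -> a = (1 + e * (p - 1))%R ->
  measurable_fun setT g -> (forall x, 0 <= g x) ->
  measurable_fun setT w -> (forall x, 0 < w x)%R -> (forall x, g x <= (w x)%:E) ->
  (forall x, potential b (fun y => (w y `^ e)%:E) x <= (C * w x `^ (e - 1))%:E) ->
  (forall x, potential b (fun y => (w y `^ a)%:E) x <= (C * w x `^ (a - 1))%:E) ->
  weak_type mu (fun f x => g x * potential b f x) p ((2 * C) `^ p).
Proof.
move=> p1 C0 aE mg g0 mw w0 gw we wa F s mF F0 s0.
have mpw t : measurable_fun setT (fun y => (w y `^ t)%:E).
  by apply/measurable_EFinP; exact: (measurableT_comp (measurable_powR t) mw).
have pw0 t y : 0 <= (w y `^ t)%:E :> \bar R by rewrite lee_fin powR_ge0.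
have p0 : (0 < p)%R by apply: lt_trans p1.
have p10 : (0 < p - 1)%R by rewrite subr_gt0.
(* Where F exceeds l w^e, one has F = F^p F^(1 - p) <= F^p (l w^e)^(1 - p) = l^(1 - p) [U]. This
   takes the place of Hölder's inequality and leaves l free to depend on the point where the
   potential is evaluated. *)
pose U y := F y `^ p * (w y `^ (- (e * (p - 1))))%:E.
have mU : measurable_fun setT U.
  by apply: emeasurable_funM => //; exact: measurable_poweR_fun.
have U0 y : 0 <= U y by rewrite mule_ge0// poweR_ge0.
have split_F (l : R) y : (0 < l)%R ->
    F y <= l%:E * (w y `^ e)%:E + (l `^ (1 - p))%:E * U y.
  move=> l0; have [Fl|lF] := leP (F y) (l%:E * (w y `^ e)%:E).
    by apply: (le_trans Fl); rewrite leeDl// mule_ge0// lee_fin powR_ge0.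
  apply: (@le_trans _ _ ((l `^ (1 - p))%:E * U y)); last first.
    by rewrite leeDr// mule_ge0// lee_fin ltW.
  have c0 : (0 < l * w y `^ e)%R by rewrite mulr_gt0// powR_gt0.
  rewrite /U muleCA -EFinM.
  have -> : (l `^ (1 - p) * w y `^ (- (e * (p - 1))) = (l * w y `^ e) `^ (1 - p))%R.
    by rewrite powRM ?powR_ge0 ?(ltW l0)// -powRrM -mulrN opprB.
  move: lF (F0 y); rewrite -EFinM; case: (F y) => [r lr r0||]//; last first.
    by move=> _ _; rewrite poweRyr ?gt_eqF// gt0_mulye// lte_fin powR_gt0.
  rewrite lte_fin in lr.
  have rp : (0 < r)%R by apply: lt_trans c0 lr.
  rewrite poweR_EFin -EFinM lee_fin -[leLHS](@powRr1 _ r)//.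
  rewrite -[leLHS](_ : r `^ p * r `^ (1 - p) = _)%R; last first.
    by rewrite -powRD addrC ?subrK// gt_eqF// implybT.
  rewrite ler_wpM2l ?powR_ge0// -opprB !powRN lef_pV2 ?posrE ?powR_gt0//.
  by rewrite ge0_ler_powR ?nnegrE ?(ltW p10) ?(ltW c0) ?(ltW rp)// ltW.
pose L := (s / 2 * (s / (2 * C)) `^ (p - 1))%R.
have sC : (0 < s / (2 * C))%R by rewrite divr_gt0// mulr_gt0.
have L0 : (0 < L)%R by rewrite mulr_gt0 ?powR_gt0// divr_gt0.
pose V x := (w x `^ a)%:E * potential b U x.
have mJU := measurable_potential ds b mU U0.
have JU0 x : 0 <= potential b U x by exact: potential_ge0.
have mV : measurable_fun setT V by exact: emeasurable_funM.
have V0 x : 0 <= V x by rewrite mule_ge0.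
have sub : superlevel (fun x => g x * potential b F x) s `<=` superlevel V L.
  move=> x; rewrite /superlevel/= => sx.
  (* With this height the first term of the splitting, multiplied by w x, equals s / 2; the second
     must then exceed s / 2, which is the inequality V x > L. *)
  have wx := w0 x; pose l := (s / (2 * C) / w x `^ e)%R.
  have l0 : (0 < l)%R by rewrite divr_gt0// powR_gt0.
  have : potential b F x <= (l * (C * w x `^ (e - 1)))%:E + (l `^ (1 - p))%:E * potential b U x.
    have lw0 y : 0 <= l%:E * (w y `^ e)%:E by rewrite mule_ge0// lee_fin ltW.
    have lU0 y : 0 <= (l `^ (1 - p))%:E * U y by rewrite mule_ge0// lee_fin powR_ge0.
    apply: (@le_trans _ _ (potential b (fun y => l%:E * (w y `^ e)%:E + (l `^ (1 - p))%:E * U y) x)).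
      apply: (potential_le ds) => // [|y|y].
      - by apply: emeasurable_funD; apply: measurable_funeM.
      - by rewrite adde_ge0.
      - exact: split_F.
    rewrite (potentialD ds)//; [|exact: measurable_funeM..].
    rewrite (potentialZl ds) ?(ltW l0)// (potentialZl ds) ?powR_ge0//.
    apply: leeD => //; rewrite [leRHS]EFinM; apply: lee_wpmul2l; first by rewrite lee_fin ltW.
    exact: we.
  move=> JF.
  have : s%:E < (w x)%:E * ((l * (C * w x `^ (e - 1)))%:E + (l `^ (1 - p))%:E * potential b U x).
    apply: (lt_le_trans sx); apply: le_trans (lee_wpmul2l _ JF); last by rewrite lee_fin ltW.
    by apply: lee_wpmul2r => //; exact: potential_ge0.
  rewrite ge0_muleDr; last 2 first.
  - by rewrite lee_fin (mulr_ge0 (ltW l0) (mulr_ge0 (ltW C0) (powR_ge0 _ _))).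
  - by rewrite mule_ge0 ?JU0// lee_fin powR_ge0.
  have weN0 : (w x `^ e != 0)%R by rewrite gt_eqF// powR_gt0.
  have -> : (w x)%:E * (l * (C * w x `^ (e - 1)))%:E = (s / 2)%:E :> \bar R.
    rewrite -EFinM; congr EFin; rewrite /l.
    have -> : (w x `^ (e - 1) = w x `^ e / w x)%R.
      by rewrite powRB ?(gt_eqF wx) ?implybT// powRr1 ?(ltW wx).
    have wxN0 := gt_eqF wx; have CN0 := gt_eqF C0.
    by move: (w x `^ e)%R weN0 => z z0; field; rewrite z0 wxN0 CN0.
  rewrite muleA -EFinM => h.
  have {}h : (s / 2)%:E < (w x * l `^ (1 - p))%:E * potential b U x.
    by move: h; rewrite -lteBlDl// -EFinB (_ : s - s / 2 = s / 2)%R//; lra.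
  have E : (w x * l `^ (1 - p) = w x `^ a * (s / (2 * C)) `^ (1 - p))%R.
    rewrite /l powRM ?(ltW sC) ?invr_ge0 ?powR_ge0// -[((w x `^ e)^-1)%R]powRN -powRrM.
    have -> : (- e * (1 - p) = a - 1)%R by rewrite aE; ring.
    rewrite mulrCA mulrC [(w x * _)%R](_ : _ = w x `^ a)%R//.
    by rewrite -{1}[w x](powRr1 (ltW wx)) -powRD ?(gt_eqF wx) ?implybT// addrC subrK.
  move: h; rewrite E /V (EFinM (w x `^ a)) -muleA.
  have cN : ((s / (2 * C)) `^ (1 - p) = ((s / (2 * C)) `^ (p - 1))^-1)%R.
    by rewrite -opprB powRN.
  rewrite cN muleCA -lte_pdivrMl ?invr_gt0 ?powR_gt0// invrK -EFinM.
  by rewrite /L [(s / 2 * _)%R]mulrC.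
have ch := chebyshev mu V0 mV (ltW L0).
have : L%:E * mu (superlevel (fun x => g x * potential b F x) s) <= C%:E * \int[mu]_x (F x `^ p).
  apply: (@le_trans _ _ (L%:E * mu (superlevel V L))).
    rewrite lee_wpmul2l ?lee_fin ?(ltW L0)//.
    have mgJ : measurable_fun setT (fun x => g x * potential b F x).
      by apply: emeasurable_funM => //; exact: (measurable_potential ds).
    have m1 := measurable_superlevel s mgJ; have m2 := measurable_superlevel L mV.
    exact: (le_measure mu (mem_set m1) (mem_set m2) sub).
  (* Once the potential acts on w^a, its bound C w^(a - 1) cancels the weight in [U], because a - 1
     = e (p - 1). *)
  apply: (le_trans ch); rewrite (integral_potential_sym ds)//.
  have mFp : measurable_fun setT (fun x => F x `^ p) by exact: measurable_poweR_fun.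
  have Fp0 x : 0 <= F x `^ p by exact: poweR_ge0.
  rewrite -ge0_integralZl ?lee_fin ?(ltW C0)//.
  apply: ge0_le_integral => //.
  - by move=> x _; rewrite mule_ge0// potential_ge0.
  - by apply: emeasurable_funM => //; exact: (measurable_potential ds).
  - exact: measurable_funeM.
  - move=> x _; apply: (le_trans (lee_wpmul2l (U0 x) (wa x))).
    rewrite /U -muleA -EFinM (_ : w x `^ _ * _ = C)%R 1?muleC//.
    rewrite mulrCA -powRD ?(gt_eqF (w0 x)) ?implybT//.
    by rewrite (_ : - _ + _ = 0)%R ?powRr0 ?mulr1// aE; ring.
rewrite -lee_pdivlMl// => /le_trans; apply.
rewrite muleA -EFinM le_eqVlt; apply/orP; left; apply/eqP; congr (_%:E * _).
have C20 : (0 < 2 * C)%R by rewrite mulr_gt0.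
rewrite /L invfM powRM ?(ltW s0) ?invr_ge0 ?(ltW C20)//.
have -> : ((2 * C)^-1 `^ (p - 1) = ((2 * C) `^ (p - 1))^-1)%R.
  by rewrite -(powR_inv1 (ltW C20)) -powRrM mulN1r powRN.
have -> : ((2 * C) `^ p = 2 * C * (2 * C) `^ (p - 1))%R by rewrite mulr_powRB1// ltW.
have -> : (s `^ (- p) = (s * s `^ (p - 1))^-1)%R by rewrite mulr_powRB1 ?(ltW s0)// powRN.
have z1 : ((2 * C) `^ (p - 1) != 0)%R by rewrite gt_eqF// powR_gt0.
have z2 : (s `^ (p - 1) != 0)%R by rewrite gt_eqF// powR_gt0.
move: ((2 * C) `^ (p - 1))%R (s `^ (p - 1))%R z1 z2 => z1 z2 h1 h2.
by field; rewrite h1 h2 !gt_eqF.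
Qed.

End weighted_potential.

(** * The weight attached to g *)

Section majorant.
Local Open Scope ereal_scope.
Context d (T : measurableType d) (R : realType).
Variable mu : {sigma_finite_measure set T -> \bar R}.
Variables (nu K : R) (Q N : int -> T -> set T).
Hypothesis ds : dyadic_system mu nu K Q N.
Hypothesis K0 : (0 < K)%R.
Implicit Types (f g h u : T -> \bar R).

Local Notation average := (average mu nu N).
Local Notation maximal := (maximal mu nu N).
Local Notation potential := (potential mu nu N).
Local Notation weak_morrey_bound := (weak_morrey_bound mu nu K N).

(** Taking the maximum with g makes the weight dominate g at every point, and not just almost
    everywhere. *)
Definition majorant (gamma : R) g (x : T) : R :=
  Num.max (fine (g x)) (fine (maximal (fun y => (g y `^ gamma)%E) x) `^ gamma^-1)%R.

Lemma measurable_majorant gamma g : measurable_fun setT g -> (forall x, 0 <= g x) ->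
  measurable_fun setT (majorant gamma g).
Proof.
move=> mg g0; apply: measurable_maxr; first exact: measurableT_comp.
apply: (measurableT_comp (measurable_powR _)).
apply: measurableT_comp => //; apply: (measurable_maximal ds).
- exact: measurable_poweR_fun.
- by move=> x; exact: poweR_ge0.
Qed.

(** Write w for the majorant and G for its second entry. The average of w^a over [N k x] is at most
    a multiple of 2^(- a b k), by the Morrey size of g, and of G(x)^a, by the A_1 property. With u =
    2^(b k) G(x) the potential is then bounded by G(x)^(a - 1) times the sum of u min(1, u^(- a)),
    which converges since a > 1. *)
Lemma majorant_potential (b q q0 gamma a B : R) : (0 < b)%R -> (nu / q0 = b)%R ->
  (1 < a)%R -> (a < gamma)%R -> (gamma < q)%R -> (0 < B)%R ->
  exists2 C : R, (0 < C)%R & forall g, measurable_fun setT g -> (forall x, 0 <= g x) ->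
  (forall x, g x \is a fin_num) -> weak_morrey_bound g q q0 B ->
  (forall x, maximal (fun y => g y `^ gamma) x \is a fin_num) ->
  (forall x, 0 < maximal (fun y => g y `^ gamma) x) ->
  forall x, potential b (fun y => (majorant gamma g y `^ a)%:E) x <=
    (C * majorant gamma g x `^ (a - 1))%:E.
Proof.
move=> b0 bE a1 ag gq B0.
have a0 : (0 < a)%R by apply: lt_trans a1.
have g_gt0 : (0 < gamma)%R by apply: lt_trans ag.
pose delta := (a / gamma)%R.
have gd : (gamma * delta = a)%R by rewrite /delta mulrCA mulfV ?mulr1// gt_eqF.
have d01 : (0 < delta < 1)%R by rewrite divr_gt0//= ltr_pdivrMr// mul1r.
have aq : (0 < a < q)%R by rewrite a0 (lt_trans ag).
have gq' : (0 < gamma < q)%R by rewrite g_gt0.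
have [A1 A10 hA1] := weak_morrey_average ds K0 q0 aq.
have [A2 A20 hA2] := weak_morrey_average ds K0 q0 gq'.
have [A3 A30 hA3] := maximal_pow_average ds K0 d01.
have m0 : (0 < Num.min 1 (a - 1) :> R)%R by rewrite lt_min subr_gt0 a1 andbT.
have [Z Z0 hZ] := zsum_hat b0 m0.
pose D := Num.max (A1 * B `^ a + A3 * (A2 * B `^ gamma) `^ delta)%R (K + 1 + A3)%R.
have D0 : (0 < D)%R by rewrite lt_max [X in _ || X]addr_gt0 ?orbT// addr_gt0.
exists (D * Z)%R; first exact: mulr_gt0.
move=> g mg g0 gfin wg Mfin Mpos x.
pose h y := g y `^ gamma.
have mh : measurable_fun setT h by exact: measurable_poweR_fun.
have h0 y : 0 <= h y by exact: poweR_ge0.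
have mM : measurable_fun setT (maximal h) by exact: (measurable_maximal ds).
pose G y := (fine (maximal h y) `^ gamma^-1)%R.
have Gp y : (0 < G y)%R by rewrite powR_gt0// fine_gt0// Mpos ltey_eq Mfin.
have Gg y : (G y `^ gamma = fine (maximal h y))%R.
  by rewrite /G -powRrM mulVf ?gt_eqF// powRr1// fine_ge0// ltW// Mpos.
have HG y : (G y <= majorant gamma g y)%R by rewrite le_max lexx orbT.
have dE (e : R) k : dyad (- (nu * e / q0)) k = (dyad (- b) k `^ e)%R.
  by rewrite dyad_powR -bE mulNr mulrAC.
have avg_g k : average k (fun y => g y `^ a) x <=
    (Num.min (A1 * B `^ a * dyad (- b) k `^ a) ((K + 1) * G x `^ a))%:E.
  rewrite EFin_min le_min; apply/andP; split.
    by rewrite -dE; exact: (hA1 g B k x B0 mg g0 wg).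
  (* In place of Jensen's inequality, the power a < gamma is split at the height G x, so that only
     the average of g^gamma enters, which is at most (G x)^gamma. *)
  have pt y : g y `^ a <= cst (G x `^ a)%:E y + (G x `^ (a - gamma))%:E * h y.
    rewrite /h -(fineK (gfin y)) !poweR_EFin -EFinM -EFinD lee_fin.
    have r0 : (0 <= fine (g y))%R by rewrite fine_ge0.
    have [rG|Gr] := leP (fine (g y)) (G x).
      apply: (@le_trans _ _ (G x `^ a)%R).
        by rewrite ge0_ler_powR ?nnegrE ?(ltW a0) ?(ltW (Gp x)).
      by rewrite lerDl mulr_ge0 ?powR_ge0.
    have rp := lt_trans (Gp x) Gr.
    apply: (@le_trans _ _ (G x `^ (a - gamma) * fine (g y) `^ gamma)%R); last first.
      by rewrite lerDr powR_ge0.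
    rewrite -[leLHS](_ : fine (g y) `^ (a - gamma) * fine (g y) `^ gamma = _)%R; last first.
      by rewrite -powRD ?(gt_eqF rp) ?implybT// subrK.
    rewrite ler_wpM2r ?powR_ge0// -opprB !powRN lef_pV2 ?posrE ?(powR_gt0 _ (Gp x)) ?(powR_gt0 _ rp)//.
    by rewrite ge0_ler_powR ?nnegrE ?subr_ge0 ?(ltW ag) ?(ltW rp) ?(ltW (Gp x)) ?(ltW Gr).
  have mgh : measurable_fun setT (fun y => (G x `^ (a - gamma))%:E * h y) by exact: measurable_funeM.
  have gh0 y : 0 <= (G x `^ (a - gamma))%:E * h y by rewrite mule_ge0// lee_fin powR_ge0.
  have c0 (y : T) : 0 <= cst (G x `^ a)%:E y :> \bar R by rewrite lee_fin powR_ge0.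
  apply: (@le_trans _ _ (average k (fun y => cst (G x `^ a)%:E y + (G x `^ (a - gamma))%:E * h y) x)).
    apply: (average_le ds) => //.
    - exact: measurable_poweR_fun.
    - exact: emeasurable_funD.
    - by move=> y; exact: poweR_ge0.
    - by move=> y; rewrite adde_ge0.
  rewrite (averageD ds)// (averageZl ds) ?powR_ge0//.
  rewrite mulrDl EFinD; apply: leeD.
    by rewrite (average_cst_le ds)// powR_ge0.
  apply: (@le_trans _ _ ((G x `^ (a - gamma))%:E * maximal h x)).
    by rewrite lee_wpmul2l ?lee_fin ?powR_ge0//; exact: average_le_maximal.
  rewrite -(fineK (Mfin x)) -/(h) -Gg -EFinM lee_fin mul1r -powRD ?(gt_eqF (Gp x)) ?implybT//.
  by rewrite subrK.
have avg_M k : average k (fun y => maximal h y `^ delta) x <=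
    (Num.min (A3 * (A2 * B `^ gamma) `^ delta * dyad (- b) k `^ a) (A3 * G x `^ a))%:E.
  rewrite EFin_min le_min; apply/andP; split.
    (* [maximal_pow_average] is used twice: here with the Morrey bound at scale k, which also bounds
       the averages at all larger scales, and below with the maximal function at x. *)
    pose Y := (A2 * B `^ gamma * dyad (- b) k `^ gamma)%R.
    have Y0 : (0 < Y)%R by rewrite !mulr_gt0 ?powR_gt0// dyad_gt0.
    have hY j : (k < j)%R -> average j h x <= Y%:E.
      move=> kj; apply: (le_trans (hA2 g B j x B0 mg g0 wg)).
      rewrite dE lee_fin ler_wpM2l ?mulr_ge0 ?powR_ge0 ?(ltW A20)//.
      rewrite ge0_ler_powR ?nnegrE ?dyad_ge0 ?(ltW g_gt0)// !dyad_opp lef_pV2 ?posrE ?dyad_gt0//.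
      by apply: dyad_le; [exact: ltW b0|exact: ltW kj].
    apply: (le_trans (hA3 h k x Y Y0 mh h0 hY)); rewrite lee_fin /Y.
    have AB : (0 <= A2 * B `^ gamma)%R by rewrite mulr_ge0 ?powR_ge0// ltW.
    by rewrite (powRM _ AB (powR_ge0 _ _)) -(powRrM (dyad _ _)) gd mulrA.
  pose Y := fine (maximal h x).
  have Y0 : (0 < Y)%R by rewrite fine_gt0// Mpos ltey_eq Mfin.
  have hY j : (k < j)%R -> average j h x <= Y%:E.
    by move=> _; rewrite /Y fineK//; exact: average_le_maximal.
  apply: (le_trans (hA3 h k x Y Y0 mh h0 hY)); rewrite lee_fin /Y -Gg -powRrM.
  by rewrite gd.
have Hpt y : (majorant gamma g y `^ a)%:E <= g y `^ a + maximal h y `^ delta.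
  rewrite -(fineK (gfin y)) -(fineK (Mfin y)) !poweR_EFin -EFinD lee_fin.
  have E : (fine (maximal h y) `^ delta = G y `^ a)%R.
    by rewrite /G -powRrM /delta [(a / _)%R]mulrC.
  rewrite -/(h) E /majorant -/(h) -/(G y).
  have [_|_] := leP (fine (g y)) (G y); first by rewrite lerDr powR_ge0.
  by rewrite lerDl powR_ge0.
have mMd : measurable_fun setT (fun y => maximal h y `^ delta) by exact: measurable_poweR_fun.
have mga : measurable_fun setT (fun y => g y `^ a) by exact: measurable_poweR_fun.
have mHa : measurable_fun setT (fun y => (majorant gamma g y `^ a)%:E).
  apply/measurable_EFinP; apply: (measurableT_comp (measurable_powR a)).
  exact: measurable_majorant.
have avg_H k : average k (fun y => (majorant gamma g y `^ a)%:E) x <=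
    (D * (G x `^ a * Num.min 1 ((dyad b k * G x) `^ (- a))))%:E.
  apply: (@le_trans _ _ (average k (fun y => g y `^ a + maximal h y `^ delta) x)).
    apply: (average_le ds) => //.
    - exact: emeasurable_funD.
    - by move=> y; rewrite lee_fin powR_ge0.
    - by move=> y; rewrite adde_ge0 ?poweR_ge0.
  rewrite (averageD ds)//; [|by move=> y; exact: poweR_ge0..].
  apply: (le_trans (leeD (avg_g k) (avg_M k))); rewrite -EFinD lee_fin.
  rewrite minr_pMr ?powR_ge0// mulr1.
  have -> : (G x `^ a * (dyad b k * G x) `^ (- a) = dyad (- b) k `^ a)%R.
    rewrite powRN powRM ?dyad_ge0 ?(ltW (Gp x))// dyad_opp.
    have -> : ((dyad b k)^-1 `^ a = (dyad b k `^ a)^-1)%R.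
      by rewrite -(powR_inv1 (dyad_ge0 b k)) -powRrM mulN1r powRN.
    have z1 : (dyad b k `^ a != 0)%R by rewrite gt_eqF// powR_gt0// dyad_gt0.
    have z2 : (G x `^ a != 0)%R by rewrite gt_eqF// powR_gt0.
    by move: (dyad b k `^ a)%R (G x `^ a)%R z1 z2 => u v u0 v0; field; rewrite u0 v0.
  have e0 := powR_ge0 (dyad (- b) k) a; have e1 := powR_ge0 (G x) a.
  have DA : (A1 * B `^ a + A3 * (A2 * B `^ gamma) `^ delta <= D)%R by rewrite le_max lexx.
  have DB : (K + 1 + A3 <= D)%R by rewrite le_max lexx orbT.
  clear -DA DB e0 e1; move: (G x `^ a)%R (dyad (- b) k `^ a)%R e0 e1 DA DB.
  move: (A1 * _)%R (A3 * _)%R => c1 c2 u v v0 u0 DA DB.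
  have [_|_] := leP u v.
    apply: (@le_trans _ _ ((K + 1) * u + A3 * u)%R).
      by apply: lerD; rewrite ge_min lexx orbT.
    by rewrite -mulrDl ler_wpM2r.
  apply: (@le_trans _ _ (c1 * v + c2 * v)%R).
    by apply: lerD; rewrite ge_min lexx.
  by rewrite -mulrDl ler_wpM2r.
have tau0 : (0 < (G x)^-1)%R by rewrite invr_gt0.
apply: (@le_trans _ _ (zsum (fun k => (D * G x `^ (a - 1))%:E *
    (hat (Num.min 1 (a - 1)) (dyad b k / (G x)^-1))%:E))).
  apply: le_zsum => k; rewrite invrK.
  apply: (le_trans (lee_wpmul2l _ (avg_H k))); first by rewrite lee_fin dyad_ge0.
  rewrite -!EFinM lee_fin.
  have u0 : (0 < dyad b k * G x)%R by rewrite mulr_gt0// dyad_gt0.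
  have w := weak_hat (introT andP (conj ltr01 a1)) u0; rewrite powRr1 ?(ltW u0)// in w.
  have DG : (0 <= D * G x `^ (a - 1))%R by rewrite mulr_ge0 ?powR_ge0// ltW.
  apply: le_trans (ler_wpM2l DG w).
  rewrite -[in leLHS](_ : G x * G x `^ (a - 1) = G x `^ a)%R; last first.
    by rewrite mulr_powRB1// ltW.
  by rewrite le_eqVlt; apply/orP; left; apply/eqP; ring.
rewrite zsumZl; [|by move=> j; rewrite lee_fin hat_ge0|by rewrite mulr_ge0 ?powR_ge0// ltW].
apply: (@le_trans _ _ ((D * G x `^ (a - 1))%:E * Z%:E)).
  by rewrite lee_wpmul2l ?hZ// lee_fin mulr_ge0 ?powR_ge0// ltW.
rewrite -EFinM lee_fin mulrAC ler_wpM2l ?mulr_ge0 ?(ltW D0) ?(ltW Z0)//.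
by rewrite ge0_ler_powR ?nnegrE ?subr_ge0 ?(ltW a1) ?(ltW (Gp x)) ?(le_trans (ltW (Gp x))).
Qed.

(** The neighbourhoods of a single point exhaust the space, so one zero of the maximal function
    makes g vanish almost everywhere. *)
Lemma maximal_eq0 gamma g x : (0 < gamma)%R -> measurable_fun setT g -> (forall x, 0 <= g x) ->
  maximal (fun y => g y `^ gamma) x = 0 -> mu (superlevel g 0) = 0.
Proof.
move=> gam0 mg g0 M0; pose h y := g y `^ gamma.
have mh : measurable_fun setT h by exact: measurable_poweR_fun.
have h0 y : 0 <= h y by exact: poweR_ge0.
have mN k := measurable_nbhd ds k x.
have null k : mu.-negligible (N k x `&` superlevel g 0).
  have : \int[mu]_(y in N k x) `|h y| = 0.
    have : average k h x <= 0 by rewrite -M0; exact: average_le_maximal.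
    rewrite /average pmule_rle0 ?lte_fin ?dyad_gt0// => i0.
    apply/eqP; rewrite eq_le integral_ge0// andbT.
    by under eq_integral do rewrite gee0_abs//.
  move=> /(ae_eq_integral_abs mu (mN k) (measurable_funTS mh)).
  apply: negligibleS => y [Ny gy] /= /(_ Ny) /eqP.
  by rewrite /h poweR_eq0// gt_eqF.
have mS := measurable_superlevel 0 mg.
apply/negligibleP => //.
apply: negligibleS (negligible_bigcup (fun n => null (int_of_index n))) => y gy.
have [k xy] := nbhd_cover ds x y.
have [_ _ /(_ k Logic.I)[n _ nk]] := int_of_index_bij.
by exists n => //; rewrite nk.
Qed.

(** The test powers e and a of the Schur argument must both lie strictly between 1 and q, and p < q
    leaves room for this. The weight requires a finite and positive maximal function: g is first
    bounded, and the degenerate case is that of a null g. *)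
Theorem potential_weak_type (b p q q0 B : R) : (0 < b)%R -> (nu / q0 = b)%R ->
  (1 < p)%R -> (p < q)%R -> (0 < B)%R ->
  exists2 C : R, (0 < C)%R & forall g, measurable_fun setT g -> (forall x, 0 <= g x) ->
  weak_morrey_bound g q q0 B ->
  weak_type mu (fun f x => g x * potential b f x) p C.
Proof.
move=> b0 bE p1 pq B0.
have p10 : (0 < p - 1)%R by rewrite subr_gt0.
(* Chosen so that p e is the midpoint of p and q; then a = p e - (e - 1) < q. *)
pose e := (1 + (q - p) / (2 * p))%R.
have p_gt0 : (0 < p)%R by apply: lt_trans p1.
have e1 : (1 < e)%R by rewrite ltrDl divr_gt0 ?subr_gt0// mulr_gt0.
pose a := (1 + e * (p - 1))%R.
have eE : (2 * p * (e - 1) = q - p)%R by rewrite /e; field; rewrite gt_eqF.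
have a1 : (1 < a)%R by rewrite ltrDl mulr_gt0// (lt_trans ltr01).
have aq : (a < q)%R by rewrite /a; nra.
have eq_ : (e < q)%R by nra.
pose gamma := ((Num.max a e + q) / 2)%R.
have mq : (Num.max a e < q)%R by rewrite gt_max aq.
have gq : (gamma < q)%R by rewrite /gamma; lra.
have mg_ : (Num.max a e < gamma)%R by rewrite /gamma; lra.
have ag : (a < gamma)%R by apply: le_lt_trans mg_; rewrite le_max lexx.
have eg : (e < gamma)%R by apply: le_lt_trans mg_; rewrite le_max lexx orbT.
have gam0 : (0 < gamma)%R by apply: lt_trans ag; apply: lt_trans a1.
have [C1 C10 hC1] := majorant_potential b0 bE a1 ag gq B0.
have [C2 C20 hC2] := majorant_potential b0 bE e1 eg gq B0.
pose C := Num.max C1 C2.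
have C0 : (0 < C)%R by rewrite lt_max C10.
exists ((2 * C) `^ p)%R; first by rewrite powR_gt0// mulr_gt0.
have bounded g (m : R) : (0 < m)%R -> measurable_fun setT g -> (forall x, 0 <= g x) ->
    (forall x, g x <= m%:E) -> weak_morrey_bound g q q0 B ->
    weak_type mu (fun f x => g x * potential b f x) p ((2 * C) `^ p).
  move=> m0 mg g0 gm wg.
  have gfin x : g x \is a fin_num by rewrite ge0_fin_numE// (le_lt_trans (gm x))// ltry.
  pose h y := g y `^ gamma.
  have mh : measurable_fun setT h by exact: measurable_poweR_fun.
  have h0 y : 0 <= h y by exact: poweR_ge0.
  have M0 x : 0 <= maximal h x by exact: maximal_ge0.
  have Mfin x : maximal h x \is a fin_num.
    rewrite ge0_fin_numE//; apply: (@le_lt_trans _ _ (K * m `^ gamma)%:E); last exact: ltry.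
    apply: ge_ereal_sup => _ [k _ <-].
    apply: le_trans (average_cst_le ds k x (powR_ge0 m gamma)).
    apply: (average_le ds) => // y; first by rewrite lee_fin powR_ge0.
    by rewrite -poweR_EFin le_poweR ?(ltW gam0).
  have [pos|/existsNP[x /negP]] := pselect (forall x, 0 < maximal h x); last first.
    rewrite -leNgt => Mx f l mf f0 l0.
    have {}Mx : maximal h x = 0 by apply/eqP; rewrite eq_le Mx M0.
    have z := maximal_eq0 gam0 mg g0 Mx.
    have mf' : measurable_fun setT (fun x => g x * potential b f x).
      by apply: emeasurable_funM => //; exact: (measurable_potential ds).
    have s : superlevel (fun x => g x * potential b f x) l `<=` superlevel g 0.
      move=> y; rewrite /superlevel/= => ly; rewrite lt0e g0 andbT.
      by apply: contraTneq ly => ->; rewrite mul0e lte_fin ltNge ltW.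
    apply: (@le_trans _ _ 0).
      rewrite -z; exact: (le_measure mu (mem_set (measurable_superlevel l mf'))
        (mem_set (measurable_superlevel 0%R mg)) s).
    rewrite mule_ge0 ?lee_fin ?mulr_ge0 ?powR_ge0//.
    by apply: integral_ge0 => y _; exact: poweR_ge0.
  have w0 x : (0 < majorant gamma g x)%R.
    by rewrite lt_max orbC powR_gt0// fine_gt0// pos ltey_eq Mfin.
  apply: (@schur_weak_type _ _ _ _ _ _ _ _ ds b g (majorant gamma g) C p a e) => //.
  - exact: measurable_majorant.
  - by move=> x; rewrite -(fineK (gfin x)) lee_fin le_max lexx.
  - move=> x; apply: (le_trans (hC2 g mg g0 gfin wg Mfin pos x)).
    by rewrite lee_fin ler_wpM2r ?powR_ge0// le_max lexx orbT.
  - move=> x; apply: (le_trans (hC1 g mg g0 gfin wg Mfin pos x)).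
    by rewrite lee_fin ler_wpM2r ?powR_ge0// le_max lexx.
move=> g mg g0 wg f l mf f0 l0.
(* The constant of the bounded case is independent of the bound, so truncating g and passing to the
   increasing union of superlevel sets gives the general case. *)
pose gm (m : nat) x := mine (g x) m.+1%:R%:E.
have gm0 m x : 0 <= gm m x by rewrite /gm le_min g0/= lee_fin.
have mgm m : measurable_fun setT (gm m) by apply: measurable_mine.
have wgm m : weak_morrey_bound (gm m) q q0 B.
  move=> k x; have [h1 h2] := wg k x; split => // t t0; apply: le_trans (h2 t t0).
  have mN := measurable_nbhd ds k x.
  apply: le_measure; rewrite ?inE; [by apply: measurableI => //; exact: measurable_superlevel..|].
  by move=> y [Ny]; rewrite /superlevel/= lt_min => /andP[].
have J0 x : 0 <= potential b f x by exact: potential_ge0.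
have mJ := measurable_potential ds b mf f0.
pose E m := superlevel (fun x => gm m x * potential b f x) l.
have mE m : measurable (E m).
  by apply: measurable_superlevel; exact: emeasurable_funM.
rewrite [superlevel _ _](_ : _ = \bigcup_m E m); last first.
  apply/seteqP; split => x.
    rewrite /superlevel/= => lx.
    suff [m hm] : exists m, l%:E < gm m x * potential b f x by exists m.
    have gx0 := g0 x; move: lx gx0; case gE : (g x) => [r||]//.
      move=> lx _; exists (Num.truncn r); rewrite /gm gE min_l// lee_fin.
      by rewrite ltW// Num.Theory.truncnS_gt.
    have J0x := J0 x; move: J0x; case JE : (potential b f x) => [r||]// r0 lx _; last first.
      by exists 0%N; rewrite /gm gE min_r ?leey// gt0_muley ?ltry// lte_fin.
    have rp : (0 < r)%R.
      rewrite lt_neqAle -lee_fin r0 andbT; apply: contraTneq lx => <-.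
      by rewrite mule0 lte_fin ltNge ltW.
    exists (Num.truncn (l / r)); rewrite /gm gE min_r ?leey// -EFinM lte_fin -ltr_pdivrMr//.
    exact: Num.Theory.truncnS_gt.
  move=> [m _]; rewrite /E /superlevel/= => /lt_le_trans; apply.
  by apply: lee_wpmul2r => //; rewrite ge_min lexx.
have ndE : nondecreasing_seq E.
  apply/nondecreasing_seqP => m; apply/subsetPset => x; rewrite /E /superlevel/=.
  move=> /lt_le_trans; apply; apply: lee_wpmul2r => //.
  by rewrite /gm le_min ge_min lexx/= ge_min [X in _ || X]lee_fin ler_nat leqnSn orbT.
have cE := @nondecreasing_cvg_mu _ T R mu E mE (bigcupT_measurable _ mE) ndE.
rewrite -(cvg_lim _ cE)//; apply: lime_le; first by apply/cvg_ex; eexists; exact: cE.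
apply: nearW => m; apply: (bounded (gm m) m.+1%:R) => //.
by move=> x; rewrite ge_min lexx orbT.
Qed.

End majorant.

(** * The product inequality in a dyadic system *)

Section olsen_dyadic.
Local Open Scope ereal_scope.
Context d (T : measurableType d) (R : realType).
Variable mu : {sigma_finite_measure set T -> \bar R}.
Variables (nu K : R) (Q N : int -> T -> set T).
Hypothesis ds : dyadic_system mu nu K Q N.
Hypothesis K0 : (0 < K)%R.
Implicit Types (f g h u : T -> \bar R).

Local Notation average := (average mu nu N).
Local Notation maximal := (maximal mu nu N).
Local Notation potential := (potential mu nu N).
Local Notation weak_morrey_bound := (weak_morrey_bound mu nu K N).
Local Notation morrey_lbound := (morrey_lbound mu nu N).

Lemma weak_type_le S (p C1 C2 : R) : (C1 <= C2)%R ->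
  weak_type mu S p C1 -> weak_type mu S p C2.
Proof.
move=> C12 h f l mf f0 l0; apply: (le_trans (h f l mf f0 l0)).
rewrite lee_wpmul2r ?lee_fin ?ler_wpM2r ?powR_ge0//.
by apply: integral_ge0 => x _; exact: poweR_ge0.
Qed.

(** The averages of f at scale j are O(2^(- nu j / r0)), and b < nu / r0 makes the scales above k a
    geometric sum of size v. Multiplied by g, this far part inherits the weak integrability q > p of
    g, which [local_lbound] accepts. *)
Theorem potential_morrey sigma (b p q q0 r0 B1 B2 : R) : 0 < sigma ->
  (0 < b)%R -> (nu / q0 = b)%R -> (b < nu / r0)%R -> (1 < p)%R -> (p < q)%R ->
  (0 < B1)%R -> (0 < B2)%R ->
  exists2 C : R, (0 < C)%R & forall f g, measurable_fun setT f -> (forall x, 0 <= f x) ->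
  measurable_fun setT g -> (forall x, 0 <= g x) ->
  weak_morrey_bound g q q0 B1 -> morrey_lbound sigma 1 p r0 f B2 ->
  morrey_lbound sigma 1 p r0 (fun x => g x * potential b f x) C.
Proof.
move=> s0 b0 bE br p1 pq B10 B20.
have p_gt0 : (0 < p)%R by apply: lt_trans p1.
have c0 : (0 < 1 :> R)%R by [].
pose pa := ((1 + p) / 2)%R; pose pb := ((p + q) / 2)%R.
have pa1 : (1 < pa)%R by rewrite /pa; lra.
have pap : (pa < p)%R by rewrite /pa; lra.
have ppb : (p < pb)%R by rewrite /pb; lra.
have pbq : (pb < q)%R by rewrite /pb; lra.
have pa0 : (0 < pa)%R by apply: lt_trans pa1.
have [W1 W10 hW1] := potential_weak_type ds K0 b0 bE pa1 (lt_trans pap pq) B10.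
have [W2 W20 hW2] := potential_weak_type ds K0 b0 bE (lt_trans p1 ppb) pbq B10.
pose W := Num.max W1 W2.
have W0 : (0 < W)%R by rewrite lt_max W10.
have [L L0 hL] := local_lbound mu s0 c0 pa0 pap ppb pq W0.
have [B' B'0 hB'] := morrey_lbound_weak ds K0 r0 s0 c0 p_gt0 B20.
have [A A0 hA] := weak_morrey_average ds K0 r0 (introT andP (conj ltr01 p1)).
pose eps := (nu / r0 - b)%R.
have eps0 : (0 < eps)%R by rewrite subr_gt0.
have [Z Z0 hZ] := zsum_hat c0 eps0.
pose v0 := (A * B' * Z)%R.
have v00 : (0 < v0)%R by rewrite !mulr_gt0.
pose e := (nu * (1 - p / r0))%R.
exists (L * (B2 * dyad e 1 + K * (B1 * v0) `^ p))%R.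
  by rewrite mulr_gt0// addr_gt0// mulr_gt0 ?dyad_gt0// powR_gt0// mulr_gt0.
move=> f g mf f0 mg g0 wg hf k x.
have wf := hB' f mf hf.
have mN := measurable_nbhd ds.
pose f1 := cutoff (N (k + 1)%R x) f.
have mf1 : measurable_fun setT f1 by exact: measurable_cutoff.
have f10 y : 0 <= f1 y by exact: cutoff_ge0.
pose v := (v0 * dyad (- eps) k)%R.
have v_gt0 : (0 < v)%R by rewrite mulr_gt0// dyad_gt0.
pose tau := (B1 * dyad (- (nu / q0)) k * v)%R.
have tau0 : (0 < tau)%R by rewrite !mulr_gt0// dyad_gt0.
have KD0 : (0 <= K * dyad nu k)%R by rewrite mulr_ge0 ?dyad_ge0// ltW.
have BD : (0 <= B2 * dyad e (k + 1))%R by rewrite mulr_ge0 ?dyad_ge0// ltW.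
have av j y : average j f y <= (A * B' * dyad (- (nu / r0)) j)%:E.
  have := hA f B' j y B'0 mf f0 wf.
  rewrite (_ : average j _ y = average j f y); last first.
    by congr (_ * _); apply: eq_integral => z _; rewrite poweRe1.
  by rewrite powRr1 ?(ltW B'0)// mulr1.
have far y : N k x y -> potential b f y <= potential b f1 y + v%:E.
  move=> xy; have t0 z : 0 <= (hat eps (dyad 1 z / dyad 1 k))%:E :> \bar R.
    by rewrite lee_fin hat_ge0.
  have C0 : (0 <= A * B' * dyad (- eps) k)%R by rewrite !mulr_ge0 ?dyad_ge0// ltW.
  apply: (@le_trans _ _ (potential b f1 y + zsum (fun j =>
      (A * B' * dyad (- eps) k)%:E * (hat eps (dyad 1 j / dyad 1 k))%:E))).
    rewrite /potential -zsumD; last 2 first.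
    - by move=> j; rewrite mule_ge0 ?lee_fin ?dyad_ge0// average_ge0.
    - by move=> j; rewrite mule_ge0.
    apply: le_zsum => j; have [jk|kj] := leP j k.
      rewrite (_ : average j f y = average j f1 y).
        by rewrite leeDl// mule_ge0.
      congr (_ * _); apply: eq_integral => z; rewrite inE => yz.
      rewrite /f1 cutoffT//; apply: (sub_nbhd_nbhdS ds xy).
      exact: (nbhd_le ds jk).
    apply: (@le_trans _ _ ((dyad b j)%:E * (A * B' * dyad (- (nu / r0)) j)%:E)).
      by rewrite lee_wpmul2l ?lee_fin ?dyad_ge0.
    rewrite -!EFinM; apply: (@le_trans _ _ (A * B' * dyad (- eps) k *
        hat eps (dyad 1 j / dyad 1 k))%:E); last first.
      by rewrite leeDr// mule_ge0 ?lee_fin ?dyad_ge0// average_ge0.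
    rewrite lee_fin -dyadN -dyadD hat_dyad// mul1r ger0_norm ?subr_ge0 ?(ltW kj)//.
    rewrite -[leRHS]mulrA -dyadD addrC subrK mulrCA.
    rewrite ler_wpM2l ?mulr_ge0 ?(ltW A0) ?(ltW B'0)//.
    by rewrite -dyad_split /eps opprB.
  apply: leeD => //; rewrite zsumZl//.
  apply: le_trans (lee_wpmul2l _ (hZ _ (dyad_gt0 1 k))) _; first by rewrite lee_fin.
  by rewrite -EFinM lee_fin /v /v0 le_eqVlt; apply/orP; left; apply/eqP; ring.
have wb : weak_bound mu (N k x) (fun y => v%:E * g y) q (K * dyad nu k) tau.
  have [h1 h2] := wg k x; split => // l l0.
  have -> : superlevel (fun y => v%:E * g y) l = superlevel g (l / v).
    by apply/seteqP; split => y; rewrite /superlevel/= (EFinM l) lte_pdivrMr// muleC.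
  apply: (le_trans (h2 _ (divr_gt0 l0 v_gt0))).
  by rewrite invf_div mulrA.
have mgv : measurable_fun setT (fun y => v%:E * g y) by exact: measurable_funeM.
have gv0 y : 0 <= v%:E * g y by rewrite mule_ge0// lee_fin ltW.
have mu_ : measurable_fun setT (fun y => g y * potential b f y).
  by apply: emeasurable_funM => //; exact: (measurable_potential ds).
have wa : weak_type mu (fun f x => g x * potential b f x) pa W.
  by apply: weak_type_le (hW1 g mg g0 wg); rewrite le_max lexx.
have wb' : weak_type mu (fun f x => g x * potential b f x) pb W.
  by apply: weak_type_le (hW2 g mg g0 wg); rewrite le_max lexx orbT.
have := hL _ (N k x) f1 _ _ _ _ _ (sublinear_potential ds b mg g0) wa wb' (mN k x)
  mf1 f10 mu_ mgv gv0 BD KD0 tau0 (hf (k + 1)%R x) wb.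
rewrite /tau /v.
(* As nu / q0 + eps = nu / r0, the scaling of g and that of the far part add up to the scaling of
   the target space. *)
have -> : (B1 * dyad (- (nu / q0)) k * (v0 * dyad (- eps) k) =
    B1 * v0 * dyad (- (nu / r0)) k)%R.
  have -> : (- (nu / r0) = - (nu / q0) + - eps)%R by rewrite bE /eps; ring.
  by rewrite dyad_split; move: (dyad _ k) (dyad _ k) => y z; ring.
have Bv0 : (0 <= B1 * v0)%R by rewrite mulr_ge0 ?(ltW B10) ?(ltW v00).
rewrite (powRM _ Bv0 (dyad_ge0 _ _)) dyad_powR.
have eE : dyad e k = (dyad nu k * dyad (- (nu / r0) * p) k)%R.
  by rewrite -dyad_split /e mulrBr mulr1 mulNr mulrA [(nu / r0 * p)%R]mulrAC.
have -> : (L * (B2 * dyad e (k + 1) + K * dyad nu k * ((B1 * v0) `^ p * dyad (- (nu / r0) * p) k)) =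
   L * (B2 * dyad e 1 + K * (B1 * v0) `^ p) * dyad e k)%R.
  rewrite dyadD eE.
  by move: (dyad e 1) (dyad nu k) (dyad _ k) ((B1 * v0) `^ p)%R => a z z' t; ring.
apply=> y xy; rewrite [v%:E * _]muleC -ge0_muleDr ?potential_ge0//; last first.
  by rewrite lee_fin ltW.
by rewrite lee_wpmul2l// far.
Qed.

(* Hedberg's inequality, scale by scale. *)
Lemma potential_maximal_le (alpha b theta p p0 B : R) : (1 < p)%R ->
  (0 < theta <= 1)%R -> (0 < B)%R -> (alpha - nu / p0 * (1 - theta) = b)%R ->
  exists2 C : R, (0 < C)%R & forall f, measurable_fun setT f -> (forall x, 0 <= f x) ->
  weak_morrey_bound f p p0 B -> forall x,
  potential alpha f x <= C%:E * potential b (fun y => maximal f y `^ theta) x.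
Proof.
move=> p1 /andP[th0 th1] B0 bE.
have [A A0 hA] := weak_morrey_average ds K0 p0 (introT andP (conj ltr01 p1)).
exists ((A * B) `^ (1 - theta))%R; first by rewrite powR_gt0// mulr_gt0.
move=> f mf f0 wf x.
have mM := measurable_maximal ds mf f0.
have mMt : measurable_fun setT (fun y => maximal f y `^ theta) by exact: measurable_poweR_fun.
have t0 y : 0 <= maximal f y `^ theta by exact: poweR_ge0.
rewrite /potential -zsumZl ?powR_ge0//; last first.
  by move=> k; rewrite mule_ge0 ?lee_fin ?dyad_ge0// average_ge0.
apply: le_zsum => k.
have av0 : 0 <= average k f x by exact: average_ge0.
have av : average k f x <= (A * B * dyad (- (nu / p0)) k)%:E.
  have := hA f B k x B0 mf f0 wf.
  rewrite (_ : average k _ x = average k f x); last first.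
    by congr (_ * _); apply: eq_integral => z _; rewrite poweRe1.
  by rewrite powRr1 ?(ltW B0)// mulr1.
(* The average at scale k is constant on the cube [Q k x], so its power theta bounds (M f)^theta
   from below on a subset of [N k x] of measure 2^(nu k). *)
have lower : average k f x `^ theta <= average k (fun y => maximal f y `^ theta) x.
  have NE z : Q k x z -> N k z = N k x.
    move=> xz; apply/seteqP; split => y h.
      apply: (nbhd_sym ds); apply: (sub_cube_nbhd ds (nbhd_sym ds h)).
      exact: (cube_sym ds).
    by apply: (nbhd_sym ds); apply: (sub_cube_nbhd ds (nbhd_sym ds h)).
  have mQ := measurable_cube ds k x.
  apply: (@le_trans _ _ ((dyad nu (- k))%:E * \int[mu]_(z in Q k x) cst (average k f x `^ theta) z)).
    rewrite integral_cst//.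
    apply: (@le_trans _ _ ((dyad nu (- k))%:E * (average k f x `^ theta * (dyad nu k)%:E))).
      rewrite muleCA -EFinM dyadN mulVf ?mule1//.
      by rewrite gt_eqF// dyad_gt0.
    by rewrite -(measure_cube ds k x).
  rewrite lee_wpmul2l ?lee_fin ?dyad_ge0//.
  apply: (@le_trans _ _ (\int[mu]_(z in Q k x) (maximal f z `^ theta))).
    apply: ge0_le_integral => //.
    - by move=> z _; exact: poweR_ge0.
    - exact: measurable_funTS.
    - move=> z xz; rewrite le_poweR ?(ltW th0)//.
      apply: le_trans (average_le_maximal _ _ _ k f z).
      by rewrite /average NE.
  apply: ge0_subset_integral => //; first exact: (measurable_nbhd ds).
    exact: measurable_funTS.
  exact: (sub_cube_nbhd ds (nbhdxx ds k x)).
apply: (@le_trans _ _ (((A * B) `^ (1 - theta))%:E *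
    ((dyad b k)%:E * average k f x `^ theta))); last first.
  by rewrite !lee_wpmul2l ?lee_fin ?powR_ge0 ?dyad_ge0.
move: av av0; case: (average k f x) => [r||]// rA r0; rewrite lee_fin in rA; rewrite lee_fin in r0.
rewrite poweR_EFin -!EFinM lee_fin.
have [->|rN0] := eqVneq r 0%R.
  by rewrite mulr0 !mulr_ge0 ?powR_ge0 ?dyad_ge0.
rewrite -[leLHS](_ : dyad alpha k * (r `^ theta * r `^ (1 - theta)) = _)%R; last first.
  by rewrite -powRD ?rN0 ?implybT// addrC subrK powRr1.
have AB0 : (0 <= A * B)%R by rewrite mulr_ge0// ltW.
have h : (r `^ (1 - theta) <= (A * B) `^ (1 - theta) * dyad (- (nu / p0) * (1 - theta)) k)%R.
  rewrite -dyad_powR -powRM ?dyad_ge0// ge0_ler_powR ?nnegrE ?subr_ge0//.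
  by rewrite mulr_ge0// dyad_ge0.
have -> : dyad b k = (dyad alpha k * dyad (- (nu / p0) * (1 - theta)) k)%R.
  by rewrite -dyad_split -bE mulNr.
have a0 : (0 <= dyad alpha k * r `^ theta)%R by rewrite mulr_ge0 ?dyad_ge0 ?powR_ge0.
rewrite mulrA; apply: (le_trans (ler_wpM2l a0 h)).
move: (dyad alpha k) (dyad _ k) (r `^ theta)%R ((A * B) `^ _)%R => z1 z2 z3 z4.
by rewrite le_eqVlt; apply/orP; left; apply/eqP; ring.
Qed.

Lemma superlevel_pow f (theta l : R) : (0 < theta)%R -> (0 <= l)%R -> (forall x, 0 <= f x) ->
  superlevel (fun x => f x `^ theta) (l `^ theta) = superlevel f l.
Proof.
move=> th0 l0 f0; apply/seteqP; split => x; rewrite /superlevel/= !ltNge; apply: contra => h.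
  by rewrite -poweR_EFin le_poweR ?(ltW th0).
have /(le_poweR (_ : 0 <= theta^-1)%R) : f x `^ theta <= (l `^ theta)%:E by [].
rewrite invr_ge0 (ltW th0) => /(_ isT (poweR_ge0 _ _)).
rewrite -poweR_EFin -!poweRrM mulfV ?gt_eqF// !poweRe1//.
Qed.

Theorem olsen_dyadic sigma (alpha p0 p1 q0 q1 r0 r1 theta B1 B2 : R) : 0 < sigma ->
  (0 < nu)%R -> (0 < p0)%R -> (1 < p1)%R -> (0 < q0)%R -> (1 < r1)%R -> (r1 < q1)%R ->
  (0 < theta <= 1)%R -> (theta = p0 / r0)%R -> (r1 * theta = p1)%R ->
  (alpha - nu / p0 * (1 - theta) = nu / q0)%R -> (nu / q0 < nu / r0)%R ->
  (0 < B1)%R -> (0 < B2)%R ->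
  exists2 C : R, (0 < C)%R & forall f g, measurable_fun setT f -> (forall x, 0 <= f x) ->
  measurable_fun setT g -> (forall x, 0 <= g x) ->
  weak_morrey_bound g q1 q0 B1 -> morrey_lbound sigma theta^-1 p1 p0 f B2 ->
  morrey_lbound sigma 1 r1 r0 (fun x => g x * potential alpha f x) C.
Proof.
move=> s0 nu0 p00 p11 q00 r11 rq1 th thE pr aE br B10 B20.
have /andP[th0 th1] := th.
have b0 : (0 < nu / q0)%R by rewrite divr_gt0.
have ti0 : (0 < theta^-1)%R by rewrite invr_gt0.
have p1_gt0 : (0 < p1)%R by apply: lt_trans p11.
have [CM CM0 hM] := maximal_morrey ds K0 s0 ti0 p11 p00 nu0 B20.
have [B' B'0 hB'] := morrey_lbound_weak ds K0 p0 s0 ti0 p1_gt0 B20.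
have [CJ CJ0 hJ] := potential_maximal_le p11 th B'0 aE.
have B1J : (0 < CJ * B1)%R by exact: mulr_gt0.
have [C C0 hC] := potential_morrey s0 b0 erefl br r11 rq1 B1J CM0.
exists C => // f g mf f0 mg g0 wg hf k x.
pose F y := maximal f y `^ theta.
have mM := measurable_maximal ds mf f0.
have M0 y : 0 <= maximal f y by exact: maximal_ge0.
have mF : measurable_fun setT F by exact: measurable_poweR_fun.
have F0 y : 0 <= F y by exact: poweR_ge0.
have r0N0 : r0 != 0%R.
  by apply: contraTneq th0 => r00; rewrite thE r00 invr0 mulr0 ltxx.
have expE : (nu * (1 - p1 / p0) = nu * (1 - r1 / r0))%R.
  by rewrite -pr thE; field; rewrite r0N0 gt_eqF.
(* With level ratio 2^(1 / theta) for M f and 2 for its power theta, and with p1 / theta = r1, the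
   two dyadic sequences coincide term by term. This is the reason for the free parameter c. *)
have hF : morrey_lbound sigma 1 r1 r0 F CM.
  move=> j y; have := hM f mf f0 hf j y; rewrite expE.
  rewrite (_ : dseq mu _ _ _ = dseq mu 1 r1 (cutoff (N j y) F))//.
  apply/funext => i; rewrite /dseq; congr (_%:E * mu _).
    by rewrite mul1r -pr mulrCA mulVf ?mulr1// gt_eqF.
  rewrite !superlevel_cutoff ?dyad_ge0// /F.
  rewrite -(superlevel_pow th0 (dyad_ge0 theta^-1 i) M0) dyad_powR.
  by rewrite mulVf// gt_eqF.
(* Hedberg's constant is absorbed in g, so that superlevel sets can be compared at the same
   levels. *)
pose G y := CJ%:E * g y.
have mG : measurable_fun setT G by exact: measurable_funeM.
have G0 y : 0 <= G y by rewrite mule_ge0// lee_fin ltW.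
have wG : weak_morrey_bound G q1 q0 (CJ * B1).
  move=> j y; have [h1 h2] := wg j y; split => // l l0.
  have -> : superlevel G l = superlevel g (l / CJ).
    by apply/seteqP; split => z; rewrite /superlevel/= EFinM lte_pdivrMr// muleC.
  apply: (le_trans (h2 _ (divr_gt0 l0 CJ0))); rewrite invf_div.
  by rewrite (_ : CJ * B1 * _ / l = B1 * dyad (- (nu / q0)) j * (CJ / l))%R//; ring.
have CD0 : (0 <= C * dyad (nu * (1 - r1 / r0)) k <= C * dyad (nu * (1 - r1 / r0)) k)%R.
  by rewrite lexx andbT mulr_ge0 ?dyad_ge0// ltW.
apply: (lbound_le s0 CD0 (dseq_ge0 _ _ _ _) _ (hC F G mF F0 mG G0 wG hF k x)) => j.
rewrite /dseq lee_wpmul2l ?lee_fin ?dyad_ge0//.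
have mN := measurable_nbhd ds k x.
apply: le_measure; rewrite ?inE.
- apply: measurable_superlevel; apply: measurable_cutoff => //.
  by apply: emeasurable_funM => //; exact: (measurable_potential ds).
- apply: measurable_superlevel; apply: measurable_cutoff => //.
  by apply: emeasurable_funM => //; exact: (measurable_potential ds).
move=> y; rewrite /superlevel/= => /lt_le_trans; apply.
have [Ny|Ny] := pselect (N k x y); last by rewrite !cutoffF.
rewrite !cutoffT// /G [CJ%:E * _]muleC -muleA lee_wpmul2l//.
exact: (hJ f mf f0 (hB' f mf hf) y).
Qed.

End olsen_dyadic.

(** * Dyadic cubes in Euclidean space *)

Section kernels.
Local Open Scope ereal_scope.
Context d (T : measurableType d) (R : realType).
Variable mu : {sigma_finite_measure set T -> \bar R}.
Variables (nu K : R) (Q N : int -> T -> set T).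
Hypothesis ds : dyadic_system mu nu K Q N.

(** A kernel below a weighted sum of indicators of neighbourhoods is controlled by the potential,
    which reduces I_alpha to the pointwise bound [kernel_le]. *)
Lemma kernel_potential_le (alpha c : R) (f : T -> \bar R) (kf : T -> R) x :
  measurable_fun setT f -> measurable_fun setT kf -> (forall y, 0 <= kf y)%R ->
  (0 <= c)%R ->
  (forall y, (kf y)%:E <= c%:E *
    zsum (fun k => (dyad alpha k * dyad nu (- k))%:E * (\1_(N k x) y)%:E)) ->
  `|\int[mu]_y (f y * (kf y)%:E)| <=
    c%:E * potential mu nu N alpha (fun y => `|f y|) x.
Proof.
move=> mf mk k0 c0 kle.
have maf : measurable_fun setT (fun y => `|f y|) by exact: measurableT_comp.
have mfk : measurable_fun setT (fun y => f y * (kf y)%:E).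
  by apply: emeasurable_funM => //; exact/measurable_EFinP.
have w0 k : (0 <= dyad alpha k * dyad nu (- k))%R by rewrite mulr_ge0 ?dyad_ge0.
pose g k := cutoff (N k x) (fun y => `|f y|).
have g0 k y : 0 <= g k y by exact: cutoff_ge0.
have mg k : measurable_fun setT (g k).
  by apply: measurable_cutoff => //; exact: (measurable_nbhd ds).
pose t k y := (dyad alpha k * dyad nu (- k))%:E * g k y.
have t0 k y : 0 <= t k y by rewrite mule_ge0 ?lee_fin.
have mt k : measurable_fun setT (t k) by exact: measurable_funeM.
have mz := measurable_zsum mt t0.
apply: (le_trans (le_abse_integral _ measurableT mfk)).
apply: (@le_trans _ _ (\int[mu]_y (c%:E * zsum (t ^~ y)))).
  apply: ge0_le_integral => //.
  - exact: measurableT_comp.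
  - exact: measurable_funeM.
  move=> y _; rewrite abseM [`|(kf y)%:E|]gee0_abs ?lee_fin//.
  apply: (le_trans (lee_wpmul2l (abse_ge0 _) (kle y))).
  rewrite muleCA lee_wpmul2l// -zsum_mule//; last by move=> k; rewrite mule_ge0 ?lee_fin.
  by apply: le_zsum => k; rewrite /t /g /cutoff muleCA.
rewrite ge0_integralZl//; last by move=> y _; exact: zsum_ge0.
rewrite lee_wpmul2l// integral_zsum//.
apply: le_zsum => k; rewrite ge0_integralZl ?lee_fin//.
by rewrite /g -integral_cutoff EFinM -muleA.
Qed.

End kernels.

Lemma dyad1S (R : realType) (j : int) : dyad 1 (j + 1) = 2 * dyad 1 j :> R.
Proof. by rewrite dyadD mulrC [X in X * _ = _](_ : _ = 2)// /dyad mul1r powRr1. Qed.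

Section boxes.
Local Open Scope ereal_scope.
Context {R : realType}.

Definition box n (A : 'I_n -> set R) : set (n.-tuple (measurableTypeR R)) :=
  [set x | forall i, A i (tnth x i)].

Lemma measurable_box n (A : 'I_n -> set R) : (forall i, measurable (A i)) ->
  measurable (box A).
Proof.
move=> mA; rewrite (_ : box A = \bigcap_(i in [set: 'I_n]) ((fun x => tnth x i) @^-1` A i)).
  apply: fin_bigcap_measurable => [|i _]; first exact: finite_finset.
  rewrite -[X in measurable X]setTI.
  exact: (@measurable_tnth _ (measurableTypeR R) n i measurableT _ (mA i)).
by apply/seteqP; split => [x h i _|x h i]; [exact: h|exact: (h i)].
Qed.

Lemma borel_lebesgue_box n (A : 'I_n -> set R) (l : R) :
  (forall i, measurable (A i)) -> (forall i, lebesgue_measure (A i) = l%:E) ->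
  borel_lebesgue R n (box A) = (l ^+ n)%:E.
Proof.
elim: n A => [|n IH] A mA lA.
  by rewrite /= expr0 diracE mem_set// => -[].
rewrite /= /cons_measure /pushforward.
rewrite (_ : _ @^-1` _ = A ord0 `*` box (fun i => A (lift ord0 i))); last first.
  apply/seteqP; split => [[x t] h|[x t] [h1 h2] i].
    split; first exact: (h ord0).
    by move=> i; have := h (lift ord0 i); rewrite tnthS.
  have [j ->|->] := unliftP ord0 i; last exact: h1.
  by rewrite tnthS; exact: h2.
rewrite product_measure1E; [|exact: mA|by apply: measurable_box => i; exact: mA].
rewrite exprS EFinM; congr (_ * _); first exact: lA.
by apply: IH => i; [exact: mA|exact: lA].
Qed.

End boxes.

Section euclidean.
Local Open Scope ereal_scope.
Context {R : realType} (n : nat).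
Local Notation mu := (@lebesgue_Rn R n).
Implicit Types (x y : Rn R n) (k : int).

Lemma measurable_Rn (A : set (n.-tuple (measurableTypeR R))) : measurable A ->
  measurable (A : set (Rn R n)).
Proof. exact: caratheodory_measurable_mu_ext. Qed.

Lemma lebesgue_box (A : 'I_n -> set R) (l : R) :
  (forall i, measurable (A i)) -> (forall i, lebesgue_measure (A i) = l%:E) ->
  mu (box A) = (l ^+ n)%:E.
Proof.
move=> mA lA; rewrite /lebesgue_Rn /completed_measure_extension measurable_mu_extE.
  exact: borel_lebesgue_box.
exact: measurable_box.
Qed.

Lemma measurable_coord (i : 'I_n) :
  measurable_fun setT (fun x : Rn R n => (tnth x i : R)).
Proof.
move=> _ Y mY; rewrite setTI; apply: measurable_Rn.
by rewrite -[X in measurable X]setTI; exact: (@measurable_tnth _ (measurableTypeR R) n i measurableT _ mY).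
Qed.

Lemma le_lebesgue (A B : set (Rn R n)) : A `<=` B -> mu A <= mu B.
Proof. by move=> AB; exact: le_mu_ext. Qed.

Lemma lebesgue_cube (a : Rn R n) (l : R) : (0 < l)%R -> mu (cube a l) = (l ^+ n)%:E.
Proof.
move=> l0.
rewrite (_ : cube a l = box (fun i => `[(tnth a i : R), (tnth a i + l)%R]%classic)); last first.
  by apply/seteqP; split => x h i; have := h i; rewrite /= in_itv.
apply: lebesgue_box => i; first exact: measurable_itv.
rewrite lebesgue_measure_itv/= lte_fin ltrDl l0 -EFinB.
by rewrite addrC addKr.
Qed.

Definition cell k (t : R) : int := Num.floor (t / dyad 1 k).

Definition dyadic_cube k x : set (Rn R n) :=
  [set y | forall i, cell k (tnth x i) = cell k (tnth y i)].

Definition dyadic_nbhd k x : set (Rn R n) :=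
  [set y | forall i, (`|cell k (tnth x i) - cell k (tnth y i)| <= 1)%R].

Lemma cell_itv k t (m1 m2 : int) :
  (m1 <= cell k t < m2)%R = (m1%:~R * dyad 1 k <= t < m2%:~R * dyad 1 k)%R.
Proof.
have D0 : (0 < dyad 1 k :> R)%R by exact: dyad_gt0.
by rewrite /cell -ler_pdivlMr// -ltr_pdivrMr// Num.Theory.floor_ge_int Num.Theory.floor_lt_int.
Qed.

Lemma cellS k t : (2 * cell (k + 1) t <= cell k t <= 2 * cell (k + 1) t + 1)%R.
Proof.
have := cell_itv (k + 1) t (cell (k + 1) t) (cell (k + 1) t + 1).
rewrite lexx ltrDl ltr01 /= => /esym.
rewrite dyad1S !mulrA -!(intrM _ _ 2) -cell_itv; lia.
Qed.

Lemma cell_eqS k s t : cell k s = cell k t -> cell (k + 1) s = cell (k + 1) t.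
Proof.
have := cellS k s; have := cellS k t.
by move: (cell (k + 1) s) (cell (k + 1) t) (cell k s) (cell k t) => a b c e; lia.
Qed.

(** Passing to the next scale halves cell numbers and turns distance 2 into at most 1, so two
    neighbourhood steps at scale k fit into one at scale k + 1. *)
Lemma cell_closeS k s t : (`|cell k s - cell k t| <= 2)%R ->
  (`|cell (k + 1) s - cell (k + 1) t| <= 1)%R.
Proof.
have := cellS k s; have := cellS k t.
by move: (cell (k + 1) s) (cell (k + 1) t) (cell k s) (cell k t) => a b c e; lia.
Qed.

Lemma dyad_n k : dyad n%:R k = (dyad 1 k ^+ n :> R)%R.
Proof. by rewrite -powR_mulrn ?dyad_ge0// dyad_powR mul1r. Qed.

Lemma cell_box k (m1 m2 : 'I_n -> int) (l : int) : (0 < l)%R ->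
  (forall i, m2 i = m1 i + l)%R ->
  mu [set y | forall i, (m1 i <= cell k (tnth y i) < m2 i)%R] =
    ((l%:~R * dyad 1 k) ^+ n)%:E.
Proof.
move=> l0 m12; have D0 : (0 < dyad 1 k :> R)%R by exact: dyad_gt0.
rewrite (_ : [set _ | _] = box (fun i => `[((m1 i)%:~R * dyad 1 k)%R, ((m2 i)%:~R * dyad 1 k)%R[%classic)); last first.
  by apply/seteqP; split => y h i; have := h i; rewrite /= in_itv/= cell_itv.
apply: lebesgue_box => i; first exact: measurable_itv.
rewrite lebesgue_measure_itv/= lte_fin ltr_pM2r// ltr_int m12 ltrDl l0 -EFinB.
by rewrite -mulrBl -intrB addrC addKr.
Qed.

Lemma nbhd_close k x y : (forall i, `|tnth x i - tnth y i| <= dyad 1 k :> R)%R ->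
  dyadic_nbhd k x y.
Proof.
move=> h i; have D0 : (0 < dyad 1 k :> R)%R by exact: dyad_gt0.
have hx := cell_itv k (tnth x i) (cell k (tnth x i)) (cell k (tnth x i) + 1).
have hy := cell_itv k (tnth y i) (cell k (tnth y i)) (cell k (tnth y i) + 1).
rewrite !lexx !ltrDl !ltr01 /= in hx hy.
move/esym/andP : hx => [x1 x2]; move/esym/andP : hy => [y1 y2].
have := h i; rewrite ler_norml => /andP[h1 h2].
have e1 : ((cell k (tnth x i))%:~R * dyad 1 k < (cell k (tnth y i) + 2)%:~R * dyad 1 k :> R)%R.
  by rewrite (intrD _ _ 2) mulrDl; move: y2; rewrite intrD mulrDl; lra.
have e2 : ((cell k (tnth y i))%:~R * dyad 1 k < (cell k (tnth x i) + 2)%:~R * dyad 1 k :> R)%R.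
  by rewrite (intrD _ _ 2) mulrDl; move: x2; rewrite intrD mulrDl; lra.
rewrite ltr_pM2r// ltr_int in e1; rewrite ltr_pM2r// ltr_int in e2.
by move: (cell k (tnth x i)) (cell k (tnth y i)) e1 e2 => c1 c2 e1 e2; lia.
Qed.

Lemma measurable_cell k (i : 'I_n) :
  measurable_fun setT (fun x : Rn R n => ((cell k (tnth x i))%:~R : R)).
Proof.
have mc : measurable_fun setT (fun t : R => ((cell k t)%:~R : R)).
  apply: nondecreasing_measurable => // s t st; rewrite ler_int /cell.
  by apply: Num.Theory.le_floor; rewrite ler_wpM2r// invr_ge0 dyad_ge0.
exact: (measurableT_comp mc (measurable_coord i)).
Qed.

Lemma measurable_cell_rel k (P : int -> Prop) (Y : set R) : measurable Y ->
  (forall m, P m <-> Y m%:~R) ->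
  measurable [set z : Rn R n * Rn R n |
    forall i, P (cell k (tnth z.1 i) - cell k (tnth z.2 i))%R].
Proof.
move=> mY PY.
pose D i (z : Rn R n * Rn R n) : R :=
  ((cell k (tnth z.1 i))%:~R - (cell k (tnth z.2 i))%:~R)%R.
have mD i : measurable_fun setT (D i).
  by apply: measurable_funB; apply: (measurableT_comp (measurable_cell k i)).
rewrite (_ : [set _ | _] = \bigcap_(i in [set: 'I_n]) (D i @^-1` Y)).
  apply: fin_bigcap_measurable => [|i _]; first exact: finite_finset.
  by rewrite -[X in measurable X]setTI; exact: mD.
apply/seteqP; split => [z h i _|z h i]; last first.
  by apply/PY; rewrite intrB; exact: (h i).
by have /PY := h i; rewrite intrB.
Qed.

(** The constant 3^n counts the cells that differ by at most one in each coordinate. *)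
Lemma dyadic_system_Rn : dyadic_system mu n%:R (3 ^+ n) dyadic_cube dyadic_nbhd.
Proof.
split.
- by move=> k x y h i; rewrite h.
- by move=> k x y z h1 h2 i; rewrite h1.
- by move=> k x y h i; apply: cell_eqS; exact: h.
- by move=> k x y h i; rewrite distrC.
- by move=> k x y h z yz i; rewrite -(yz i).
- by move=> k x i; rewrite subrr normr0.
- by move=> k x y h i; apply: cell_closeS; apply: le_trans (h i) _.
- move=> k x y h z yz i; apply: cell_closeS.
  apply: le_trans (ler_distD (cell k (tnth y i)) _ _) _.
  by rewrite (lerD (h i) (yz i)).
- move=> x y; pose m : R := (1 + \sum_(i < n) `|tnth x i - tnth y i|)%R.
  have m0 : (0 < m)%R by rewrite ltr_pwDl// sumr_ge0.
  have [k /andP[_ mk]] := dyad_bracket (@ltr01 R) m0.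
  exists (k + 1)%R; apply: nbhd_close => i; apply: le_trans (ltW mk).
  rewrite /m (bigD1 i)//= addrCA lerDl addr_ge0//.
  by rewrite sumr_ge0.
- move=> k; rewrite (_ : [set _ | _] = [set z : Rn R n * Rn R n |
    forall i, (fun m => m = 0%R) (cell k (tnth z.1 i) - cell k (tnth z.2 i))%R]).
    apply: (@measurable_cell_rel k (fun m => m = 0%R) [set 0%R]) => // m; split => [->//|/= /eqP].
    by rewrite intr_eq0 => /eqP.
  apply/seteqP; split => z h i; first by apply/eqP; rewrite subr_eq0; apply/eqP.
  by apply/eqP; rewrite -subr_eq0; apply/eqP; exact: h.
- move=> k; apply: (@measurable_cell_rel k (fun m : int => (`|m| <= 1)%R) `[(-1)%R, 1%R]%classic) => //.
  by move=> m; rewrite /= in_itv/= -ler_norml -intr_norm -(ler_int R).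
- move=> k x; rewrite (_ : dyadic_cube k x = [set y | forall i,
    (cell k (tnth x i) <= cell k (tnth y i) < cell k (tnth x i) + 1)%R]).
    have := @cell_box k (fun i => cell k (tnth x i)) _ 1 isT (fun=> erefl).
    by rewrite mul1r -dyad_n.
  apply/seteqP; split => y h i; have := h i => /=.
    by move=> ->; rewrite lexx ltrDl.
  by move: (cell _ _) (cell _ _) => a b; lia.
- move=> k x; rewrite (_ : dyadic_nbhd k x = [set y | forall i,
    (cell k (tnth x i) - 1 <= cell k (tnth y i) < cell k (tnth x i) + 2)%R]).
    have e3 i : (cell k (tnth x i) + 2 = cell k (tnth x i) - 1 + 3)%R by rewrite -addrA.
    have := @cell_box k _ _ 3 isT e3.
    by rewrite exprMn -dyad_n => h; rewrite le_eqVlt; apply/orP; left; apply/eqP; exact: h.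
  apply/seteqP; split => y h i; have := h i => /=.
    by move: (cell _ _) (cell _ _) => a b; lia.
  by move: (cell _ _) (cell _ _) => a b; lia.
Qed.

Lemma edist_ge (i : 'I_n) x y : (`|tnth x i - tnth y i| <= Defs.edist x y :> R)%R.
Proof.
rewrite -sqrtr_sqr /Defs.edist ler_wsqrtr// (bigD1 i)//= lerDl.
by apply: sumr_ge0 => j _; rewrite sqr_ge0.
Qed.

Lemma measurable_edist x : measurable_fun setT (Defs.edist x).
Proof.
pose co (i : 'I_n) (y : Rn R n) : R := tnth y i.
have mS : measurable_fun setT (fun y => (\sum_(i < n) (co i x - co i y) ^+ 2)%R).
  apply: measurable_sum => i.
  have m : measurable_fun setT (fun y => (co i x - co i y)%R).
    exact: (measurable_funB (measurable_cst (co i x)) (measurable_coord i)).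
  exact: (measurable_funX 2 m).
have msq : measurable_fun setT (@Num.sqrt R).
  by apply: continuous_measurable_fun; exact: sqrt_continuous.
exact: (measurableT_comp msq mS).
Qed.

(** The single term of the least dyadic scale 2^k >= |x - y| suffices; 2^(n - alpha) comes from 2^k
    < 2 |x - y|. *)
Lemma kernel_le (alpha : R) x y : (0 < alpha < n%:R)%R ->
  ((Defs.edist x y `^ (n%:R - alpha))^-1)%:E <= (2 `^ (n%:R - alpha))%:E *
    zsum (fun k => (dyad alpha k * dyad n%:R (- k))%:E * (\1_(dyadic_nbhd k x) y)%:E).
Proof.
move=> /andP[a0 an]; have na0 : (0 < n%:R - alpha)%R by rewrite subr_gt0.
have t0 k : 0 <= (dyad alpha k * dyad n%:R (- k))%:E * (\1_(dyadic_nbhd k x) y)%:E :> \bar R.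
  by rewrite mule_ge0 ?lee_fin// mulr_ge0 ?dyad_ge0.
have e0 : (0 <= Defs.edist x y :> R)%R by exact: sqrtr_ge0.
(* On the diagonal the kernel is the inverse of 0, which is 0 by convention. *)
have [->|eN0] := eqVneq (Defs.edist x y : R) 0%R.
  rewrite powR0 ?gt_eqF// invr0 mule_ge0 ?lee_fin ?powR_ge0//.
  exact: zsum_ge0.
have ep : (0 < Defs.edist x y :> R)%R by rewrite lt_neqAle eq_sym eN0.
have [j /andP[j1 j2]] := dyad_bracket_oc (@ltr01 R) ep.
pose k := (j + 1)%R.
have xy : dyadic_nbhd k x y.
  by apply: nbhd_close => i; apply: le_trans j2; exact: edist_ge.
apply: (@le_trans _ _ ((2 `^ (n%:R - alpha))%:E * (dyad alpha k * dyad n%:R (- k))%:E)); last first.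
  rewrite lee_wpmul2l ?lee_fin ?powR_ge0//.
  apply: le_trans (zsum_ge k t0) => /=.
  by rewrite indicE mem_set// mule1.
rewrite -EFinM lee_fin dyadN -dyad_opp -dyad_split.
have -> : (alpha + - n%:R = - (1 * (n%:R - alpha)))%R by rewrite mul1r opprB.
have Dk : dyad 1 k = (2 * dyad 1 j :> R)%R by exact: dyad1S.
have j0 := dyad_gt0 (1 : R) j.
rewrite dyad_opp -dyad_powR Dk powRM ?(ltW j0)// invfM mulrA mulfV ?gt_eqF ?powR_gt0// mul1r.
rewrite lef_pV2 ?posrE ?(powR_gt0 _ ep) ?(powR_gt0 _ j0)//.
by rewrite ge0_ler_powR ?nnegrE ?(ltW na0) ?(ltW j0) ?(ltW j1).
Qed.

Lemma fractional_integral_le (alpha : R) (f : Rn R n -> \bar R) x :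
  (0 < alpha < n%:R)%R -> measurable_fun setT f ->
  `|fractional_integral alpha f x| <= (2 `^ (n%:R - alpha))%:E *
    potential mu n%:R dyadic_nbhd alpha (fun y => `|f y|) x.
Proof.
move=> an mf.
have mk : measurable_fun setT (fun y => ((Defs.edist x y `^ (n%:R - alpha))^-1)%R).
  rewrite (_ : (fun y => _) = (fun y => (Defs.edist x y `^ (- (n%:R - alpha)))%R)).
    exact: (measurableT_comp (measurable_powR _) (measurable_edist x)).
  by apply/funext => y; rewrite powRN.
apply: (kernel_potential_le dyadic_system_Rn mf mk).
- by move=> y; rewrite invr_ge0 powR_ge0.
- exact: powR_ge0.
- by move=> y; exact: kernel_le.
Qed.

End euclidean.

(** * Lorentz and Morrey-Lorentz quasi-norms *)

Section lorentz.
Local Open Scope ereal_scope.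
Context {R : realType} {n : nat}.
Local Notation mu := (@lebesgue_Rn R n).
Local Notation leb := (@lebesgue_measure R).
Implicit Types (h : Rn R n -> \bar R) (c q t V : R) (m : \bar R).

(** Read off the supremum over simple functions below the integrand, so that integrands built from
    rearrangements can be compared directly. *)
Lemma ge0_le_integral_nonmeas d (T : measurableType d)
    (nu : {measure set T -> \bar R}) (D : set T) (f g : T -> \bar R) :
  (forall x, D x -> 0 <= f x) -> (forall x, D x -> f x <= g x) ->
  \int[nu]_(x in D) f x <= \int[nu]_(x in D) g x.
Proof.
move=> f0 fg; rewrite !ge0_integralE//; last first.
  by move=> x Dx; apply: le_trans (f0 x Dx) (fg x Dx).
apply: ge_ereal_sup => _ [s hs <-]; apply: ereal_sup_ubound; exists s => // x.
apply: (le_trans (hs x)); rewrite !patchE; case: ifPn => //.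
by rewrite inE; exact: fg.
Qed.

Lemma powR_le_hat (s u v : R) : (0 <= s)%R -> (0 < u)%R -> (u <= v)%R ->
  (u `^ s <= v `^ s * hat s (u / v))%R.
Proof.
move=> s0 u0 uv; have v0 := lt_le_trans u0 uv.
rewrite -[leLHS](_ : v `^ s * (u / v) `^ s = _)%R; last first.
  by rewrite -powRM ?divr_ge0 ?(ltW u0) ?(ltW v0)// mulrC divfK// gt_eqF.
rewrite ler_wpM2l ?powR_ge0// /hat le_min lexx/= ger_powR//.
  by rewrite divr_gt0//= ler_pdivrMr// mul1r.
by rewrite -subr_ge0 opprK addr_ge0.
Qed.

(** The set of t where the rearrangement exceeds a level, up to its end point, when m is the measure
    of the superlevel set; m may be infinite. *)
Definition before m : set R := [set t | (0 < t)%R /\ t%:E < m].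

Lemma measurable_before m : measurable (before m).
Proof.
apply: is_interval_measurable => x y [x0 xm] [y0 ym] z /andP[xz zy].
split; first exact: lt_le_trans x0 xz.
by apply: le_lt_trans ym; rewrite lee_fin.
Qed.

(** For s > 0 this is m^s / s; comparability with m^s is all that is used, and dyadic shells give
    it. *)
Definition power_mass (s : R) m : \bar R := \int[leb]_(t in before m) (t `^ (s - 1))%:E.

Lemma lebesgue_shell (a : R) : (0 < a)%R -> leb `[a, (2 * a)%R[%classic = a%:E.
Proof.
move=> a0; rewrite lebesgue_measure_itv/= lte_fin ltr_pMl// ltr1n -EFinB.
by congr EFin; ring.
Qed.

Lemma measurable_pow (D : set R) (s : R) :
  measurable_fun D (fun t => (t `^ s)%:E : \bar R).
Proof. by apply: measurable_funTS; apply/measurable_EFinP; exact: measurable_powR. Qed.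

Lemma le_powR_abs (s u : R) : (1 <= u <= 2)%R -> (u `^ s <= 2 `^ `|s|)%R.
Proof.
move=> /andP[u1 u2]; have u0 : (0 < u)%R by apply: lt_le_trans u1.
apply: (@le_trans _ _ (u `^ `|s|)%R).
  by rewrite ler_powR// ler_norm.
by rewrite ge0_ler_powR ?nnegrE ?normr_ge0 ?(ltW u0).
Qed.

Lemma power_mass_le (s : R) : (0 < s)%R -> exists2 C : R, (0 < C)%R &
  forall m, 0 <= m -> power_mass s m <= C%:E * m `^ s.
Proof.
move=> s0; have [Z Z0 hZ] := zsum_hat (@ltr01 R) s0.
exists (2 `^ `|s - 1| * Z)%R; first by rewrite mulr_gt0// powR_gt0.
case=> [r r0||//]; last first.
  by rewrite poweRyr ?gt_eqF// gt0_muley ?leey// lte_fin mulr_gt0// powR_gt0.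
have [->|rN0] := eqVneq r 0%R.
  rewrite poweR0r ?gt_eqF// mule0 /power_mass (_ : before 0 = set0) ?integral_set0//.
  by apply/seteqP; split => // t []; rewrite lte_fin => /lt_trans h /h; rewrite ltxx.
have rp : (0 < r)%R by rewrite lt_neqAle eq_sym rN0.
pose S j : set R := `[dyad 1 j, (2 * dyad 1 j)%R[%classic.
have mS j : measurable (S j) by exact: measurable_itv.
pose w j : R := (if (dyad 1 j < r)%R then 2 `^ `|s - 1| * dyad (s - 1) j else 0)%R.
have w0 j : (0 <= w j)%R.
  by rewrite /w; case: ifP => // _; rewrite mulr_ge0 ?powR_ge0 ?dyad_ge0.
pose g j (t : R) : \bar R := (w j)%:E * (\1_(S j) t)%:E.
have mI j : measurable_fun setT (g j).
  by apply: measurable_funeM; apply/measurable_EFinP; exact: measurable_indic.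
have I0 j t : 0 <= g j t by rewrite /g mule_ge0 ?lee_fin.
apply: (@le_trans _ _ (\int[leb]_t zsum (g ^~ t))).
  rewrite /power_mass integral_mkcond; apply: ge0_le_integral_nonmeas => t _.
    by rewrite patchE; case: ifP => // _; rewrite lee_fin powR_ge0.
  rewrite patchE; case: ifPn => [|_]; last by apply: zsum_ge0 => j.
  rewrite inE => -[t0]; rewrite lte_fin => tr.
  have [j /andP[j1 j2]] := dyad_bracket (@ltr01 R) t0.
  apply: le_trans (zsum_ge j (fun j => I0 j t)) => /=.
  have Sj : S j t.
    by rewrite /S/= in_itv/= j1/= -dyad1S.
  rewrite /g /w (le_lt_trans j1 tr) indicE mem_set// mule1 lee_fin.
  have D0 := dyad_gt0 (1 : R) j.
  have -> : dyad (s - 1) j = (dyad 1 j `^ (s - 1))%R by rewrite dyad_powR mul1r.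
  rewrite -[leLHS](_ : (t / dyad 1 j) `^ (s - 1) * dyad 1 j `^ (s - 1) = _)%R; last first.
    by rewrite -powRM ?divr_ge0 ?(ltW t0) ?(ltW D0)// divfK// gt_eqF.
  rewrite ler_wpM2r ?powR_ge0// le_powR_abs// ler_pdivlMr// mul1r j1/=.
  by rewrite ler_pdivrMr// -dyad1S ltW.
rewrite (@integral_zsum R _ (measurableTypeR R) leb setT g measurableT mI I0).
apply: (@le_trans _ _ (zsum (fun j => (2 `^ `|s - 1| * r `^ s)%:E *
    (hat s (dyad 1 j / r))%:E))).
  apply: le_zsum => j; rewrite /g ge0_integralZl ?lee_fin//; last first.
    by apply/measurable_EFinP; apply: measurable_indic; exact: mS.
  rewrite integral_indic; [|exact: measurableT|exact: mS].
  rewrite (_ : S j `&` _ = S j); last by apply/seteqP; split => // t [].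
  rewrite [X in _ * X <= _](_ : _ = (dyad 1 j)%:E); last exact: (lebesgue_shell (dyad_gt0 1 j)).
  rewrite -!EFinM lee_fin /w.
  case: ifPn => [jr|_]; last by rewrite mul0r !mulr_ge0 ?powR_ge0 ?hat_ge0.
  rewrite -!mulrA ler_wpM2l ?powR_ge0//.
  have -> : (dyad (s - 1) j * dyad 1 j = dyad 1 j `^ s :> R)%R.
    by rewrite -dyad_split subrK dyad_powR mul1r.
  by apply: powR_le_hat; [exact: ltW s0|exact: dyad_gt0|exact: ltW jr].
rewrite zsumZl; [|by move=> j; rewrite lee_fin hat_ge0|by rewrite mulr_ge0 ?powR_ge0].
apply: le_trans (lee_wpmul2l _ (hZ _ rp)) _; first by rewrite lee_fin mulr_ge0 ?powR_ge0.
by rewrite poweR_EFin -!EFinM lee_fin mulrAC.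
Qed.

Lemma le_power_mass (s : R) : (0 < s)%R -> exists2 C : R, (0 < C)%R &
  forall m, 0 <= m -> m `^ s <= C%:E * power_mass s m.
Proof.
move=> s0; pose C := (2 `^ (`|s - 1| + s))%R.
have C0 : (0 < C)%R by exact: powR_gt0.
have fin (r : R) m : (0 < r)%R -> r%:E <= m -> (r `^ s)%:E <= C%:E * power_mass s m.
  (* The shell [r / 2, r) alone gives the lower bound; with r arbitrarily large it also settles m =
     +oo. *)
  move=> r0 rm; pose a := (r / 2)%R.
  have a0 : (0 < a)%R by rewrite divr_gt0.
  have ra : (r = 2 * a)%R by rewrite /a mulrC divfK.
  have low : ((2 `^ `|s - 1|)^-1 * a `^ (s - 1))%:E * a%:E <= power_mass s m.
    rewrite -[leLHS](_ : \int[leb]_(t in `[a, (2 * a)%R[%classic)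
        ((2 `^ `|s - 1|)^-1 * a `^ (s - 1))%:E = _); last first.
      by rewrite integral_cst//; congr (_ * _); exact: lebesgue_shell.
    apply: (@le_trans _ _ (\int[leb]_(t in `[a, (2 * a)%R[%classic) (t `^ (s - 1))%:E)).
      apply: ge0_le_integral_nonmeas => t.
        by move=> _; rewrite lee_fin mulr_ge0 ?invr_ge0 ?powR_ge0.
      rewrite /= in_itv/= => /andP[a1 a2]; have t0 := lt_le_trans a0 a1.
      rewrite lee_fin mulrC ler_pdivrMr ?powR_gt0//.
      rewrite -[leLHS](_ : t `^ (s - 1) * (t / a) `^ (- (s - 1)) = _)%R; last first.
        have ti : (t / a != 0)%R by rewrite gt_eqF// divr_gt0.
        have -> : (t `^ (s - 1) = (t / a) `^ (s - 1) * a `^ (s - 1))%R.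
          by rewrite -powRM ?(divr_ge0 (ltW t0) (ltW a0)) ?(ltW a0)// divfK// gt_eqF.
        rewrite mulrAC -powRD ?ti ?implybT//.
        by rewrite subrr powRr0 mul1r.
      rewrite ler_wpM2l ?powR_ge0// -normrN le_powR_abs// ler_pdivlMr// mul1r a1/=.
      by rewrite ler_pdivrMr// ltW.
    apply: ge0_subset_integral => //; [exact: measurable_before|exact: measurable_pow|..].
      by move=> t _; rewrite lee_fin powR_ge0.
    move=> t; rewrite /= in_itv/= => /andP[a1 a2]; split; first exact: lt_le_trans a1.
    by apply: lt_le_trans rm; rewrite lte_fin ra.
  apply: le_trans (lee_wpmul2l _ low); last by rewrite lee_fin ltW.
  rewrite -!EFinM lee_fin le_eqVlt; apply/orP; left; apply/eqP.
  rewrite ra powRM ?(ltW a0)//.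
  have -> : (a `^ s = a `^ (s - 1) * a)%R by rewrite mulrC mulr_powRB1// ltW.
  have : (2 `^ `|s - 1| != 0 :> R)%R by rewrite gt_eqF// powR_gt0.
  have : C = (2 `^ `|s - 1| * 2 `^ s)%R by rewrite /C powRD ?pnatr_eq0 ?implybT.
  by move=> -> N; rewrite -[X in _ = (_ * X)%R]mulrA mulrACA mulfV// mul1r.
exists C => // -[r r0|_|//].
  have [->|rN0] := eqVneq r 0%R.
    rewrite poweR0r ?gt_eqF// mule_ge0 ?lee_fin ?(ltW C0)//.
    by apply: integral_ge0 => t _; rewrite lee_fin powR_ge0.
  have rp : (0 < r)%R by rewrite lt_neqAle eq_sym rN0.
  by rewrite poweR_EFin; exact: fin.
rewrite poweRyr ?gt_eqF// leye_eq; apply/eqP; apply/eqyP => M M0.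
have rp : (0 < M `^ s^-1)%R by exact: powR_gt0.
have := fin _ +oo rp (leey _).
by rewrite -powRrM mulVf ?gt_eqF// powRr1// ltW.
Qed.

Local Notation dist h := (distribution_function h).

(** With [lt_rearrangement], this inverts the rearrangement. The pair is strict on one side and weak
    on the other because the rearrangement is an infimum. *)
Lemma rearrangement_lt h (l t : R) : (0 < l)%R ->
  l%:E < rearrangement h t -> t%:E < dist h l.
Proof.
move=> l0; rewrite !ltNge; apply: contra => ht.
by apply: ereal_inf_lbound; exists l.
Qed.

Lemma lt_rearrangement h (l t : R) : t%:E < dist h l -> l%:E <= rearrangement h t.
Proof.
move=> ht; apply: le_ereal_inf_tmp => _ [s [s0 hs] <-]; rewrite lee_fin.
rewrite leNgt; apply/negP => sl; move: ht; apply/negP; rewrite -leNgt.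
apply: le_trans hs; apply: le_lebesgue => x /=; apply: le_lt_trans.
by rewrite lee_fin ltW.
Qed.

Lemma rearrangement_ge0 h t : 0 <= rearrangement h t.
Proof. by apply: le_ereal_inf_tmp => _ [s [s0 _] <-]; rewrite lee_fin ltW. Qed.

Definition lorentz_index (q : R) (r : \bar R) : \bar R :=
  if r is r'%:E then (r' / q)%:E else +oo.

Local Notation absf h := (fun x => `|h x|).

Lemma dseqE h c q j : dseq mu c q (absf h) j = (dyad (c * q) j)%:E * dist h (dyad c j).
Proof. by []. Qed.

Lemma dist_ge0 h l : 0 <= dist h l.
Proof. by []. Qed.

Let kernel_eq (q r t : R) (x : \bar R) : (0 < r)%R -> (0 < t)%R -> 0 <= x ->
  ((t `^ q^-1)%:E * x) `^ r * t^-1%:E = (t `^ (r / q - 1))%:E * x `^ r.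
Proof.
move=> r0 t0 x0; rewrite poweRM ?lee_fin ?powR_ge0// poweR_EFin muleAC -EFinM.
rewrite -powRrM [(q^-1 * r)%R]mulrC -[(t^-1)%R](powR_inv1 (ltW t0)).
by rewrite -powRD// (gt_eqF t0) implybT.
Qed.

Let sum_mass h (s : R) (w : int -> R) (c : R) : (0 < s)%R -> (forall j, 0 <= w j)%R ->
  \int[leb]_(t in `]0%R, +oo[) ((t `^ (s - 1))%:E *
    zsum (fun j => (w j)%:E * (\1_(before (dist h (dyad c j))) t)%:E)) =
  zsum (fun j => (w j)%:E * power_mass s (dist h (dyad c j))).
Proof.
move=> s0 w0; pose B j := before (dist h (dyad c j)).
have mB j : measurable (B j) by exact: measurable_before.
have BI j : B j `<=` `]0%R, +oo[%classic by move=> t [t0 _]; rewrite /= in_itv/= t0.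
pose g j t := (w j)%:E * ((t `^ (s - 1))%:E * (\1_(B j) t)%:E).
have g0 j t : 0 <= g j t by rewrite !mule_ge0 ?lee_fin ?powR_ge0.
have mpI j : measurable_fun setT (fun t : R => (t `^ (s - 1))%:E * (\1_(B j) t)%:E).
  apply: emeasurable_funM; first exact: measurable_pow.
  by apply/measurable_EFinP; exact: measurable_indic.
have mg j : measurable_fun setT (g j) by exact: measurable_funeM.
transitivity (\int[leb]_(t in `]0%R, +oo[) zsum (g ^~ t)).
  apply: eq_integral => t _; rewrite -zsum_mule ?lee_fin ?powR_ge0//; last first.
    by move=> j; rewrite mule_ge0 ?lee_fin.
  by congr zsum; apply/funext => j; rewrite /g muleCA.
rewrite (@integral_zsum R _ (measurableTypeR R) leb `]0%R, +oo[%classic g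
  (measurable_itv _) (fun j => measurable_funTS (mg j)) g0).
congr zsum; apply/funext => j; rewrite /g ge0_integralZl ?lee_fin//; last 2 first.
- exact: (measurable_funTS (mpI j)).
- by move=> t _; rewrite mule_ge0 ?lee_fin ?powR_ge0.
congr (_ * _); rewrite /power_mass [RHS]integral_mkcond [LHS]integral_mkcond.
apply: eq_integral => t _; rewrite !patchE indicE -/(B j).
case: (boolP (t \in B j)) => [tB|_]; last by rewrite mule0; case: ifP.
rewrite mule1; case: ifPn => // /negP[]; rewrite inE in tB.
by rewrite mem_set//; exact: BI tB.
Qed.

(** For finite r the power of the rearrangement is expanded in dyadic layers, and each layer
    integrates to about the power r / q of its measure. For r = oo every level below the
    rearrangement at t is bounded separately. *)
Lemma lorentz_norm_le c q (r : \bar R) : (0 < c)%R -> (0 < q)%R -> 0 < r ->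
  exists2 C : R, (0 < C)%R & forall h V, (0 <= V)%R ->
  lbound (lorentz_index q r) (dseq mu c q (absf h)) V ->
  lorentz_norm q r h <= (C * V `^ q^-1)%:E.
Proof.
move=> c0 q0; have qN0 : q != 0%R by rewrite gt_eqF.
case: r => [r||//] => [|_]; last first.
  exists (2 `^ c)%R; first exact: powR_gt0.
  move=> h V V0 hV; apply: ge_ereal_sup => _ [t /= t0 <-].
  have key j : (dyad c j)%:E < rearrangement h t -> (t `^ q^-1 * dyad c j <= V `^ q^-1)%R.
    move=> /(rearrangement_lt (dyad_gt0 _ _)) tm.
    have tV : (dyad (c * q) j * t <= V)%R.
      rewrite -lee_fin EFinM; apply: le_trans (hV j).
      by rewrite dseqE lee_wpmul2l ?lee_fin ?dyad_ge0// ltW.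
    have -> : dyad c j = (dyad (c * q) j `^ q^-1)%R by rewrite dyad_powR mulfK.
    rewrite -powRM ?dyad_ge0 ?(ltW t0)// mulrC ge0_ler_powR ?nnegrE ?invr_ge0 ?(ltW q0)//.
    by rewrite mulr_ge0 ?dyad_ge0// ltW.
  have tq : (0 < t `^ q^-1)%R by exact: powR_gt0.
  case xE : (rearrangement h t) => [x||]; last first.
  - by have := rearrangement_ge0 h t; rewrite xE.
  (* An infinite rearrangement at t would exceed every dyadic level, whereas [key] bounds those it
     exceeds. *)
  - exfalso; have u0 : (0 < (V `^ q^-1 + 1) / t `^ q^-1)%R.
      by rewrite divr_gt0// ltr_wpDl ?powR_ge0.
    have [j /andP[_ j2]] := dyad_bracket c0 u0.
    have := key (j + 1)%R; rewrite xE ltry => /(_ isT); apply/negP; rewrite -ltNge.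
    move: j2; rewrite ltr_pdivrMr// mulrC; apply: lt_trans.
    by rewrite ltrDl.
  have x0 : (0 <= x)%R by rewrite -lee_fin -xE rearrangement_ge0.
  rewrite -EFinM lee_fin; have [->|xN0] := eqVneq x 0%R.
    by rewrite mulr0 mulr_ge0 ?powR_ge0.
  have xp : (0 < x)%R by rewrite lt_neqAle eq_sym xN0.
  have [j /andP[j1 j2]] := dyad_bracket_oc c0 xp.
  have := key j; rewrite xE lte_fin => /(_ j1) kj.
  apply: le_trans (ler_wpM2l (powR_ge0 2 c) kj).
  rewrite mulrCA ler_wpM2l ?powR_ge0// (le_trans j2)// dyadD mulrC.
  by rewrite ler_wpM2r ?dyad_ge0// /dyad mulr1.
rewrite lte_fin => r0; have s0 : (0 < r / q)%R by rewrite divr_gt0.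
have [A A0 hA] := power_mass_le s0.
exists ((A * 2 `^ (c * r)) `^ r^-1)%R.
  by rewrite powR_gt0// mulr_gt0// powR_gt0.
move=> h V V0 /= hV.
pose w (j : int) : R := (dyad (c * r) (j + 1) * (predT j)%:R)%R.
have w0 j : (0 <= w j)%R by rewrite mulr_ge0 ?dyad_ge0.
have key : \int[leb]_(t in `]0%R, +oo[)
    (((t `^ q^-1)%:E * rearrangement h t) `^ r * t^-1%:E) <=
    (A * 2 `^ (c * r) * V `^ (r / q))%:E.
  apply: (@le_trans _ _ (zsum (fun j => (w j)%:E * power_mass (r / q) (dist h (dyad c j))))).
    rewrite -sum_mass//; apply: ge0_le_integral_nonmeas => t; rewrite /= in_itv/= andbT => t0.
      by rewrite mule_ge0 ?poweR_ge0// lee_fin invr_ge0 ltW.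
    rewrite kernel_eq ?rearrangement_ge0// lee_wpmul2l ?lee_fin ?powR_ge0//.
    apply: (@le_trans _ _ (zsum (fun j => (w j)%:E *
        (\1_(superlevel (rearrangement h : measurableTypeR R -> \bar R) (dyad c j)) t)%:E))).
      by apply: layer_le => //; [exact: rearrangement_ge0|exists 0%R].
    apply: le_zsum => j; rewrite lee_wpmul2l ?lee_fin ?w0// !indicE ler_nat.
    case: (boolP (t \in superlevel _ _)) => //; rewrite inE /superlevel/= => hj.
    by rewrite mem_set//; split => //; apply: rearrangement_lt hj; exact: dyad_gt0.
  apply: (@le_trans _ _ (zsum (fun j => (A * 2 `^ (c * r))%:E *
      (dseq mu c q (absf h) j `^ (r / q))))).
    apply: le_zsum => j; apply: (le_trans (lee_wpmul2l _ (hA _ (dist_ge0 h _)))).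
      by rewrite lee_fin.
    rewrite dseqE poweRM ?lee_fin ?dyad_ge0// poweR_EFin dyad_powR.
    rewrite !muleA -!EFinM lee_wpmul2r ?poweR_ge0// lee_fin /w mulr1 dyadD.
    rewrite (_ : c * q * (r / q) = c * r)%R; last by field.
    rewrite [dyad (c * r) 1](_ : _ = 2 `^ (c * r))%R; last by rewrite /dyad mulr1.
    by rewrite mulrC -!mulrA [(dyad _ _ * _)%R]mulrC.
  rewrite zsumZl; [|by move=> j; exact: poweR_ge0|by rewrite mulr_ge0 ?powR_ge0// ltW].
  by rewrite [leRHS]EFinM lee_wpmul2l// lee_fin mulr_ge0 ?powR_ge0// ltW.
have i0 : 0 <= \int[leb]_(t in `]0%R, +oo[)
    (((t `^ q^-1)%:E * rearrangement h t) `^ r * t^-1%:E).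
  apply: integral_ge0 => t; rewrite /= in_itv/= andbT => t0.
  by rewrite mule_ge0 ?poweR_ge0// lee_fin invr_ge0 ltW.
have ri0 : (0 <= r^-1)%R by rewrite invr_ge0 ltW.
apply: (le_trans (le_poweR ri0 i0 key)).
rewrite poweR_EFin lee_fin powRM ?powR_ge0 ?mulr_ge0 ?powR_ge0 ?(ltW A0)//.
by rewrite -[((V `^ _) `^ _)%R]powRrM mulrAC mulfV ?mul1r// gt_eqF.
Qed.

(** Conversely, the r-th powers of the levels 2^(c j) not exceeding the rearrangement at t form a
    geometric sum dominated by its r-th power; for finite r the weights are divided by [Z] to make
    the constant 1. *)
Lemma lbound_lorentz c q (r : \bar R) : (0 < c)%R -> (0 < q)%R -> 0 < r ->
  exists2 C : R, (0 < C)%R & forall h V, (0 <= V)%R ->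
  lorentz_norm q r h <= V%:E ->
  lbound (lorentz_index q r) (dseq mu c q (absf h)) (C * V `^ q).
Proof.
move=> c0 q0; have qN0 : q != 0%R by rewrite gt_eqF.
case: r => [r||//] => [|_]; last first.
  exists 1%R => // h V V0 hV j; rewrite mul1r dseqE.
  have bound (t : R) : (0 < t)%R -> t%:E < dist h (dyad c j) -> (t * dyad (c * q) j <= V `^ q)%R.
    move=> t0 /lt_rearrangement tj.
    have : (t `^ q^-1)%:E * (dyad c j)%:E <= V%:E.
      apply: le_trans hV.
      apply: (@le_trans _ _ ((t `^ q^-1)%:E * rearrangement h t)).
        by rewrite lee_wpmul2l ?lee_fin ?powR_ge0.
      by apply: ereal_sup_ubound; exists t.
    rewrite -EFinM lee_fin => hV'.
    have a0 : (0 <= t `^ q^-1 * dyad c j)%R by rewrite mulr_ge0 ?powR_ge0 ?dyad_ge0.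
    have := ge0_ler_powR (ltW q0) a0 V0 hV'.
    by rewrite powRM ?powR_ge0 ?dyad_ge0// -powRrM mulVf// powRr1 ?(ltW t0)// dyad_powR.
  rewrite muleC -lee_pdivlMr ?dyad_gt0// leNgt; apply/negP => lt.
  (* A real t strictly in between is chosen because the measure itself may be infinite. *)
  have [t /andP[t1 t2]] : exists t : R, (V `^ q / dyad (c * q) j)%:E < t%:E < dist h (dyad c j).
    move: lt; rewrite -EFinM; case: (dist h _) => [m||//] lt.
      exists ((V `^ q / dyad (c * q) j + m) / 2)%R; rewrite !lte_fin in lt *.
      by apply/andP; split; lra.
    by exists (V `^ q / dyad (c * q) j + 1)%R; rewrite lte_fin ltrDl ltr01 ltry.
  rewrite lte_fin in t1.
  have t0 : (0 < t)%R by apply: le_lt_trans t1; rewrite divr_ge0 ?powR_ge0 ?dyad_ge0.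
  have := bound t t0 t2; apply/negP; rewrite -ltNge.
  by move: t1; rewrite ltr_pdivrMr ?dyad_gt0.
rewrite lte_fin => r0; have s0 : (0 < r / q)%R by rewrite divr_gt0.
have [A A0 hA] := le_power_mass s0.
have [Z Z0 hZ] := zsum_hat c0 r0.
exists ((A * Z) `^ (r / q)^-1)%R; first by rewrite powR_gt0// mulr_gt0.
move=> h V V0 /= hV.
have sN0 : (r / q)%R != 0%R by rewrite gt_eqF.
rewrite powRM ?powR_ge0// -!powRrM mulVf// powRr1; last by rewrite mulr_ge0 ?ltW.
have -> : (q * (r / q) = r)%R by field.
have i0 : 0 <= \int[leb]_(t in `]0%R, +oo[)
    (((t `^ q^-1)%:E * rearrangement h t) `^ r * t^-1%:E).
  apply: integral_ge0 => t; rewrite /= in_itv/= andbT => t0.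
  by rewrite mule_ge0 ?poweR_ge0// lee_fin invr_ge0 ltW.
have key : \int[leb]_(t in `]0%R, +oo[)
    (((t `^ q^-1)%:E * rearrangement h t) `^ r * t^-1%:E) <= (V `^ r)%:E.
  have := le_poweR (ltW r0) (poweR_ge0 _ _) hV.
  by rewrite -poweRrM mulVf ?gt_eqF// poweRe1.
apply: (@le_trans _ _ (A%:E * (Z%:E * (V `^ r)%:E))); last first.
  by rewrite -!EFinM lee_fin mulrA.
pose w (j : int) : R := (dyad (c * r) j / Z)%R.
have w0 j : (0 <= w j)%R by rewrite divr_ge0 ?dyad_ge0// ltW.
have pm0 m : 0 <= power_mass (r / q) m.
  by apply: integral_ge0 => t _; rewrite lee_fin powR_ge0.
apply: (@le_trans _ _ (A%:E * (Z%:E * zsum (fun j => (w j)%:E * power_mass (r / q) (dist h (dyad c j)))))).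
  have wp0 j : 0 <= (w j)%:E * power_mass (r / q) (dist h (dyad c j)).
    by apply: mule_ge0; [rewrite lee_fin|exact: pm0].
  have zwp0 j : 0 <= Z%:E * ((w j)%:E * power_mass (r / q) (dist h (dyad c j))).
    by apply: mule_ge0 => //; rewrite lee_fin ltW.
  rewrite -(zsumZl wp0 (ltW Z0)) -(zsumZl zwp0 (ltW A0)).
  apply: le_zsum => j; rewrite dseqE poweRM ?lee_fin ?dyad_ge0// poweR_EFin dyad_powR.
  rewrite (_ : c * q * (r / q) = c * r)%R; last by field.
  rewrite [Z%:E * _]muleA -EFinM (_ : Z * w j = dyad (c * r) j)%R; last first.
    by rewrite /w mulrC divfK// gt_eqF.
  by rewrite muleCA lee_wpmul2l ?lee_fin ?dyad_ge0// hA.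
rewrite !lee_wpmul2l ?lee_fin ?(ltW A0) ?(ltW Z0)//.
apply: le_trans key; rewrite -sum_mass//.
apply: ge0_le_integral_nonmeas => t; rewrite /= in_itv/= andbT => t0.
  by rewrite mule_ge0 ?lee_fin ?powR_ge0//; apply: zsum_ge0 => j; rewrite mule_ge0 ?lee_fin.
rewrite kernel_eq ?rearrangement_ge0// lee_wpmul2l ?lee_fin ?powR_ge0//.
have zE : zsum (fun j => (w j)%:E * (\1_(before (dist h (dyad c j))) t)%:E) <=
    zsum (fun j => (w j * ((dyad c j)%:E <= rearrangement h t)%E%:R)%:E).
  apply: le_zsum => j; rewrite -EFinM lee_fin ler_wpM2l// indicE ler_nat.
  case: (boolP (t \in before _)) => //; rewrite inE => -[_ tj].
  by rewrite (lt_rearrangement tj).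
apply: (le_trans zE); move: zE => _.
case xE : (rearrangement h t) => [x||]; last first.
- by have := rearrangement_ge0 h t; rewrite xE.
- by rewrite poweRyr ?gt_eqF// leey.
have x0 : (0 <= x)%R by rewrite -lee_fin -xE rearrangement_ge0.
have [->|xN0] := eqVneq x 0%R.
  rewrite poweR0r ?gt_eqF// (_ : (fun _ => _) = (fun=> 0)).
    by rewrite /zsum esum1.
  by apply/funext => j; rewrite lee_fin leNgt dyad_gt0 mulr0.
have xp : (0 < x)%R by rewrite lt_neqAle eq_sym xN0.
apply: (@le_trans _ _ (zsum (fun j => (x `^ r / Z)%:E * (hat r (dyad c j / x))%:E))).
  apply: le_zsum => j; rewrite -EFinM !lee_fin /w.
  have [jx|_] := leP (dyad c j) x; last by rewrite mulr0 mulr_ge0 ?hat_ge0// divr_ge0 ?powR_ge0// ltW.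
  rewrite mulr1 mulrAC ler_wpM2r ?invr_ge0 ?(ltW Z0)//.
  by rewrite -dyad_powR; exact: (powR_le_hat (ltW r0) (dyad_gt0 c j) jx).
rewrite zsumZl; [|by move=> j; rewrite lee_fin hat_ge0|by rewrite divr_ge0 ?powR_ge0// ltW].
apply: le_trans (lee_wpmul2l _ (hZ _ xp)) _; first by rewrite lee_fin divr_ge0 ?powR_ge0// ltW.
by rewrite -EFinM poweR_EFin divfK// gt_eqF.
Qed.

End lorentz.

(** * From cubes to dyadic neighbourhoods and back *)

Section morrey_lorentz_link.
Local Open Scope ereal_scope.
Context {R : realType} {n : nat}.
Local Notation mu := (@lebesgue_Rn R n).
Local Notation leb := (@lebesgue_measure R).
Local Notation nbhd := (@dyadic_nbhd R n).
Local Notation absf h := (fun x => `|h x|).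
Implicit Types (h : Rn R n -> \bar R) (c q t W : R) (k : int) (a x : Rn R n).

Lemma rearrangement_scale_le h c t : (0 < c)%R ->
  rearrangement (fun x => c%:E * h x) t <= c%:E * rearrangement h t.
Proof.
move=> c0; rewrite -lee_pdivrMl//; apply: le_ereal_inf_tmp => _ [s [s0 hs] <-].
rewrite lee_pdivrMl// -EFinM; apply: ereal_inf_lbound.
exists (c * s)%R => //; split; first by rewrite mulr_gt0.
rewrite [leLHS](_ : _ = distribution_function h s)//; congr (mu _).
apply/funext => x /=; apply/propext.
suff -> : ((c * s)%:E < `|c%:E * h x|) = (s%:E < `|h x|) by [].
by rewrite abseM gee0_abs ?lee_fin ?(ltW c0)// EFinM lte_pmul2l.
Qed.

Lemma measurable_rearrangement h (D : set R) :
  measurable_fun D (rearrangement h : R -> \bar R).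
Proof.
apply: measurable_funTS; apply: (measurability _ (ErealGenCInfty.measurableE R)).
move=> _ [_ [y ->] <-]; rewrite setTI; apply: is_interval_measurable.
have mono (s t : R) : (s <= t)%R -> rearrangement h t <= rearrangement h s.
  move=> st; apply: ereal_inf_le_tmp => _ [u [u0 hu] <-]; exists u => //.
  by split=> //; apply: le_trans hu _; rewrite lee_fin.
move=> s t /=; rewrite !in_itv/= !andbT => _ yt u /andP[_ ut].
by rewrite in_itv/= andbT (le_trans yt)// mono.
Qed.

Lemma lorentz_norm_ge0 q (r : \bar R) h : 0 < r -> 0 <= lorentz_norm q r h.
Proof.
case: r => [r||//] _; first exact: poweR_ge0.
apply: (@le_trans _ _ ((1 `^ q^-1)%:E * rearrangement h 1%R)).
  by rewrite mule_ge0 ?lee_fin ?powR_ge0// rearrangement_ge0.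
by apply: ereal_sup_ubound; exists 1%R => //=; exact: ltr01.
Qed.

Lemma lorentz_norm_scale_le c q (r : \bar R) h : (0 < c)%R -> 0 < r ->
  lorentz_norm q r (fun x => c%:E * h x) <= c%:E * lorentz_norm q r h.
Proof.
move=> c0; case: r => [r||//] r0; last first.
  apply: ge_ereal_sup => _ [t /= t0 <-].
  apply: (@le_trans _ _ (c%:E * ((t `^ q^-1)%:E * rearrangement h t))).
    by rewrite muleCA lee_wpmul2l ?lee_fin ?powR_ge0// rearrangement_scale_le.
  by rewrite lee_wpmul2l ?lee_fin ?(ltW c0)//; apply: ereal_sup_ubound; exists t.
rewrite lte_fin in r0.
pose u h t := ((t `^ q^-1)%:E * rearrangement h t) `^ r * t^-1%:E.
have u0 h' t : (0 < t)%R -> 0 <= u h' t.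
  by move=> t0; rewrite mule_ge0 ?poweR_ge0// lee_fin invr_ge0 ltW.
have mu' : measurable_fun (`]0%R, +oo[%classic : set R) (u h).
  apply: emeasurable_funM.
    apply: measurableT_comp (measurable_poweR r) _.
    by apply: emeasurable_funM; [exact: measurable_pow|exact: measurable_rearrangement].
  apply/measurable_EFinP; apply: (eq_measurable_fun (fun t : R => t `^ (-1))%R).
    by move=> t; rewrite inE/= in_itv/= andbT => t0; rewrite powR_inv1// ltW.
  by apply: measurable_funTS; exact: measurable_powR.
have I0 h' : 0 <= \int[leb]_(t in `]0%R, +oo[) u h' t.
  by apply: integral_ge0 => t; rewrite /= in_itv/= andbT; exact: u0.
have key : \int[leb]_(t in `]0%R, +oo[) u (fun x => c%:E * h x) t <=
    (c `^ r)%:E * \int[leb]_(t in `]0%R, +oo[) u h t.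
  have cr0 : 0 <= (c `^ r)%:E by rewrite lee_fin powR_ge0.
  rewrite -ge0_integralZl//; last first.
    by move=> t; rewrite /= in_itv/= andbT; exact: u0.
  apply: ge0_le_integral_nonmeas => t; rewrite /= in_itv/= andbT => t0; first exact: u0.
  rewrite /u muleA lee_wpmul2r ?lee_fin ?invr_ge0 ?(ltW t0)//.
  rewrite -(poweR_EFin c r) -poweRM ?lee_fin ?(ltW c0)//; last first.
    by rewrite mule_ge0 ?rearrangement_ge0// lee_fin powR_ge0.
  rewrite le_poweR ?(ltW r0)//; first by rewrite mule_ge0 ?rearrangement_ge0// lee_fin powR_ge0.
  by rewrite muleCA lee_wpmul2l ?lee_fin ?powR_ge0// rearrangement_scale_le.
have ri0 : (0 <= r^-1)%R by rewrite invr_ge0 ltW.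
apply: (le_trans (le_poweR ri0 (I0 _) key)).
rewrite poweRM ?lee_fin ?powR_ge0// poweR_EFin -powRrM mulfV ?gt_eqF// powRr1 ?(ltW c0)//.
Qed.

Lemma morrey_lorentz_norm_ge0 p q (r : \bar R) h : 0 < r -> 0 <= morrey_lorentz_norm p q r h.
Proof.
move=> r0; pose Q := cube ([tuple 0%R | i < n] : Rn R n) 1%R.
apply: (@le_trans _ _ (mu Q `^ (p^-1 - q^-1) *
    lorentz_norm q r (fun x => h x * charfun Q x))).
  by rewrite mule_ge0 ?poweR_ge0// lorentz_norm_ge0.
apply: ereal_sup_ubound; exists Q => //.
by exists [tuple 0%R | i < n], 1%R.
Qed.

Lemma morrey_lorentz_norm_scale_le c p q (r : \bar R) h : (0 < c)%R -> 0 < r ->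
  morrey_lorentz_norm p q r (fun x => c%:E * h x) <= c%:E * morrey_lorentz_norm p q r h.
Proof.
move=> c0 r0; apply: ge_ereal_sup => _ [Q hQ <-].
apply: (@le_trans _ _ (c%:E * (mu Q `^ (p^-1 - q^-1) *
    lorentz_norm q r (fun x => h x * charfun Q x)))); last first.
  by rewrite lee_wpmul2l ?lee_fin ?(ltW c0)//; apply: ereal_sup_ubound; exists Q.
rewrite muleCA lee_wpmul2l ?poweR_ge0//.
rewrite (_ : (fun x => _ * _ * _) = (fun x => c%:E * (h x * charfun Q x))).
  exact: lorentz_norm_scale_le.
by apply/funext => x; rewrite muleA.
Qed.

Lemma nbhd_sub_cube k x : exists a, dyadic_nbhd k x `<=` cube a (3 * dyad 1 k).
Proof.
exists [tuple ((cell k (tnth x i) - 1)%:~R * dyad 1 k)%R | i < n] => y xy i.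
have D0 : (0 < dyad 1 k :> R)%R by exact: dyad_gt0.
have hy := cell_itv k (tnth y i) (cell k (tnth x i) - 1) (cell k (tnth x i) + 2).
have c1 : (cell k (tnth x i) - 1 <= cell k (tnth y i) < cell k (tnth x i) + 2)%R.
  have := xy i; move: (cell k (tnth x i)) (cell k (tnth y i)) => c1 c2; lia.
rewrite c1 in hy; move/esym/andP : hy => [y1 y2].
rewrite tnth_mktuple y1/= (le_trans (ltW y2))// -mulrDl ler_wpM2r ?(ltW D0)//.
by rewrite !intrD -!addrA lerD2l; lra.
Qed.

Lemma dseq_le c p h (v : Rn R n -> \bar R) j : (forall x, `|h x| <= v x) ->
  dseq mu c p (absf h) j <= dseq mu c p v j.
Proof.
move=> hv; apply: lee_wpmul2l; first by rewrite lee_fin dyad_ge0.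
by apply: le_lebesgue => x; rewrite /superlevel/= => /lt_le_trans; exact.
Qed.

Lemma morrey_lorentz_dseq c p p0 (r : \bar R) : (0 < c)%R -> (0 < p <= p0)%R -> 0 < r ->
  exists2 C : R, (0 < C)%R & forall h W, (0 <= W)%R ->
  morrey_lorentz_norm p0 p r h <= W%:E ->
  morrey_lbound mu n%:R nbhd (lorentz_index p r) c p p0 (absf h) (C * W `^ p).
Proof.
move=> c0 /andP[p_gt0 pp] r0; have p00 : (0 < p0)%R by apply: lt_le_trans pp.
have [C C0 hC] := lbound_lorentz (n := n) c0 p_gt0 r0.
exists (C * dyad (n%:R * (1 - p / p0)) 2)%R; first by rewrite mulr_gt0 ?dyad_gt0.
move=> h W W0 hW k x; have [a aQ] := nbhd_sub_cube k x.
have D0 : (0 < dyad 1 k :> R)%R by exact: dyad_gt0.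
have l0 : (0 < 3 * dyad 1 k :> R)%R by rewrite mulr_gt0.
pose e := (p^-1 - p0^-1 : R)%R.
have e0 : (0 <= e)%R by rewrite subr_ge0 lef_pV2.
set Q := cube a (3 * dyad 1 k)%R in aQ.
have muQ : mu Q = ((3 * dyad 1 k) ^+ n)%:E by exact: lebesgue_cube.
(* Here 3 * 2^k <= 2^(k + 2), and the exponent 1/p - 1/p0 is nonnegative; hence the index 2 in the
   constant. *)
have muQ_le : (((3 * dyad 1 k) ^+ n) `^ e <= dyad (n%:R * e) (k + 2) :> R)%R.
  rewrite -dyad_powR ge0_ler_powR ?nnegrE ?dyad_ge0 ?exprn_ge0 ?(ltW l0)// dyad_n.
  rewrite lerXn2r ?nnegrE ?dyad_ge0 ?(ltW l0)// dyadD mulrC ler_wpM2l ?(ltW D0)//.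
  by rewrite /dyad mul1r -[2%:~R]/(2%:R) powR_mulrn//; lra.
have m0 : (0 < ((3 * dyad 1 k) ^+ n) `^ e :> R)%R by rewrite powR_gt0 ?exprn_gt0.
pose V := (W * dyad (n%:R * e) (k + 2))%R.
have V0 : (0 <= V)%R by rewrite mulr_ge0 ?dyad_ge0.
have hV : lorentz_norm p r (fun x => h x * charfun Q x) <= V%:E.
  apply: (@le_trans _ _ (W * ((3 * dyad 1 k) ^+ n) `^ e)%:E); last first.
    by rewrite lee_fin ler_wpM2l.
  rewrite EFinM muleC -lee_pdivrMl// -powRN opprB.
  apply: le_trans hW; apply: ereal_sup_ubound; exists Q; first by exists a, (3 * dyad 1 k)%R.
  by rewrite muQ poweR_EFin.
have si0 : 0 < lorentz_index p r.
  by case: r r0 {hC hW hV} => [r||]//=; rewrite !lte_fin => r0; rewrite divr_gt0.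
apply: (lbound_le (b := dseq mu c p (absf (fun x => h x * charfun Q x)))
  (A := (C * V `^ p)%R)) => //.
- rewrite mulr_ge0 ?powR_ge0 ?(ltW C0)//= /V powRM ?dyad_ge0// dyad_powR.
  rewrite -[(_ * e * p)%R]mulrA (_ : e * p = 1 - p / p0)%R; last first.
    by rewrite /e mulrBl mulVf ?gt_eqF// mulrC.
  move: (n%:R * _)%R => s; rewrite dyadD le_eqVlt; apply/orP; left; apply/eqP.
  by move: (dyad s k) (dyad s 2) (W `^ p)%R => y z w; ring.
- by move=> j; exact: dseq_ge0.
- move=> j; apply: lee_wpmul2l; first by rewrite lee_fin dyad_ge0.
  apply: le_lebesgue => y; have lj := dyad_ge0 c j : (0 <= dyad c j :> R)%R.
  rewrite (superlevel_cutoff _ _ lj) => -[/aQ Qy hy].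
  by rewrite /superlevel/= /charfun indicE mem_set// mule1.
- exact: hC.
Qed.

(** A cube of side at most 2^(k + 1) lies in the neighbourhood of its corner at that scale. Here h
    is merely dominated by v, which lets the fractional integral enter through its pointwise
    bound. *)
Lemma morrey_lorentz_norm_le c p p0 (r : \bar R) : (0 < c)%R -> (0 < p <= p0)%R -> 0 < r ->
  exists2 C : R, (0 < C)%R & forall h v B, (0 <= B)%R -> (forall x, `|h x| <= v x) ->
  morrey_lbound mu n%:R nbhd (lorentz_index p r) c p p0 v B ->
  morrey_lorentz_norm p0 p r h <= (C * B `^ p^-1)%:E.
Proof.
move=> c0 /andP[p_gt0 pp] r0; have p00 : (0 < p0)%R by apply: lt_le_trans pp.
have [C C0 hC] := lorentz_norm_le (n := n) c0 p_gt0 r0.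
pose e := (n%:R * (p^-1 - p0^-1) : R)%R.
have pi : (p0^-1 <= p^-1)%R by rewrite lef_pV2.
exists (C * dyad e 1)%R; first by rewrite mulr_gt0 ?dyad_gt0.
move=> h v B B0 hv vB; apply: ge_ereal_sup => _ [Q [a [l [l0 ->]]] <-].
have [k /andP[k1 k2]] := dyad_bracket_oc (@ltr01 R) l0.
have D0 : (0 < dyad 1 k :> R)%R by exact: dyad_gt0.
have QN : cube a l `<=` dyadic_nbhd (k + 1)%R a.
  move=> y ya; apply: nbhd_close => i; have /andP[y1 y2] := ya i.
  rewrite distrC ger0_norm ?subr_ge0//; apply: le_trans k2.
  by rewrite lerBlDl.
have si0 : 0 < lorentz_index p r.
  by case: r r0 {hC vB} => [r||]//=; rewrite !lte_fin => r0; rewrite divr_gt0.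
set X := (B * dyad (n%:R * (1 - p / p0)) (k + 1))%R.
have X0 : (0 <= X)%R by rewrite mulr_ge0 ?dyad_ge0.
have hX : lorentz_norm p r (fun x => h x * charfun (cube a l) x) <= (C * X `^ p^-1)%:E.
  apply: hC => //; apply: (lbound_le _ _ _ _ (vB (k + 1)%R a)) => //.
  - by rewrite X0 lexx.
  - by move=> j; exact: dseq_ge0.
  - move=> j; apply: dseq_le => y; rewrite abseM.
    have [Qy|Qy] := pselect (cube a l y).
      rewrite cutoffT; last exact: QN.
      by rewrite /charfun indicE mem_set// abse1 mule1.
    rewrite /charfun indicE memNset// abse0 mule0 cutoff_ge0// => z.
    by apply: le_trans (hv z).
rewrite lebesgue_cube// poweR_EFin.
have ln0 : (0 < l ^+ n)%R by exact: exprn_gt0.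
apply: (le_trans (lee_wpmul2l _ hX)); first by rewrite lee_fin powR_ge0.
have lk : (dyad e k <= (l ^+ n) `^ (p^-1 - p0^-1))%R.
  rewrite /e -dyad_powR ge0_ler_powR ?nnegrE ?dyad_ge0 ?(ltW ln0) ?subr_ge0//.
  by rewrite dyad_n lerXn2r ?nnegrE ?(ltW D0) ?(ltW l0) ?(ltW k1).
have ek0 := dyad_gt0 e k.
rewrite -EFinM lee_fin -opprB powRN mulrC ler_pdivrMr; last exact: lt_le_trans lk.
have -> : (X `^ p^-1 = B `^ p^-1 * (dyad e 1 * dyad e k))%R.
  rewrite /X powRM ?dyad_ge0// dyad_powR (_ : _ / p = e)%R; last first.
    by rewrite /e; field; rewrite (gt_eqF p00) (gt_eqF p_gt0).
  by rewrite dyadD [(dyad e k * _)%R]mulrC.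
have c0' : (0 <= C * dyad e 1 * B `^ p^-1)%R.
  by rewrite !mulr_ge0 ?powR_ge0 ?dyad_ge0 ?(ltW C0).
apply: le_trans (ler_wpM2l c0' lk); rewrite le_eqVlt; apply/orP; left; apply/eqP.
by move: (dyad e 1) (dyad e k) (B `^ _)%R => y z w; ring.
Qed.

(** The indicator of the set where |h| > l has Morrey norm at most 1 / l, and one term of its dyadic
    sequence is the measure estimate sought. *)
Lemma weak_morrey_norm_bound p p0 : (0 < p <= p0)%R ->
  exists2 B : R, (0 < B)%R & forall h, weak_morrey_norm p0 p h <= 1 ->
  weak_morrey_bound mu n%:R (3 ^+ n) nbhd (absf h) p p0 B.
Proof.
move=> pp0; have /andP[p_gt0 pp] := pp0; have p00 : (0 < p0)%R by apply: lt_le_trans pp.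
have p0e : 0 < p%:E by rewrite lte_fin.
have [C C0 hC] := morrey_lorentz_dseq (@ltr01 R) pp0 p0e.
exists (((2 `^ p) * C / 3 ^+ n) `^ p^-1)%R.
  by rewrite powR_gt0// divr_gt0 ?exprn_gt0// mulr_gt0// powR_gt0.
move=> h h1 k x; split; first exact: (measure_nbhd (dyadic_system_Rn n)).
move=> l l0; pose E := [set y | l%:E < `|h y|].
have hE : morrey_lorentz_norm p0 p p%:E (charfun E) <= (l^-1)%:E.
  rewrite -[leRHS]mule1 lee_pdivlMl//.
  by apply: le_trans h1; apply: ereal_sup_ubound; exists l.
have li0 : (0 <= l^-1)%R by rewrite invr_ge0 ltW.
have hk := hC _ _ li0 hE k x.
have idx : 0 < lorentz_index p p%:E by rewrite /= lte_fin divff ?ltr01// gt_eqF.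
have b0 : (0 <= C * l^-1 `^ p * dyad (n%:R * (1 - p / p0)) k)%R.
  by rewrite !mulr_ge0 ?powR_ge0 ?dyad_ge0 ?(ltW C0).
(* As superlevel sets are strict, the indicator is tested at level 1/2 and not at 1; this is the
   source of 2^p in the constant. *)
have := lbound_term (-1)%R idx b0 (dseq_ge0 _ _ _ _) hk; rewrite /dseq mul1r.
have sub : nbhd k x `&` superlevel (absf h) l `<=`
    superlevel (cutoff (nbhd k x) (absf (charfun E))) (dyad 1 (-1)).
  rewrite superlevel_cutoff ?dyad_ge0// => y [Ny hy]; split => //.
  rewrite /superlevel/= /charfun indicE mem_set//= normr1 lte_fin dyadN.
  by rewrite /dyad mulr1 powRr1// invf_lt1// ltr1n.
have D1 : (dyad p (-1) = (2 `^ p)^-1 :> R)%R by rewrite dyadN /dyad mulr1.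
move=> h2; have := le_trans (lee_wpmul2l _ (le_lebesgue sub)) h2.
rewrite D1 lee_fin invr_ge0 powR_ge0 => /(_ isT).
rewrite -lee_pdivlMl ?invr_gt0 ?powR_gt0// invrK -EFinM => /le_trans; apply.
rewrite lee_fin powRM ?mulr_ge0 ?powR_ge0 ?dyad_ge0// powRM ?powR_ge0 ?dyad_ge0//.
rewrite -[((_ / _) `^ _ `^ _)%R]powRrM mulVf ?gt_eqF// powRr1; last first.
  by rewrite divr_ge0 ?exprn_ge0// mulr_ge0 ?powR_ge0// ltW.
rewrite dyad_powR (_ : n%:R * (1 - p / p0) = n%:R + - (n%:R / p0) * p)%R; last first.
  by rewrite mulrBr mulr1 mulNr mulrA mulrAC.
rewrite dyad_split le_eqVlt; apply/orP; left; apply/eqP.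
have t0 : (3 ^+ n != 0 :> R)%R by rewrite expf_neq0.
move: (3 ^+ n)%R (dyad _ k) (dyad _ k) (l^-1 `^ p)%R (2 `^ p)%R t0 => t y z w v t0.
by field.
Qed.

Lemma weak_morrey_norm_ge0 p q h : (0 < q)%R -> 0 <= weak_morrey_norm p q h.
Proof.
move=> q0; have q0e : 0 < q%:E by rewrite lte_fin.
apply: (@le_trans _ _ (1%:E * morrey_norm p q (charfun [set x | 1%:E < `|h x|]))).
  by rewrite mul1e; exact: morrey_lorentz_norm_ge0.
by apply: ereal_sup_ubound; exists 1%R => //=; exact: ltr01.
Qed.

Lemma weak_morrey_norm_scale_le c p q h : (0 < c)%R ->
  weak_morrey_norm p q (fun x => c%:E * h x) <= c%:E * weak_morrey_norm p q h.
Proof.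
move=> c0; apply: ge_ereal_sup => _ [s /= s0 <-].
apply: (@le_trans _ _ (c%:E * ((s / c)%:E *
    morrey_norm p q (charfun [set x | (s / c)%:E < `|h x|])))); last first.
  rewrite lee_wpmul2l ?lee_fin ?(ltW c0)//; apply: ereal_sup_ubound.
  by exists (s / c)%R => //=; exact: divr_gt0.
have -> : [set x | s%:E < `|c%:E * h x|] = [set x | (s / c)%:E < `|h x|].
  apply/funext => x /=; apply/propext.
  suff -> : (s%:E < `|c%:E * h x|) = ((s / c)%:E < `|h x|) by [].
  by rewrite abseM gee0_abs ?lee_fin ?(ltW c0)// mulrC EFinM lte_pdivrMl.
have cs : (c * (s / c) = s)%R by rewrite mulrC divfK// gt_eqF.
by rewrite muleA -EFinM cs; exact: lexx.
Qed.

End morrey_lorentz_link.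

(** * Normalisation and choice of exponents *)

Lemma le_mul_approx (R : realType) (X : \bar R) (C a b : R) :
  0 <= C -> 0 <= a -> 0 <= b ->
  (forall e, 0 < e -> (X <= (C * (a + e) * (b + e))%:E)%E) -> (X <= (C * a * b)%:E)%E.
Proof.
move=> C0 a0 b0 h; apply/lee_addgt0Pr => d d0.
have D0 : 0 < (C + 1) * (a + b + 1) by rewrite mulr_gt0//; lra.
pose e := Num.min 1 (d / ((C + 1) * (a + b + 1))).
have e0 : 0 < e by rewrite lt_min ltr01 divr_gt0.
have e1 : e <= 1 by rewrite ge_min lexx.
have ed : e * ((C + 1) * (a + b + 1)) <= d by rewrite -ler_pdivlMr// ge_min lexx orbT.
apply: le_trans (h e e0) _; rewrite -EFinD lee_fin.
have Ce0 : 0 <= C * e by rewrite mulr_ge0// ltW.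
have h1 : C * e * (a + b + e) <= C * e * (a + b + 1) by rewrite ler_wpM2l// lerD2l.
have h2 : 0 <= e * (a + b + 1) by rewrite mulr_ge0 ?(ltW e0)// !addr_ge0.
apply: le_trans (_ : C * a * b + e * ((C + 1) * (a + b + 1)) <= _); last by rewrite lerD2l.
apply: le_trans (_ : C * a * b + C * e * (a + b + 1) <= _).
  by rewrite [leLHS](_ : _ = C * a * b + C * e * (a + b + e)) ?lerD2l//; ring.
by rewrite lerD2l -subr_ge0 (_ : _ - _ = e * (a + b + 1))//; ring.
Qed.

(** In both alternatives the sequence index is the same for source and target, so a single sigma
    runs through the dyadic argument. *)
Lemma lorentz_index_eq (R : realType) (p1 r1 : R) (p2 r2 : \bar R) : 0 < p1 -> 0 < r1 ->
  (0 < r2 < +oo)%E /\ (0 < p2 < +oo)%E /\ r1 / p1 = fine r2 / fine p2 \/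
  r2 = +oo%E /\ p2 = +oo%E ->
  lorentz_index p1 p2 = lorentz_index r1 r2.
Proof.
move=> p10 r10 [[r2b [p2b rp]]|[-> ->//]].
case: r2 r2b rp => [r2||] => [_|/andP[]//|/andP[]//].
case: p2 p2b => [p2||] => [|/andP[]//|/andP[]//].
rewrite /= lte_fin => /andP[p20 _] rp; congr EFin.
have -> : r2 = r1 / p1 * p2 by rewrite rp divfK// gt_eqF.
by field; rewrite !gt_eqF.
Qed.


Theorem theorem6p1 (R : realType) (n : nat)
    (alpha p0 p1 q0 q1 r0 r1 : R) (p2 r2 : \bar R) :
  0 < alpha < n%:R ->
  1 < p1 <= p0 -> (0 < p2)%E ->
  1 < q1 <= q0 ->
  1 < r1 <= r0 -> (1 < r2)%E ->
  r1 < q1 ->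
  q0^-1 <= alpha / n%:R < p0^-1 ->
  r0^-1 = q0^-1 + p0^-1 - alpha / n%:R ->
  ((0 < r2 < +oo)%E /\ (0 < p2 < +oo)%E /\
     r0 / p0 = r1 / p1 /\ r1 / p1 = fine r2 / fine p2) \/
  (r2 = +oo%E /\ p2 = +oo%E /\ r0 / p0 = r1 / p1) ->
  exists C : R, 0 < C /\
    forall f g : Rn R n -> \bar R,
      morrey_lorentz p0 p1 p2 f -> weak_morrey q0 q1 g ->
      (morrey_lorentz_norm r0 r1 r2
         (fun x => g x * fractional_integral alpha f x)
       <= C%:E * weak_morrey_norm q0 q1 g * morrey_lorentz_norm p0 p1 p2 f)%E.
Proof.
move=> an /andP[p11 pp0] p20 /andP[q11 qq0] /andP[r11 rr0] r21 rq /andP[qa ap] r0E cases.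
have /andP[alpha0 alphan] := an.
have n0 : 0 < n%:R :> R by exact: lt_trans alphan.
have p1_gt0 : 0 < p1 by exact: lt_trans p11.
have q1_gt0 : 0 < q1 by exact: lt_trans q11.
have r1_gt0 : 0 < r1 by exact: lt_trans r11.
have p0_gt0 : 0 < p0 by exact: lt_le_trans pp0.
have q0_gt0 : 0 < q0 by exact: lt_le_trans qq0.
have r0_gt0 : 0 < r0 by exact: lt_le_trans rr0.
have r20 : (0 < r2)%E by apply: lt_trans r21; rewrite lte_fin.
have rpE : r0 / p0 = r1 / p1 by case: cases => [[_ [_ []]]|[_ []]].
have idxE : lorentz_index p1 p2 = lorentz_index r1 r2.
  apply: lorentz_index_eq => //.
  by case: cases => [[r2b [p2b [_ h]]]|[-> [-> _]]]; [left|right].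
have idx0 : (0 < lorentz_index p1 p2)%E.
  by case: p2 p20 {cases idxE} => [p2||]//=; rewrite !lte_fin => p20; rewrite divr_gt0.
have naE : n%:R / r0 = n%:R / q0 + n%:R / p0 - alpha.
  by rewrite r0E mulrBr mulrDr mulrCA divff ?mulr1// gt_eqF.
pose theta := p0 / r0.
have theta0 : 0 < theta by rewrite divr_gt0.
(* This is 1/q0 <= alpha/n, with theta = 1 in the case of equality. *)
have theta1 : theta <= 1.
  by rewrite ler_pdivrMr// mul1r -lef_pV2// r0E; lra.
have thr : r1 * theta = p1.
  have -> : r1 = r0 / p0 * p1 by rewrite rpE divfK// gt_eqF.
  by rewrite /theta; field; rewrite !gt_eqF.
(* The relation defining r0 says exactly that interpolation lowers the order alpha to n / q0. *)
have gap : alpha - n%:R / p0 * (1 - theta) = n%:R / q0.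
  have -> : n%:R / p0 * (1 - theta) = n%:R / p0 - n%:R / r0.
    by rewrite /theta; field; rewrite !gt_eqF.
  by rewrite naE; ring.
(* This is alpha/n < 1/p0; strictness gives the convergence over far scales. *)
have qr : n%:R / q0 < n%:R / r0.
  by rewrite ltr_pM2l// r0E; lra.
have pp : 0 < p1 <= p0 by rewrite p1_gt0.
have qq : 0 < q1 <= q0 by rewrite q1_gt0.
have rr : 0 < r1 <= r0 by rewrite r1_gt0.
have ti0 : 0 < theta^-1 by rewrite invr_gt0.
have [B1 B10 hB1] := weak_morrey_norm_bound (R := R) (n := n) qq.
have [B2 B20 hB2] := morrey_lorentz_dseq (R := R) (n := n) ti0 pp p20.
have K0 : 0 < 3 ^+ n :> R by rewrite exprn_gt0.
have th : 0 < theta <= 1 by rewrite theta0.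
have [C C0 hC] := olsen_dyadic (dyadic_system_Rn n) K0 idx0 n0 p0_gt0 p11 q0_gt0 r11 rq
  th erefl thr gap qr B10 B20.
have [Co Co0 hCo] := morrey_lorentz_norm_le (R := R) (n := n) ltr01 rr r20.
pose M : R := 2 `^ (n%:R - alpha).
have M0 : 0 < M by exact: powR_gt0.
have Cr0 : 0 < C `^ r1^-1 by exact: powR_gt0.
exists (M * (Co * C `^ r1^-1)); split; first by rewrite !mulr_gt0.
move=> f g [mf ffin] [mg gfin].
have A0 := weak_morrey_norm_ge0 q0 g q1_gt0.
have D0 := morrey_lorentz_norm_ge0 p0 p1 f p20.
case aE : (weak_morrey_norm q0 q1 g) A0 gfin => [a||]// a0 _.
case bE : (morrey_lorentz_norm p0 p1 p2 f) D0 ffin => [b||]// b0 _.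
rewrite lee_fin in a0; rewrite lee_fin in b0.
(* Either norm may vanish, so f and g are divided by slightly larger positive numbers. *)
rewrite -!EFinM; apply: le_mul_approx => //; first by rewrite ltW// !mulr_gt0.
move=> e e0.
have N10 : 0 < a + e by rewrite ltr_wpDl.
have N20 : 0 < b + e by rewrite ltr_wpDl.
move: (a + e) (b + e) N10 N20 (lerDl a e) (lerDl b e) => N1 N2 N10 N20.
rewrite !(ltW e0) => aN bN.
have N1i : 0 < N1^-1 by rewrite invr_gt0.
have N2i : 0 < N2^-1 by rewrite invr_gt0.
pose f' x := (N2^-1%:E * f x)%E.
pose g' x := (N1^-1%:E * g x)%E.
have hf' : (morrey_lorentz_norm p0 p1 p2 f' <= 1%:E)%E.
  apply: le_trans (morrey_lorentz_norm_scale_le p0 p1 f N2i p20) _.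
  by rewrite bE -EFinM lee_fin ler_pdivrMl// mulr1.
have hg' : (weak_morrey_norm q0 q1 g' <= 1%:E)%E.
  apply: le_trans (weak_morrey_norm_scale_le q0 q1 g N1i) _.
  by rewrite aE -EFinM lee_fin ler_pdivrMl// mulr1.
have mf' : measurable_fun setT f' by exact: measurable_funeM.
have mg' : measurable_fun setT g' by exact: measurable_funeM.
have mabs (u : Rn R n -> \bar R) : measurable_fun setT u ->
    measurable_fun setT (fun x => `|u x|%E).
  by move=> mu'; exact: (measurableT_comp (@abse_measurable R setT) mu').
have abs0 (u : Rn R n -> \bar R) x : (0 <= `|u x|)%E by exact: abse_ge0.
have hb := hB2 f' 1 ler01 hf'; rewrite powR1 mulr1 in hb.
have := hC _ _ (mabs _ mf') (abs0 f') (mabs _ mg') (abs0 g') (hB1 g' hg') hb.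
rewrite idxE; set v := (fun x => _) => hv.
(* [N1 * N2] undoes the normalisation and [M] is the loss in the kernel bound; divided by [K], the
   product g I_alpha f lies below the dyadic product [v]. *)
pose K := N1 * N2 * M.
have Kp : 0 < K by rewrite !mulr_gt0.
pose h x := (g x * fractional_integral alpha f x)%E.
pose h' x := (K^-1%:E * h x)%E.
have hh' : (fun x => K%:E * h' x)%E = h.
  by apply/funext => x; rewrite /h' muleA -EFinM mulfV ?mul1e// gt_eqF.
have h'v x : (`|h' x| <= v x)%E.
  pose P := potential (@lebesgue_Rn R n) n%:R (@dyadic_nbhd R n) alpha (fun y => `|f y|%E) x.
  have vE : v x = (K^-1%:E * (`|g x| * (M%:E * P)))%E.
    have Nf y : (`|f' y| = N2^-1%:E * `|f y|)%E.
      by rewrite abseM gee0_abs// lee_fin ltW.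
    have fE : (fun y => `|f' y|%E) = (fun y => N2^-1%:E * `|f y|)%E by exact/funext.
    have PZ := potentialZl (dyadic_system_Rn n) alpha x (mabs f mf) (abs0 f) (ltW N2i).
    have gE : (`|g' x| = N1^-1%:E * `|g x|)%E by rewrite abseM gee0_abs// lee_fin ltW.
    rewrite /v fE PZ gE -/P; move: P `|g x|%E => P u.
    rewrite muleACA -EFinM.
    rewrite [in RHS](muleCA u) [RHS]muleA -EFinM; congr (_%:E * _)%E.
    by rewrite /K; field; rewrite !gt_eqF.
  rewrite vE /h' /h abseM gee0_abs; last by rewrite lee_fin invr_ge0 ltW.
  rewrite lee_wpmul2l//; first by rewrite lee_fin invr_ge0 ltW.
  by rewrite abseM lee_wpmul2l//; exact: fractional_integral_le.
have := hCo h' v C (ltW C0) h'v hv.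
rewrite -/h -hh' => h'C.
apply: le_trans (morrey_lorentz_norm_scale_le _ _ _ Kp r20) _.
apply: le_trans (lee_wpmul2l _ h'C) _; first by rewrite lee_fin ltW.
rewrite -EFinM lee_fin /K le_eqVlt; apply/orP; left; apply/eqP.
by move: (C `^ _) => z; ring.
Qed.
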